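(* Let $\alpha \geq -1$ and let $\psi$ be a holomorphic function on $\mathbb{D}$ such that $\psi' \in A^2_\alpha(\mathbb{D})$. Then $$\|H_{\overline{\psi}}\|_{A^2_\alpha(\mathbb{D})\to L^2_\alpha(\mathbb{D})} \leq \frac{\|\psi'\|_{A^2(\mathbb{D})}}{\sqrt{2+\alpha}}.$$ Moreover, this inequality is sharp: for each $\alpha\ge -1$ the constant $1/\sqrt{2+\alpha}$ cannot be replaced by a smaller one.
   Context: $\mathbb{D}$ is the open unit disc in $\mathbb{C}$. For $\alpha>-1$ put $dA_\alpha(z) = (1+\alpha)(1-|z|^2)^\alpha\,\frac{dx\,dy}{\pi}$ and $L^2_\alpha(\mathbb{D}) = L^2(\mathbb{D}, dA_\alpha)$. Then $A^2_\alpha(\mathbb{D})$ is the closed subspace of holomorphic functions in $L^2_\alpha(\mathbb{D})$. The unweighted Bergman space is $A^2(\mathbb{D}) = A^2_0(\mathbb{D})$, with $\|g\|_{A^2(\mathbb{D})}^2 = \int_{\mathbb{D}}|g|^2\frac{dx\,dy}{\pi}$, and $\|g\|_{A^2(\mathbb{D})}=+\infty$ if this integral diverges. For $\alpha=-1$, $L^2_{-1}(\mathbb{D}) = L^2(\partial\mathbb{D}, |dz|/2\pi)$ and $A^2_{-1}(\mathbb{D})$ is the classical Hardy space $H^2(\mathbb{D})$, regarded via boundary values as the closure in $L^2(\partial \mathbb{D},|dz|/2\pi)$ of the rational functions with poles outside $\overline{\mathbb{D}}$. Symbols and functions are then understood through their boundary values. Let $P: L^2_\alpha(\mathbb{D})\to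 A^2_\alpha(\mathbb{D})$ be the orthogonal projection and $I$ the identity. The Hankel operator with symbol $\overline\psi$ is $H_{\overline\psi} f = (I-P)(\overline\psi f)$, defined for those $f\in A^2_\alpha(\mathbb{D})$ with $\overline\psi f\in L^2_\alpha(\mathbb{D})$. Its norm is the supremum (in $[0,\infty]$) of $\|H_{\overline\psi}f\|_{L^2_\alpha(\mathbb{D})}$ over all such $f$ with $\|f\|_{A^2_\alpha(\mathbb{D})}=1$. *)

(* Defs.v *)
From mathcomp Require Export all_boot all_order all_algebra complex.
From mathcomp Require Export all_classical all_reals all_analysis.
Export Order.TTheory GRing.Theory Num.Theory.
Export numFieldNormedType.Exports.
#[global] Set Implicit Arguments.
#[global] Unset Strict Implicit.
#[global] Unset Printing Implicit Defensive.

Local Open Scope classical_set_scope.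
Local Open Scope complex_scope.
Local Open Scope ring_scope.

(* R[i]^o is the field R[i] as a normed space over itself, so that derivable
   and derive1 below are complex differentiability and the complex derivative. *)
Notation CC R := ((R[i])^o).

Section WeightedL2.
Context {R : realType} {d : measure_display} {T : measurableType d}.
(* The space L^2(D, w dmu) of complex functions; only values on D matter, and
   two functions at L2norm-distance 0 represent the same element. *)
Variables (mu : {measure set T -> \bar R}) (D : set T) (w : T -> R).
Implicit Types (u v f g psi : T -> CC R) (H : set (T -> CC R)).

Definition L2norm u : \bar R :=
  sqrte (\int[mu]_(x in D) (w x * ComplexField.Normc.normc (u x) ^+ 2)%:E).

Definition L2 : set (T -> CC R) :=
  [set u | [/\ measurable_fun D (fun x => complex.Re (u x)),
               measurable_fun D (fun x => complex.Im (u x)) &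
               (L2norm u < +oo)%E]].

Definition L2inner u v : R[i] :=
  (\int[mu]_(x in D) (w x * complex.Re (u x * (v x)^*)))
  +i* (\int[mu]_(x in D) (w x * complex.Im (u x * (v x)^*))).

Definition is_orthproj H u g : Prop :=
  H g /\ forall h, H h -> L2inner (u \- g) h = 0.

(* When H is a closed subspace and u is in L2, is_orthproj H u g holds for some
   g, unique up to L2norm-distance 0. *)
Definition orthproj H u : T -> CC R := xget (fun=> 0) [set g | is_orthproj H u g].

(* The Hankel operator with symbol the conjugate of psi. *)
Definition hankel H psi f : T -> CC R :=
  let u := fun x => (psi x)^* * f x in u \- orthproj H u.

Definition hankel_dom H psi : set (T -> CC R) :=
  [set f | H f /\ L2 (fun x => (psi x)^* * f x)].

(* The 0 makes this the supremum in [0, +oo]: ereal_sup set0 is -oo. *)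
Definition hankel_opnorm H psi : \bar R :=
  ereal_sup ([set 0%E] `|`
    [set L2norm (hankel H psi f) | f in
       [set f | hankel_dom H psi f /\ L2norm f = 1%E]]).

End WeightedL2.

Section Disc.
Context {R : realType}.
Implicit Types (f g psi : CC R -> CC R) (alpha : R).

Definition holomorphic_disc f : Prop :=
  forall z : CC R, ComplexField.Normc.normc z < 1 -> derivable f z 1.

Definition plane_mu := ((@lebesgue_measure R) \x (@lebesgue_measure R))%E.

Definition toC (p : R * R) : CC R := p.1 +i* p.2.
Definition ofC (z : CC R) : R * R := (complex.Re z, complex.Im z).

Definition disc : set (R * R) := [set p | p.1 ^+ 2 + p.2 ^+ 2 < 1].

(* Density with respect to dx dy, meaningful on the disc only. *)
Definition dA alpha (p : R * R) : R :=
  (1 + alpha) * (1 - (p.1 ^+ 2 + p.2 ^+ 2)) `^ alpha / pi.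

Definition bergman alpha : set (R * R -> CC R) :=
  [set u | L2 plane_mu disc (dA alpha) u /\ holomorphic_disc (u \o ofC)].

Definition A2norm g : \bar R := L2norm plane_mu disc (dA 0) (g \o toC).

(* The unit circle is parametrized by the angle t in [0, 2 pi], with |dz|/(2 pi)
   becoming dt/(2 pi). *)
Definition circle (t : R) : CC R := cos t +i* sin t.
Definition angles : set R := `[0, 2 * pi].
Definition dtheta (t : R) : R := (2 * pi)^-1.

Definition circle_norm (u : R -> CC R) : \bar R :=
  L2norm lebesgue_measure angles dtheta u.

(* A^2_(-1) as a subspace of L^2 of the circle: the closure of the rational
   functions with poles outside the closed disc. *)
Definition hardy_bdry : set (R -> CC R) :=
  [set u : R -> CC R | L2 lebesgue_measure angles dtheta u /\
    forall e : R, 0 < e ->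
      exists p q : {poly R[i]},
        (forall z : R[i], ComplexField.Normc.normc z <= 1 -> q.[z] != 0) /\
        (circle_norm (fun t => u t - p.[circle t] / q.[circle t])%R < e%:E)%E].

(* Membership of a holomorphic function in the Hardy space cannot be read off
   its boundary values alone, hence the bound on the means over |z| = r. *)
Definition hardy_disc : set (CC R -> CC R) :=
  [set g | holomorphic_disc g /\
    exists M : R, forall r : R, 0 <= r < 1 ->
      (circle_norm (fun t => (g (r%:C * circle t))%R) <= M%:E)%E].

(* Radial limits; lim is a junk value where the limit does not exist. *)
Definition bdry psi (t : R) : CC R :=
  lim (psi (r%:C * circle t) @[r --> (1 : R)^'-]).

Definition in_A2 alpha g : Prop :=
  if alpha == -1 then hardy_disc g else bergman alpha (g \o toC).

Definition hankel_norm alpha psi : \bar R :=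
  if alpha == -1
  then hankel_opnorm lebesgue_measure angles dtheta hardy_bdry (bdry psi)
  else hankel_opnorm plane_mu disc (dA alpha) (bergman alpha) (psi \o toC).

End Disc.

(* Main.v *)
(* On A^2_alpha (and on H^2 for alpha = -1) the monomials are orthogonal, with squared
   norms gam n satisfying gam (n+1) (n + alpha + 2) = (n + 1) gam n.  For polynomials
   f = sum a_n z^n and psi = sum b_m z^m, the squared norm of (I - P)(conj(psi) f) is a
   quadratic form in the products a_n b_m; symmetrizing it gives nonnegative weights,
   and a Schur test with weights 1 / gam n, whose row sums are m / (2 + alpha), yields
   |H f|^2 <= (sum gam n |a_n|^2) (sum m |b_m|^2) / (2 + alpha),
   where the last sum is the Dirichlet integral of psi.  The general case follows by
   truncating both power series.  For psi = z and f = 1 the product conj(psi) f is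
   orthogonal to all holomorphic functions and has squared norm 1 / (2 + alpha), which
   gives sharpness. *)
Require Import Defs.
From mathcomp Require Import ring lra zify measurable_realfun.
Local Open Scope classical_set_scope.
Local Open Scope complex_scope.
Local Open Scope ring_scope.

(** The constant comes from [gam n * (sum over k <= n of 1 / gam k) = (n + alpha + 2) / (alpha +
    2)]: its values at [n + m] and at [n] differ by [m / (2 + alpha)], free of [n]. The weights are
    nonnegative because [gam] is log-convex, which rests on [alpha >= -1].

    Two obstacles shape the rest. [orthproj] is a choice with a default value, so each projection
    must be exhibited; and for an unbounded symbol the truncated products need not converge in norm
    to [conj psi * f]. On the disc the coefficients of the projection grow slowly enough to define a
    holomorphic function, and Fatou's lemma, fed with pointwise convergence, gives its membership
    and the bound together. On the circle [f] has only norm-convergent expansions, but [psi'] in H^2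
    makes the series of [psi] converge absolutely up to the boundary, so the bound passes through
    inner products, with a projection from Riesz-Fischer.

    Holomorphy is given only as pointwise complex differentiability, so power series are built from
    Goursat's theorem, carried to annuli by the exponential. *)

Notation Re := complex.Re.
Notation Im := complex.Im.
Notation normc := ComplexField.Normc.normc.

(** * Real and imaginary parts, modulus *)

Section ComplexParts.
Context {R : rcfType}.
Implicit Types x y z : R[i].

(** The squared modulus, real-valued and polynomial in the parts, so that identities about it reduce
    to [ring] without square roots. *)
Definition sqn z : R := Re z ^+ 2 + Im z ^+ 2.

Lemma complexP x y : Re x = Re y -> Im x = Im y -> x = y.
Proof. by case: x => a b; case: y => c d /= -> ->. Qed.

Lemma ReD x y : Re (x + y) = Re x + Re y. Proof. by case: x; case: y. Qed.
Lemma ImD x y : Im (x + y) = Im x + Im y. Proof. by case: x; case: y. Qed.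
Lemma ReN x : Re (- x) = - Re x. Proof. by case: x. Qed.
Lemma ImN x : Im (- x) = - Im x. Proof. by case: x. Qed.
Lemma ReM x y : Re (x * y) = Re x * Re y - Im x * Im y.
Proof. by case: x; case: y. Qed.
Lemma ImM x y : Im (x * y) = Re x * Im y + Im x * Re y.
Proof. by case: x; case: y. Qed.
Lemma ReJ x : Re (x^*) = Re x. Proof. by case: x. Qed.
Lemma ImJ x : Im (x^*) = - Im x. Proof. by case: x. Qed.
Lemma ReB x y : Re (x - y) = Re x - Re y. Proof. by rewrite ReD ReN. Qed.
Lemma ImB x y : Im (x - y) = Im x - Im y. Proof. by rewrite ImD ImN. Qed.
Lemma Re0 : Re (0 : R[i]) = 0. Proof. by []. Qed.
Lemma Im0 : Im (0 : R[i]) = 0. Proof. by []. Qed.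
Lemma Re1 : Re (1 : R[i]) = 1. Proof. by []. Qed.
Lemma Im1 : Im (1 : R[i]) = 0. Proof. by []. Qed.
Lemma ReR (r : R) : Re r%:C = r. Proof. by []. Qed.
Lemma ImR (r : R) : Im r%:C = 0. Proof. by []. Qed.
Lemma ReC (a b : R) : Re (a +i* b) = a. Proof. by []. Qed.
Lemma ImC (a b : R) : Im (a +i* b) = b. Proof. by []. Qed.

Definition partsE := (ReC, ImC, ReD, ImD, ReN, ImN, ReM, ImM, ReJ, ImJ, Re0, Im0, Re1, Im1,
  ReR, ImR).

Lemma Re_sum (I : Type) (s : seq I) (P : pred I) (F : I -> R[i]) :
  Re (\sum_(i <- s | P i) F i) = \sum_(i <- s | P i) Re (F i).
Proof. by rewrite (big_morph (@complex.Re R) ReD Re0). Qed.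

Lemma Im_sum (I : Type) (s : seq I) (P : pred I) (F : I -> R[i]) :
  Im (\sum_(i <- s | P i) F i) = \sum_(i <- s | P i) Im (F i).
Proof. by rewrite (big_morph (@complex.Im R) ImD Im0). Qed.

Lemma sqn_ge0 z : 0 <= sqn z.
Proof. by rewrite addr_ge0 ?sqr_ge0. Qed.

Lemma sqr_normc_sqn z : normc z ^+ 2 = sqn z.
Proof. by case: z => a b; rewrite /= sqr_sqrtr // addr_ge0 ?sqr_ge0. Qed.

Lemma normc_ge0 z : 0 <= normc z.
Proof. by case: z => a b /=; rewrite sqrtr_ge0. Qed.

Lemma normc_sqrt z : normc z = Num.sqrt (sqn z).
Proof. by case: z. Qed.

Lemma normrE z : `|z| = (normc z)%:C. Proof. by []. Qed.

Lemma mulJ_sqn z : z * z^* = (sqn z)%:C.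
Proof. apply: complexP; rewrite !partsE /sqn; ring. Qed.

Lemma sqnM x y : sqn (x * y) = sqn x * sqn y.
Proof. rewrite /sqn !partsE; ring. Qed.

Lemma sqnJ x : sqn (x^*) = sqn x.
Proof. by rewrite /sqn !partsE sqrrN. Qed.

Lemma sqn0 : sqn (0 : R[i]) = 0.
Proof. by rewrite /sqn !partsE expr0n addr0. Qed.

Lemma sqn1 : sqn (1 : R[i]) = 1.
Proof. by rewrite /sqn !partsE expr0n addr0 expr1n. Qed.

Lemma sqnR (r : R) : sqn (r%:C : R[i]) = r ^+ 2.
Proof. by rewrite /sqn !partsE expr0n addr0. Qed.

Lemma sqnN x : sqn (- x) = sqn x. Proof. by rewrite /sqn !partsE !sqrrN. Qed.

Lemma sqnX x n : sqn (x ^+ n) = sqn x ^+ n.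
Proof. by elim: n => [|n IH]; rewrite ?expr0 ?sqn1 // !exprS sqnM IH. Qed.

Lemma normcX x n : normc (x ^+ n) = normc x ^+ n.
Proof.
by elim: n => [|n IH]; rewrite ?expr0 ?ComplexField.Normc.normc1 // !exprS
  ComplexField.Normc.normcM IH.
Qed.

Lemma normc_conj x : normc (x^*) = normc x.
Proof. by rewrite !normc_sqrt sqnJ. Qed.

Lemma normcR (r : R) : normc (r%:C : R[i]) = `|r|.
Proof. by rewrite normc_sqrt sqnR sqrtr_sqr. Qed.

Lemma normc_sum (I : Type) (s : seq I) (P : pred I) (F : I -> R[i]) :
  normc (\sum_(i <- s | P i) F i) <= \sum_(i <- s | P i) normc (F i).
Proof.
elim/big_ind2: _ => // [|x1 x2 y1 y2 h1 h2]; first by rewrite ComplexField.Normc.normc0.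
exact: le_trans (le_normcD _ _) (lerD h1 h2).
Qed.

Lemma Re_le_normc z : `|Re z| <= normc z.
Proof.
by rewrite normc_sqrt -sqrtr_sqr ler_sqrt /sqn ?addr_ge0 ?sqr_ge0 // lerDl sqr_ge0.
Qed.

Lemma Im_le_normc z : `|Im z| <= normc z.
Proof.
by rewrite normc_sqrt -sqrtr_sqr ler_sqrt /sqn ?addr_ge0 ?sqr_ge0 // lerDr sqr_ge0.
Qed.

Lemma normc_le_parts z : normc z <= `|Re z| + `|Im z|.
Proof.
rewrite normc_sqrt -[leRHS]ger0_norm ?addr_ge0 // -(sqrtr_sqr (_ + _)).
rewrite ler_sqrt ?sqr_ge0 // /sqn sqrrD !real_normK ?num_real //.
have : 0 <= `|Re z| * `|Im z| by rewrite mulr_ge0.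
lra.
Qed.

Lemma sqnD_le x y : sqn (x + y) <= 2 * sqn x + 2 * sqn y.
Proof.
rewrite /sqn !partsE; have := sqr_ge0 (Re x - Re y); have := sqr_ge0 (Im x - Im y).
nra.
Qed.

Lemma normcB x y : normc (x - y) = normc (y - x).
Proof. by rewrite -normcN opprB. Qed.

End ComplexParts.

Arguments ComplexField.Normc.normc : simpl never.

Lemma squeeze_sqr {R : realFieldType} (x y : R) : x * y <= 2^-1 * (x ^+ 2 + y ^+ 2).
Proof. have := sqr_ge0 (x - y); lra. Qed.

(** * Weighted L^2 spaces of complex functions *)

Section WeightedL2Theory.
Context {R : realType} {d : measure_display} {T : measurableType d}.
Variables (mu : {measure set T -> \bar R}) (D : set T) (w : T -> R).
Hypothesis mD : measurable D.
Hypothesis mw : measurable_fun D w.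
Hypothesis w0 : forall x, D x -> 0 <= w x.
Implicit Types (u v f g F G : T -> CC R).

Definition cmeas F := measurable_fun D (fun x => Re (F x)) /\
  measurable_fun D (fun x => Im (F x)).

Definition cintegrable F :=
  mu.-integrable D (fun x => (Re (F x))%:E) /\ mu.-integrable D (fun x => (Im (F x))%:E).

Definition cint F : R[i] :=
  (\int[mu]_(x in D) Re (F x)) +i* (\int[mu]_(x in D) Im (F x)).

Lemma cmeasD F G : cmeas F -> cmeas G -> cmeas (F \+ G).
Proof.
move=> [a b] [c e]; split.
- by under eq_fun do rewrite /= ReD; apply: measurable_funD.
- by under eq_fun do rewrite /= ImD; apply: measurable_funD.
Qed.

Lemma cmeasM F G : cmeas F -> cmeas G -> cmeas (fun x => F x * G x).
Proof.
move=> [a b] [c e]; split.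
- by under eq_fun do rewrite /= ReM; apply: measurable_funB; apply: measurable_funM.
- by under eq_fun do rewrite /= ImM; apply: measurable_funD; apply: measurable_funM.
Qed.

Lemma cmeasJ F : cmeas F -> cmeas (fun x => (F x)^*).
Proof.
move=> [a b]; split; first by under eq_fun do rewrite ReJ.
by under eq_fun do rewrite ImJ; apply: measurable_funN.
Qed.

Lemma cmeas_cst (c : CC R) : cmeas (fun=> c).
Proof. by split; apply: measurable_cst. Qed.

Lemma cmeasR (r : T -> R) : measurable_fun D r -> cmeas (fun x => (r x)%:C).
Proof. by move=> h; split => //; apply: measurable_cst. Qed.

Lemma cmeasB F G : cmeas F -> cmeas G -> cmeas (F \- G).
Proof.
move=> [a b] [c e]; split.
- by under eq_fun do rewrite /= ReB; apply: measurable_funB.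
- by under eq_fun do rewrite /= ImB; apply: measurable_funB.
Qed.

Lemma cmeasX F n : cmeas F -> cmeas (fun x => F x ^+ n).
Proof.
move=> mF; elim: n => [|n IH]; first by under eq_fun do rewrite expr0; apply: cmeas_cst.
by under eq_fun do rewrite exprS; apply: cmeasM.
Qed.

Lemma cmeas_sqn F : cmeas F -> measurable_fun D (fun x => sqn (F x)).
Proof. by case=> a b; apply: measurable_funD; apply: measurable_funX. Qed.

Lemma cmeas_normc F : cmeas F -> measurable_fun D (fun x => normc (F x)).
Proof.
move=> m; under eq_fun do rewrite normc_sqrt -powR12_sqrt ?sqn_ge0 //.
exact: (measurableT_comp (@measurable_powR R _) (cmeas_sqn m)).
Qed.

Lemma eq_cint F G : (forall x, D x -> F x = G x) -> cint F = cint G.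
Proof.
move=> e; rewrite /cint; congr (_ +i* _); apply: eq_Rintegral => x; rewrite inE => /e ->//.
Qed.

Lemma cintD F G : cintegrable F -> cintegrable G ->
  cint (fun x => F x + G x) = cint F + cint G.
Proof.
move=> [a b] [c e]; apply: complexP; rewrite ?partsE /=.
- by rewrite -RintegralD //; apply: eq_Rintegral => x _; rewrite ReD.
- by rewrite -RintegralD //; apply: eq_Rintegral => x _; rewrite ImD.
Qed.

Lemma integrable_lincomb (a b : R) (f g : T -> R) :
  mu.-integrable D (EFin \o f) -> mu.-integrable D (EFin \o g) ->
  mu.-integrable D (EFin \o (fun x => a * f x + b * g x)).
Proof.
move=> h k; rewrite /comp; under eq_fun do rewrite EFinD !EFinM.
by apply: integrableD => //; apply: integrableZl.
Qed.

Lemma Rintegral_lincomb (a b : R) (f g : T -> R) :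
  mu.-integrable D (EFin \o f) -> mu.-integrable D (EFin \o g) ->
  \int[mu]_(x in D) (a * f x + b * g x) =
  a * (\int[mu]_(x in D) f x) + b * (\int[mu]_(x in D) g x).
Proof.
move=> h k; rewrite RintegralD //; [|rewrite /comp; under eq_fun do rewrite EFinM; exact: integrableZl..].
by rewrite !RintegralZl.
Qed.

Lemma cintegrableZ (c : CC R) F : cintegrable F -> cintegrable (fun x => c * F x).
Proof.
move=> [a b]; split.
- by under eq_fun do rewrite ReM -mulNr; exact: (integrable_lincomb (Re c) (- Im c) a b).
- by under eq_fun do rewrite ImM; exact: (integrable_lincomb (Re c) (Im c) b a).
Qed.

Lemma cintZ (c : CC R) F : cintegrable F -> cint (fun x => c * F x) = c * cint F.
Proof.
move=> [a b]; apply: complexP; rewrite ?partsE /=.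
- rewrite -mulNr -Rintegral_lincomb //; apply: eq_Rintegral => x _.
  by rewrite ReM mulNr.
- by rewrite -Rintegral_lincomb //; apply: eq_Rintegral => x _; rewrite ImM.
Qed.

Lemma cintJ F : cintegrable F -> cint (fun x => (F x)^*) = (cint F)^*.
Proof.
move=> [a b]; apply: complexP; rewrite ?partsE /=.
- by apply: eq_Rintegral => x _; rewrite ReJ.
- rewrite -mulN1r -RintegralZl //; apply: eq_Rintegral => x _; by rewrite ImJ mulN1r.
Qed.

Lemma cint0 : cint (fun=> 0) = 0.
Proof. by rewrite /cint /= /Rintegral integral0. Qed.

Lemma cintegrable_le F (g : T -> R) : cmeas F ->
  (forall x, D x -> normc (F x) <= g x) -> mu.-integrable D (EFin \o g) -> cintegrable F.
Proof.
move=> [a b] h ig; split; (apply: le_integrable ig => //; first exact/measurable_EFinP) => x Dx.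
- by rewrite /= lee_fin (le_trans (Re_le_normc _)) // (le_trans (h _ Dx)) // ler_norm.
- by rewrite /= lee_fin (le_trans (Im_le_normc _)) // (le_trans (h _ Dx)) // ler_norm.
Qed.

(** As the [fine] part of an extended integral this is 0 when the integral diverges, so upper bounds
    on it carry information only for [u] in [L2]. *)
Definition nrm2 u : R := \int[mu]_(x in D) (w x * sqn (u x)).

Local Notation L2 := (L2 mu D w).
Local Notation inner := (L2inner mu D w).
Local Notation L2norm := (L2norm mu D w).

Lemma L2norm_sqn u : L2norm u = sqrte (\int[mu]_(x in D) (w x * sqn (u x))%:E).
Proof. by rewrite /Defs.L2norm; under eq_integral do rewrite sqr_normc_sqn. Qed.

Lemma wsqn_ge0 u x : D x -> (0 <= (w x * sqn (u x))%:E)%E.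
Proof. by move=> Dx; rewrite lee_fin mulr_ge0 ?w0 ?sqn_ge0. Qed.

Lemma N2_ge0 u : (0 <= \int[mu]_(x in D) (w x * sqn (u x))%:E)%E.
Proof. by apply: integral_ge0 => x; exact: wsqn_ge0. Qed.

Lemma wsqn_meas u : cmeas u -> measurable_fun D (EFin \o (fun x => w x * sqn (u x))).
Proof. by move=> m; apply/measurable_EFinP/measurable_funM => //; exact: cmeas_sqn. Qed.

(** [sqrte] is finite exactly on finite arguments, so the condition on [L2norm] becomes
    integrability, the form that the integration lemmas consume. *)
Lemma L2P u : L2 u <-> cmeas u /\ mu.-integrable D (EFin \o (fun x => w x * sqn (u x))).
Proof.
have abse : (\int[mu]_(x in D) `|(w x * sqn (u x))%:E| =
  \int[mu]_(x in D) (w x * sqn (u x))%:E)%E.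
  by apply: eq_integral => x; rewrite inE => Dx; rewrite gee0_abs // wsqn_ge0.
split=> [[a b]|[[a b] /integrableP[_]]].
  rewrite L2norm_sqn => c; split; first by [].
  apply/integrableP; split; first exact: wsqn_meas.
  rewrite /comp abse; have := N2_ge0 u.
  move: c; case: (X in sqrte X) => [r _ _|//|//]; exact: ltry.
rewrite /comp abse => c; split => //; rewrite L2norm_sqn.
have := N2_ge0 u.
move: c; case: (X in (X < _)%E) => [r _ _|//|//]; exact: ltry.
Qed.

Lemma L2_cmeas u : L2 u -> cmeas u. Proof. by case/L2P. Qed.

Lemma L2_integral u : L2 u -> (\int[mu]_(x in D) (w x * sqn (u x))%:E = (nrm2 u)%:E)%E.
Proof.
move=> /L2P[_ i]; rewrite /nrm2 /Rintegral fineK //.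
by apply: integrable_fin_num.
Qed.

Lemma L2normE u : L2 u -> L2norm u = (Num.sqrt (nrm2 u))%:E.
Proof. by move=> h; rewrite L2norm_sqn L2_integral. Qed.

Lemma nrm2_ge0 u : 0 <= nrm2 u.
Proof. by apply: Rintegral_ge0 => x Dx; rewrite mulr_ge0 ?w0 ?sqn_ge0. Qed.

Lemma L2_le u (g : T -> R) : cmeas u -> (forall x, D x -> w x * sqn (u x) <= g x) ->
  mu.-integrable D (EFin \o g) -> L2 u.
Proof.
move=> m h ig; apply/L2P; split => //; apply: le_integrable ig => //.
  exact: wsqn_meas.
move=> x Dx; rewrite /= lee_fin ger0_norm ?mulr_ge0 ?w0 ?sqn_ge0 //.
by rewrite (le_trans (h _ Dx)) // ler_norm.
Qed.

Lemma L2D u v : L2 u -> L2 v -> L2 (u \+ v).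
Proof.
move=> /L2P[mu1 iu] /L2P[mv iv]; apply: L2_le (integrable_lincomb 2 2 iu iv).
  exact: cmeasD.
move=> x Dx /=; rewrite (le_trans (ler_wpM2l (w0 Dx) (sqnD_le _ _))) // mulrDr.
by rewrite ![w x * (2 * _)]mulrCA.
Qed.

Lemma L2Z (c : CC R) u : L2 u -> L2 (fun x => c * u x).
Proof.
move=> /L2P[mu1 iu]; apply: L2_le (integrable_lincomb (sqn c) 0 iu iu).
  by apply: cmeasM => //; exact: cmeas_cst.
by move=> x Dx /=; rewrite sqnM mul0r addr0 mulrCA.
Qed.

Lemma L2B u v : L2 u -> L2 v -> L2 (u \- v).
Proof.
move=> hu hv; rewrite (_ : u \- v = u \+ (fun x => -1 * v x)).
  exact: L2D hu (L2Z _ hv).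
by apply/funext => x /=; rewrite mulN1r.
Qed.

Lemma L2J u : L2 u -> L2 (fun x => (u x)^*).
Proof.
move=> /L2P[mu1 iu]; apply/L2P; split; first exact: cmeasJ.
by rewrite /comp; under eq_fun do rewrite sqnJ.
Qed.

Lemma L2_0 : L2 (fun=> 0).
Proof.
apply/L2P; split; first exact: cmeas_cst.
by rewrite /comp; under eq_fun do rewrite sqn0 mulr0; apply: integrable0.
Qed.

Lemma L2_sum (I : Type) (s : seq I) (F : I -> T -> CC R) :
  (forall i, L2 (F i)) -> L2 (fun x => \sum_(i <- s) F i x).
Proof.
move=> h; elim: s => [|i s IH].
  by under eq_fun do rewrite big_nil; exact: L2_0.
by under eq_fun do rewrite big_cons; exact: L2D.
Qed.

Lemma L2_bounded (C : R) F u : cmeas F -> (forall x, D x -> sqn (F x) <= C) -> L2 u ->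
  L2 (fun x => F x * u x).
Proof.
move=> mF hF /L2P[mu1 iu]; apply: L2_le (integrable_lincomb C 0 iu iu).
  exact: cmeasM.
move=> x Dx /=; rewrite sqnM mul0r addr0 mulrCA ler_wpM2r ?hF //.
by rewrite mulr_ge0 ?w0 ?sqn_ge0.
Qed.

Lemma L2_eq u v : (forall x, D x -> u x = v x) -> L2 u -> L2 v.
Proof.
move=> e /L2P[[a b] iu]; have m : cmeas v.
  split; first by apply: eq_measurable_fun a => x; rewrite inE => /e ->.
  by apply: eq_measurable_fun b => x; rewrite inE => /e ->.
apply: L2_le iu => // x Dx; by rewrite /= (e _ Dx).
Qed.

Definition wprod u v : T -> CC R := fun x => (w x)%:C * (u x * (v x)^*).

Lemma innerE u v : inner u v = cint (wprod u v).
Proof.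
by apply: complexP => /=; apply: eq_Rintegral => x _; rewrite /wprod ?ReM ?ImM !partsE; ring.
Qed.

Lemma wprod_cint u v : L2 u -> L2 v -> cintegrable (wprod u v).
Proof.
move=> /L2P[mu1 iu] /L2P[mv iv].
apply: cintegrable_le (integrable_lincomb 2^-1 2^-1 iu iv).
  by apply: cmeasM; [exact: cmeasR | apply: cmeasM => //; exact: cmeasJ].
move=> x Dx; rewrite /wprod !ComplexField.Normc.normcM normcR ger0_norm ?w0 // normc_conj.
rewrite -!sqr_normc_sqn; have h := w0 Dx.
have := ler_wpM2l h (squeeze_sqr (normc (u x)) (normc (v x))); lra.
Qed.

Lemma innerDl u1 u2 v : L2 u1 -> L2 u2 -> L2 v ->
  inner (u1 \+ u2) v = inner u1 v + inner u2 v.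
Proof.
move=> h1 h2 h; rewrite !innerE -cintD; [|exact: wprod_cint..].
by apply: eq_cint => x _; rewrite /wprod /= mulrDl mulrDr.
Qed.

Lemma innerZl (c : CC R) u v : L2 u -> L2 v ->
  inner (fun x => c * u x) v = c * inner u v.
Proof.
move=> h1 h; rewrite !innerE -cintZ; [|exact: wprod_cint].
by apply: eq_cint => x _; rewrite /wprod /= -mulrA mulrCA.
Qed.

Lemma innerBl u1 u2 v : L2 u1 -> L2 u2 -> L2 v ->
  inner (u1 \- u2) v = inner u1 v - inner u2 v.
Proof.
move=> h1 h2 h; rewrite -mulN1r -innerZl // -innerDl //; last exact: L2Z.
by rewrite !innerE; apply: eq_cint => x _; rewrite /wprod /= mulN1r.
Qed.

Lemma innerJ u v : L2 u -> L2 v -> inner v u = (inner u v)^*.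
Proof.
move=> h1 h; rewrite !innerE -cintJ; last exact: wprod_cint.
by apply: eq_cint => x _; apply: complexP; rewrite /wprod !partsE; ring.
Qed.

Lemma inner_suml (I : Type) (s : seq I) (F : I -> T -> CC R) v :
  (forall i, L2 (F i)) -> L2 v ->
  inner (fun x => \sum_(i <- s) F i x) v = \sum_(i <- s) inner (F i) v.
Proof.
move=> h hv; elim: s => [|i s IH].
  rewrite big_nil innerE -[RHS]cint0; apply: eq_cint => x _.
  by rewrite /wprod big_nil mul0r mulr0.
rewrite big_cons -IH -innerDl //; last exact: L2_sum.
by rewrite !innerE; apply: eq_cint => x _; rewrite /wprod /= big_cons.
Qed.

Lemma eq_inner u v u' v' : (forall x, D x -> u x = u' x) -> (forall x, D x -> v x = v' x) ->
  inner u v = inner u' v'.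
Proof.
by move=> e e'; rewrite !innerE; apply: eq_cint => x Dx; rewrite /wprod e ?e'.
Qed.

Lemma innerDr u v1 v2 : L2 u -> L2 v1 -> L2 v2 ->
  inner u (v1 \+ v2) = inner u v1 + inner u v2.
Proof.
move=> h h1 h2; rewrite innerJ ?innerDl //; last exact: L2D.
by rewrite rmorphD /= -!innerJ.
Qed.

Lemma innerBr u v1 v2 : L2 u -> L2 v1 -> L2 v2 ->
  inner u (v1 \- v2) = inner u v1 - inner u v2.
Proof.
move=> h h1 h2; rewrite innerJ ?innerBl //; last exact: L2B.
by rewrite rmorphB /= -!innerJ.
Qed.

Lemma innerZr (c : CC R) u v : L2 u -> L2 v ->
  inner u (fun x => c * v x) = c^* * inner u v.
Proof.
move=> h h1; rewrite innerJ ?innerZl //; last exact: L2Z.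
by rewrite rmorphM /= -!innerJ.
Qed.

Lemma inner_sumr (I : Type) (s : seq I) (F : I -> T -> CC R) u :
  (forall i, L2 (F i)) -> L2 u ->
  inner u (fun x => \sum_(i <- s) F i x) = \sum_(i <- s) inner u (F i).
Proof.
move=> h hv; rewrite innerJ ?inner_suml //; last exact: L2_sum.
by rewrite rmorph_sum /=; apply: eq_bigr => i _; rewrite -innerJ.
Qed.

Lemma inner_self u : inner u u = (nrm2 u)%:C.
Proof.
rewrite innerE; apply: complexP; rewrite ?partsE /=.
- by apply: eq_Rintegral => x _; rewrite /wprod mulJ_sqn !partsE; ring.
- rewrite -[RHS]/(Im 0) -cint0 /=; apply: eq_Rintegral => x _; rewrite /wprod mulJ_sqn !partsE; ring.
Qed.

Lemma nrm2D u v : L2 u -> L2 v ->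
  nrm2 (u \+ v) = nrm2 u + nrm2 v + 2 * Re (inner u v).
Proof.
move=> hu hv; apply: complexI; rewrite -inner_self innerDl //; last exact: L2D.
rewrite !innerDr // !inner_self (innerJ hu hv).
by apply: complexP; rewrite !partsE; ring.
Qed.

Lemma nrm2Z (c : CC R) u : L2 u -> nrm2 (fun x => c * u x) = sqn c * nrm2 u.
Proof.
move=> hu; apply: complexI; rewrite -inner_self innerZl //; last exact: L2Z.
by rewrite innerZr // inner_self mulrA mulJ_sqn -rmorphM.
Qed.

Lemma nrm2B u v : L2 u -> L2 v ->
  nrm2 (u \- v) = nrm2 u + nrm2 v - 2 * Re (inner u v).
Proof.
move=> hu hv; apply: complexI; rewrite -inner_self innerBl //; last exact: L2B.
rewrite !innerBr // !inner_self (innerJ hu hv).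
by apply: complexP; rewrite !partsE; ring.
Qed.

Lemma cauchy_schwarz u v : L2 u -> L2 v -> sqn (inner u v) <= nrm2 u * nrm2 v.
Proof.
move=> hu hv; set k := inner u v.
(* Subtracting real multiples of [k * v] from [u] makes the cross term the real number [t * sqn k],
   so a real quadratic in [t] remains. *)
have key (t : R) : 0 <= nrm2 u + t ^+ 2 * sqn k * nrm2 v - 2 * (t * sqn k).
  have := nrm2_ge0 (u \- (fun x => (t%:C * k) * v x)).
  rewrite nrm2B //; last exact: L2Z.
  rewrite nrm2Z // innerZr // sqnM sqnR.
  have -> : Re ((t%:C * k)^* * k) = t * sqn k by rewrite /sqn !partsE; ring.
  by [].
have s0 := sqn_ge0 k; have n0 := nrm2_ge0 v; have u0 := nrm2_ge0 u.
have [v0|vp] := eqVneq (nrm2 v) 0.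
  rewrite v0 mulr0 leNgt; apply/negP => sp.
  (* The form is now affine in [t], and this [t] gives it the value [- nrm2 u - 2 < 0]. *)
  have := key ((nrm2 u + 1) / sqn k); rewrite v0 mulr0 addr0.
  by rewrite mulfVK ?gt_eqF //; lra.
have vp' : 0 < nrm2 v by rewrite lt_def vp n0.
have := key ((nrm2 v)^-1).
have -> : (nrm2 v)^-1 ^+ 2 * sqn k * nrm2 v = (nrm2 v)^-1 * sqn k by field.
move=> h; rewrite -[_ <= _ * _]subr_ge0 -(@pmulr_rge0 _ (nrm2 v)^-1) ?invr_gt0 //.
have -> : (nrm2 v)^-1 * (nrm2 u * nrm2 v - sqn k) = nrm2 u - (nrm2 v)^-1 * sqn k by field.
lra.
Qed.

Lemma nrm2_sqrtD u v : L2 u -> L2 v ->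
  Num.sqrt (nrm2 (u \+ v)) <= Num.sqrt (nrm2 u) + Num.sqrt (nrm2 v).
Proof.
move=> hu hv; rewrite -[leRHS]ger0_norm ?addr_ge0 ?sqrtr_ge0 // -(sqrtr_sqr (_ + _)).
rewrite ler_sqrt ?sqr_ge0 // nrm2D // sqrrD !sqr_sqrtr ?nrm2_ge0 //.
rewrite -sqrtrM ?nrm2_ge0 //.
have : Re (inner u v) <= Num.sqrt (nrm2 u * nrm2 v).
  apply: le_trans (ler_norm _) (le_trans (Re_le_normc _) _).
  by rewrite normc_sqrt ler_wsqrtr // cauchy_schwarz.
lra.
Qed.

(** Serves where limits are known only pointwise: membership in [L2] and the bound come out
    together, with no norm convergence in the hypotheses. *)
Lemma L2_fatou (F : (T -> CC R)^nat) u (B : R) :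
  (forall n, cmeas (F n)) -> cmeas u ->
  (forall n, L2 (F n) /\ nrm2 (F n) <= B) ->
  (forall x, D x -> (sqn (F n x - u x)) @[n --> \oo] --> (0 : R)) ->
  L2 u /\ nrm2 u <= B.
Proof.
move=> mF mu1 hF cF.
have cv x : D x -> (w x * sqn (F n x))%:E @[n --> \oo] --> (w x * sqn (u x))%:E.
  move=> Dx; apply: cvg_EFin; first by near=> n.
  apply: cvgMl_tmp; have := cF _ Dx => h.
  have reim (g : CC R -> R) : (forall z z', g (z - z') = g z - g z') ->
      (forall z, g z ^+ 2 <= sqn z) -> g (F n x) @[n --> \oo] --> g (u x).
    move=> gB gle; apply/cvgrPdist_le => e e0.
    have e2 : 0 < e ^+ 2 by rewrite exprn_gt0.
    move/cvgrPdist_le : h => /(_ _ e2) [N _ hN]; exists N => // n /hN /=.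
    rewrite sub0r normrN ger0_norm ?sqn_ge0 // => h1.
    rewrite -gB -(@ler_pXn2r _ 2) ?nnegrE // ?(ltW e0) // real_normK ?num_real //.
    by apply: le_trans h1; rewrite (le_trans (gle _)) // -opprB /sqn !partsE !sqrrN.
  have hr : Re (F n x) @[n --> \oo] --> Re (u x).
    by apply: (reim (@complex.Re R)) => *; rewrite ?ReB // /sqn lerDl sqr_ge0.
  have hi : Im (F n x) @[n --> \oo] --> Im (u x).
    by apply: (reim (@complex.Im R)) => *; rewrite ?ImB // /sqn lerDr sqr_ge0.
  by rewrite /sqn !expr2; apply: cvgD; apply: cvgM.
have := @fatou _ _ _ mu D mD (fun n x => (w x * sqn (F n x))%:E)
  (fun n => wsqn_meas (mF n)) (fun n x Dx => wsqn_ge0 _ Dx).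
have -> : (\int[mu]_(x in D) limn_einf ((fun n x => (w x * sqn (F n x))%:E) ^~ x) =
  \int[mu]_(x in D) (w x * sqn (u x))%:E)%E.
  by apply: eq_integral => x; rewrite inE => Dx; rewrite (cvg_limn_einf_sup (cv _ Dx)).1.
have le : (limn_einf (fun n => \int[mu]_(x in D) (w x * sqn (F n x))%:E) <= B%:E)%E.
  rewrite limn_einf_lim; apply: lime_le; first exact: is_cvg_einfs.
  near=> n; apply: (@le_trans _ _ (\int[mu]_(x in D) (w x * sqn (F n x))%:E)%E).
    by apply: ereal_inf_lbound; exists n => /=.
  by rewrite (L2_integral (hF n).1) lee_fin (hF n).2.
move=> /le_trans/(_ le) fle.
have Lu : L2 u.
  case: (mu1) => a b; split => //; rewrite L2norm_sqn.
  have := N2_ge0 u.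
  move: fle; case: (\int[mu]_(x in D) _)%E => [r _ _|//|//]; exact: ltry.
by split => //; move: fle; rewrite L2_integral.
Unshelve. all: by end_near. Qed.

Lemma nrm2_subxx u : nrm2 (u \- u) = 0.
Proof.
rewrite /nrm2 /Rintegral (eq_integral (fun=> 0%E)) ?integral0 // => x _ /=.
by rewrite subrr sqn0 mulr0.
Qed.

End WeightedL2Theory.

(** * The finite Hankel inequality *)

Section SchurTest.
Context {R : realType}.
Variables (alpha : R) (gam : nat -> R).
Hypothesis halpha : -1 <= alpha.
Hypothesis gam_gt0 : forall n, 0 < gam n.
Hypothesis gam_rec : forall n, gam n.+1 * (n%:R + alpha + 2) = n.+1%:R * gam n.

Let den_gt0 n : 0 < n%:R + alpha + 2.
Proof. by move: (ler0n R n) halpha; move: n%:R => x; lra. Qed.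

Lemma gamS n : gam n.+1 = n.+1%:R / (n%:R + alpha + 2) * gam n.
Proof. by rewrite mulrAC -gam_rec mulfK // gt_eqF. Qed.

(** The ratios [gam k.+1 / gam k = (k + 1) / (k + alpha + 2)] are nondecreasing in [k] because
    [alpha + 2 >= 1]; each step of the induction on [m] multiplies the two sides by one such
    ratio. *)
Lemma gam_log_convex k m m' : gam (k + m') * gam (k + m) <= gam (k + m + m') * gam k.
Proof.
elim: m => [|m IH]; first by rewrite addn0.
rewrite addnS addSn !gamS mulrCA -[leRHS]mulrA.
have rle : (k + m).+1%:R / ((k + m)%:R + alpha + 2) <=
    (k + m + m').+1%:R / ((k + m + m')%:R + alpha + 2) :> R.
  rewrite ler_pdivrMr // mulrAC ler_pdivlMr // -![_.+1%:R]natr1 (natrD _ (k + m)).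
  by move: (ler0n R m') halpha; move: m'%:R (k + m)%:R => x y; nra.
apply: ler_pM => //; first by rewrite divr_ge0 // ltW.
by rewrite mulr_ge0 // ltW.
Qed.

(** The recursion of [gam] makes the sum of the inverses telescope. The constant [1 / (2 + alpha)]
    of the theorem originates here. *)
Lemma gam_sumV n : gam n * (\sum_(k < n.+1) (gam k)^-1) = (n%:R + alpha + 2) / (alpha + 2).
Proof.
have a2 : alpha + 2 != 0 by rewrite gt_eqF //; have := halpha; lra.
elim: n => [|n IH]; first by rewrite big_ord1 divff ?gt_eqF // add0r divff.
rewrite big_ord_recr /= mulrDr divff ?gt_eqF // gamS -[_ * gam n * _]mulrA IH -natr1.
have := den_gt0 n => /gt_eqF/negbT d0; field.
by rewrite a2 d0.
Qed.

(** The coefficient of [Re (a_n b_m conj(a_n' b_m'))] in the squared distance of the product to its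
    projection. The term [gam (n + m)] comes from the squared norm of [psi * f], the quotient from
    the component of the projection along the power [n - m']; the guard [m' <= n] discards the
    negative powers, which the truncated subtraction would hide. *)
Definition schur_coef (n m n' m' : nat) : R := (n + m == n' + m')%N%:R *
  (gam (n + m) - (m' <= n)%N%:R * (gam n * gam n' / gam (n - m'))).

(** Log-convexity at [k = n - m'] with shifts [m] and [m']: then [k + m' = n], [k + m = n'] and
    [k + m + m' = n + m]. *)
Lemma schur_coef_ge0 n m n' m' : 0 <= schur_coef n m n' m'.
Proof.
rewrite /schur_coef; case: eqP => [e|_]; last by rewrite mul0r.
rewrite mul1r; case: leqP => [le|_]; last by rewrite mul0r subr0 ltW.
rewrite mul1r subr_ge0 ler_pdivrMr //.
have := gam_log_convex (n - m') m m'.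
have e1 : (n - m' + m = n')%N by lia.
by rewrite subnK // e1 -e.
Qed.

Lemma schur_coefC n m n' m' : schur_coef n' m' n m = schur_coef n m n' m'.
Proof.
rewrite /schur_coef [(n' + m' == _)%N]eq_sym; case: eqP => [e|_]; last by rewrite !mul0r.
have e1 : (m <= n')%N = (m' <= n)%N by lia.
have e2 : (n' - m = n - m')%N by lia.
by rewrite e1 e2 -e [gam n' * _]mulrC.
Qed.

Lemma schur_row_sum n m K : (n < K)%N -> (m < K)%N ->
  \sum_(n' < K) \sum_(m' < K) schur_coef n m n' m' / gam n' <= m%:R / (2 + alpha).
Proof.
move=> nK mK; set N := (n + m)%N.
(* On the diagonal [n' + m' = N] each [n'] leaves the single entry [m' = N - n']; [c n'] is this
   entry. *)
pose c n' := gam N / gam n' - (N - n' <= n)%N%:R * (gam n / gam (n - (N - n'))).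
have cE n' : (n' <= N)%N -> schur_coef n m n' (N - n') / gam n' = c n'.
  move=> le; rewrite /schur_coef subnKC // eqxx mul1r /c -/N mulrBl; congr (_ - _).
  have g0 : gam n' != 0 by rewrite gt_eqF.
  have g1 : gam (n - (N - n')) != 0 by rewrite gt_eqF.
  by field; rewrite g0 g1.
(* Since every [c n'] is nonnegative, lifting the cutoff [K] only enlarges the sum. Both sums are
   widened to [N.+1 + K] to be compared term by term. *)
apply: (@le_trans _ _ (\sum_(n' < N.+1) c n')).
  rewrite (_ : \sum_(n' < N.+1) c n' = \sum_(n' < N.+1 + K | (n' < N.+1)%N) c n'); last first.
    by rewrite (big_ord_widen (N.+1 + K) c) // leq_addr.
  rewrite (big_ord_widen (N.+1 + K) (fun n' => \sum_(m' < K) schur_coef n m n' m' / gam n')) ?leq_addl //.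
  rewrite big_mkcond [leRHS]big_mkcond /=; apply: ler_sum => n' _.
  have c0 : (n' < N.+1)%N -> 0 <= c n'.
    move=> le; rewrite -cE; last by rewrite -ltnS.
    by rewrite divr_ge0 ?schur_coef_ge0 // ltW.
  case: (ltnP n' N.+1) => [le|gt]; last first.
    case: ifP => // _; rewrite big1 // => m' _.
    by rewrite /schur_coef -/N (_ : (N == n' + m')%N = false) ?mul0r //; lia.
  case: ifP => [n'K|_]; last exact: c0.
  have [lt|ge] := ltnP (N - n') K.
    rewrite (bigD1 (Ordinal lt)) //= cE -1?ltnS // big1 ?addr0 // => m' ne.
    rewrite /schur_coef -/N (_ : (N == n' + m')%N = false) ?mul0r //.
    by apply/eqP => e; move/eqP: ne; apply; apply: val_inj => /=; lia.
  rewrite big1 ?c0 // => m' _.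
  rewrite /schur_coef -/N (_ : (N == n' + m')%N = false) ?mul0r //.
  by have := ltn_ord m'; lia.
rewrite /c sumrB -mulr_sumr gam_sumV.
(* Reversing both sums replaces [N - n'] by the summation index, and the guard then cuts the range
   down to [n.+1], which makes [gam_sumV] apply a second time, at [n]. *)
have -> : \sum_(n' < N.+1) (N - n' <= n)%N%:R * (gam n / gam (n - (N - n'))) =
    gam n * \sum_(k < n.+1) (gam k)^-1.
  rewrite mulr_sumr (reindex_inj rev_ord_inj) /=.
  rewrite [RHS](reindex_inj rev_ord_inj) /=.
  rewrite (big_ord_widen N.+1 (fun k => gam n / gam (n.+1 - k.+1))) ?ltnS ?leq_addr //.
  rewrite [RHS]big_mkcond /=; apply: eq_bigr => k _.
  rewrite subSS (_ : (N - (N - k))%N = k); last by have := ltn_ord k; lia.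
  by rewrite subSS ltnS; case: ifP; rewrite ?mul1r ?mul0r.
rewrite gam_sumV /N natrD; have a2 : alpha + 2 != 0 by rewrite gt_eqF //; have := halpha; lra.
by rewrite le_eqVlt; apply/orP; left; apply/eqP; field; rewrite addrC a2.
Qed.

Lemma sqn_sum2 (I J : finType) (c : I -> J -> R) (z : I -> J -> R[i]) :
  sqn (\sum_i \sum_j (c i j)%:C * z i j) =
  \sum_i \sum_j \sum_i' \sum_j' (c i j * c i' j') * Re (z i j * (z i' j')^*).
Proof.
rewrite -[LHS](ReR (sqn _)) -mulJ_sqn rmorph_sum mulr_suml Re_sum.
apply: eq_bigr => i _; rewrite mulr_suml Re_sum; apply: eq_bigr => j _.
rewrite mulr_sumr Re_sum; apply: eq_bigr => i' _.
rewrite rmorph_sum mulr_sumr Re_sum; apply: eq_bigr => j' _.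
by rewrite rmorphM /= !partsE; ring.
Qed.

Lemma sum4_le (K : nat) (F G : nat -> nat -> nat -> nat -> R) :
  (forall n m n' m', F n m n' m' <= G n m n' m') ->
  \sum_(n < K) \sum_(m < K) \sum_(n' < K) \sum_(m' < K) F n m n' m' <=
  \sum_(n < K) \sum_(m < K) \sum_(n' < K) \sum_(m' < K) G n m n' m'.
Proof. by move=> h; do 4 (apply: ler_sum => ? _). Qed.

(* Expanding both squares, the terms indexed by n + m = n' + m' and n - m = n' - m'
   match after exchanging m and m'; what remains is a quadratic form with the
   nonnegative coefficients [schur_coef], to which the Schur test with the weights
   1 / gam n applies, with equality in every row. *)
Lemma hankel_finite_inequality (a b : nat -> R[i]) (K : nat) :
  \sum_(N < K + K) gam N *
     sqn (\sum_(n < K) \sum_(m < K) ((n + m == N)%N%:R)%:C * (a n * b m)) -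
  \sum_(k < K) (gam k)^-1 *
     sqn (\sum_(n < K) \sum_(m < K) ((n == m + k :> nat)%N%:R * gam n)%:C * (a n * (b m)^*))
  <= (\sum_(n < K) gam n * sqn (a n)) * (\sum_(m < K) m%:R * sqn (b m)) / (2 + alpha).
Proof.
pose X n m n' m' := Re (a n * b m * (a n' * b m')^*).
have E1 : \sum_(N < K + K) gam N *
    sqn (\sum_(n < K) \sum_(m < K) ((n + m == N)%N%:R)%:C * (a n * b m)) =
    \sum_(n < K) \sum_(m < K) \sum_(n' < K) \sum_(m' < K)
      ((n + m == n' + m')%N%:R * gam (n + m)) * X n m n' m'.
  under eq_bigr do rewrite sqn_sum2 mulr_sumr.
  rewrite exchange_big; apply: eq_bigr => n _.
  under eq_bigr do rewrite mulr_sumr.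
  rewrite exchange_big; apply: eq_bigr => m _.
  under eq_bigr do rewrite mulr_sumr.
  rewrite exchange_big; apply: eq_bigr => n' _.
  under eq_bigr do rewrite mulr_sumr.
  rewrite exchange_big; apply: eq_bigr => m' _.
  have lt : (n + m < K + K)%N by have := ltn_ord n; have := ltn_ord m; lia.
  rewrite (bigD1 (Ordinal lt)) //= eqxx big1 ?addr0 => [|N ne].
    by rewrite mul1r /X eq_sym; ring.
  rewrite (_ : (n + m == N)%N = false) ?mul0r ?mulr0 //.
  by apply/eqP => e; move/eqP: ne; apply; apply: val_inj.
have E2 : \sum_(k < K) (gam k)^-1 *
    sqn (\sum_(n < K) \sum_(m < K) ((n == m + k :> nat)%N%:R * gam n)%:C * (a n * (b m)^*)) =
    \sum_(n < K) \sum_(m < K) \sum_(n' < K) \sum_(m' < K)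
      ((n + m == n' + m')%N%:R * ((m' <= n)%N%:R * (gam n * gam n' / gam (n - m'))))
       * X n m n' m'.
  under eq_bigr do rewrite sqn_sum2 mulr_sumr.
  rewrite exchange_big; apply: eq_bigr => n _.
  under eq_bigr do rewrite mulr_sumr.
  rewrite exchange_big /=.
  under eq_bigr do under eq_bigr do rewrite mulr_sumr.
  under eq_bigr do rewrite exchange_big /=.
  under eq_bigr do under eq_bigr do under eq_bigr do rewrite mulr_sumr.
  under eq_bigr do under eq_bigr do rewrite exchange_big /=.
  rewrite exchange_big /= [RHS]exchange_big /=; apply: eq_bigr => n' _.
  rewrite [RHS]exchange_big /=; apply: eq_bigr => m _; apply: eq_bigr => m' _.
  have XE : Re (a n * (b m)^* * (a n' * (b m')^*)^*) = X n m' n' m.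
    by rewrite /X !partsE; ring.
  under eq_bigr do rewrite XE [_ * (_ * X _ _ _ _)]mulrA.
  rewrite -mulr_suml; congr (_ * _).
  case: leqP => [le|gt]; last first.
    rewrite mul0r mulr0 big1 // => k _.
    by rewrite (_ : (n == m + k :> nat)%N = false) ?mul0r ?mulr0 //; lia.
  have lt : (n - m < K)%N by have := ltn_ord n; lia.
  rewrite (bigD1 (Ordinal lt)) //= [X in _ + X]big1 => [|k ne]; last first.
    rewrite (_ : (n == m + k :> nat)%N = false) ?mul0r ?mulr0 //.
    by apply/eqP => e; move/eqP: ne; apply; apply: val_inj => /=; lia.
  rewrite subnKC // eqxx (_ : (n + m' == n' + m)%N = (n' == m' + (n - m) :> nat)%N); last by lia.
  by have -> : (true : nat)%:R = 1 :> R by []; ring.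
rewrite E1 E2 {E1 E2} -sumrB.
under eq_bigr do rewrite -sumrB.
under eq_bigr do under eq_bigr do rewrite -sumrB.
under eq_bigr do under eq_bigr do under eq_bigr do rewrite -sumrB.
pose y n m := sqn (a n * b m).
(* Half of the Schur bound [p * q <= (s * p^2 + q^2 / s) / 2] with [s = gam n / gam n']; the other
   half is the same term with the index pairs exchanged. *)
pose G n m n' m' := schur_coef n m n' m' * (2^-1 * (y n m * (gam n / gam n'))).
have le (n m n' m' : nat) : ((n + m == n' + m')%N%:R * gam (n + m)) * X n m n' m' -
      ((n + m == n' + m')%N%:R * ((m' <= n)%N%:R * (gam n * gam n' / gam (n - m'))))
       * X n m n' m' <= G n m n' m' + G n' m' n m.
  rewrite -mulrBl -mulrBr -/(schur_coef n m n' m') /G schur_coefC -mulrDr.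
  apply: ler_wpM2l; first exact: schur_coef_ge0.
  apply: le_trans (ler_norm _) (le_trans (Re_le_normc _) _).
  rewrite ComplexField.Normc.normcM normc_conj -mulrDr /y -!sqr_normc_sqn.
  set p := normc _; set q := normc _; set s := gam n / gam n'.
  have s0 : 0 < s by rewrite divr_gt0.
  rewrite (_ : gam n' / gam n = s^-1); last by rewrite invf_div.
  have h : 0 <= (p * s - q) ^+ 2 / s by rewrite divr_ge0 ?sqr_ge0 ?ltW.
  have sn : s != 0 by rewrite gt_eqF.
  have -> : 2^-1 * (p ^+ 2 * s + q ^+ 2 / s) = p * q + 2^-1 * ((p * s - q) ^+ 2 / s).
    by field.
  by rewrite lerDl mulr_ge0.
apply: le_trans (sum4_le K le) _.
under eq_bigr do under eq_bigr do under eq_bigr do rewrite big_split.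
under eq_bigr do under eq_bigr do rewrite big_split.
under eq_bigr do rewrite big_split.
rewrite big_split /=.
(* The two halves have the same total, so that only row sums are left to estimate. *)
have -> : \sum_(n < K) \sum_(m < K) \sum_(n' < K) \sum_(m' < K) G n' m' n m =
    \sum_(n < K) \sum_(m < K) \sum_(n' < K) \sum_(m' < K) G n m n' m'.
  under eq_bigr do rewrite exchange_big /=.
  rewrite exchange_big /=; apply: eq_bigr => n' _.
  under eq_bigr do rewrite exchange_big /=.
  by rewrite exchange_big.
rewrite -mulr2n -[leLHS]mulr_natl !mulr_suml [leLHS]mulr_sumr; apply: ler_sum => n _.
rewrite [leLHS]mulr_sumr mulr_sumr mulr_suml; apply: ler_sum => m _.
have -> : \sum_(n' < K) \sum_(m' < K) G n m n' m' = 2^-1 * y n m * gam n *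
    \sum_(n' < K) \sum_(m' < K) schur_coef n m n' m' / gam n'.
  rewrite mulr_sumr; apply: eq_bigr => n' _; rewrite mulr_sumr; apply: eq_bigr => m' _.
  by rewrite /G; ring.
rewrite !mulrA divff // mul1r.
apply: le_trans (ler_wpM2l _ (schur_row_sum (ltn_ord n) (ltn_ord m))) _.
  by rewrite mulr_ge0 ?sqn_ge0 // ltW.
by rewrite /y sqnM le_eqVlt; apply/orP; left; apply/eqP; ring.
Qed.

End SchurTest.

(** * Fourier analysis with orthogonal powers, common to the disc and the circle *)

Section OrthogonalPowers.
Context {R : realType} {d : measure_display} {T : measurableType d}.
Variables (mu : {measure set T -> \bar R}) (D : set T) (w : T -> R).
Hypothesis mD : measurable D.
Hypothesis mw : measurable_fun D w.
Hypothesis w0 : forall x, D x -> 0 <= w x.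
Local Notation L2 := (L2 mu D w).
Local Notation inner := (L2inner mu D w).
Local Notation nrm2 := (nrm2 mu D w).
Variables (zeta : T -> CC R) (gam : nat -> R).
Hypothesis mzeta : cmeas D zeta.
Hypothesis zeta1 : forall x, D x -> sqn (zeta x) <= 1.
Hypothesis L2one : L2 (fun=> 1).
Hypothesis gam_gt0 : forall n, 0 < gam n.
Hypothesis inner_powers : forall n m,
  inner (fun x => zeta x ^+ n) (fun x => zeta x ^+ m) = (if n == m then gam n else 0)%:C.
Implicit Types (a b c : nat -> CC R) (u v : T -> CC R).

Definition ppoly a N : T -> CC R := fun x => \sum_(n < N) a n * zeta x ^+ n.

Lemma L2_mul_power u n : L2 u -> L2 (fun x => zeta x ^+ n * u x).
Proof.
apply: (@L2_bounded _ _ _ _ _ _ mD mw w0 1); first exact: cmeasX.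
by move=> x Dx; rewrite sqnX exprn_ile1 ?sqn_ge0 ?zeta1.
Qed.

Lemma L2_mul_Jpower u n : L2 u -> L2 (fun x => (zeta x ^+ n)^* * u x).
Proof.
apply: (@L2_bounded _ _ _ _ _ _ mD mw w0 1); first exact/cmeasJ/cmeasX.
by move=> x Dx; rewrite sqnJ sqnX exprn_ile1 ?sqn_ge0 ?zeta1.
Qed.

Lemma L2_power n : L2 (fun x => zeta x ^+ n).
Proof. by apply: (L2_eq mD mw w0 _ (L2_mul_power n L2one)) => x _; rewrite mulr1. Qed.

Lemma L2_ppoly a N : L2 (ppoly a N).
Proof. by apply: L2_sum => // n; apply: L2Z => //; exact: L2_power. Qed.

Lemma inner_ppolyr u a N : L2 u ->
  inner u (ppoly a N) = \sum_(n < N) (a n)^* * inner u (fun x => zeta x ^+ n).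
Proof.
move=> Lu; rewrite inner_sumr //.
  by apply: eq_bigr => n _; rewrite innerZr //; exact: L2_power.
by move=> n; apply: L2Z => //; exact: L2_power.
Qed.

Lemma inner_ppoly_power a N k :
  inner (ppoly a N) (fun x => zeta x ^+ k) = if (k < N)%N then a k * (gam k)%:C else 0.
Proof.
rewrite inner_suml //; [|by move=> n; apply: L2Z => //; exact: L2_power|exact: L2_power].
under eq_bigr => n _ do rewrite (innerZl mD mw w0 (a n) (L2_power n) (L2_power k)) inner_powers.
case: ifPn => [lt|]; last first.
  rewrite -leqNgt => le; rewrite big1 // => n _.
  by rewrite (_ : (n == k :> nat)%N = false) ?mulr0 //; have := ltn_ord n; lia.
rewrite (bigD1 (Ordinal lt)) //= eqxx big1 ?addr0 // => n ne.
rewrite (_ : (n == k :> nat)%N = false) ?mulr0 //.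
by apply/eqP => e; move/eqP: ne; apply; apply: val_inj.
Qed.

Lemma nrm2_ppoly a N : nrm2 (ppoly a N) = \sum_(n < N) gam n * sqn (a n).
Proof.
apply: complexI; rewrite -inner_self // inner_ppolyr; last exact: L2_ppoly.
rewrite rmorph_sum; apply: eq_bigr => n _.
by rewrite inner_ppoly_power ltn_ord mulrA [_^* * _]mulrC mulJ_sqn -rmorphM mulrC.
Qed.

Definition pcoef u n : CC R := (gam n)^-1%:C * inner u (fun x => zeta x ^+ n).

Lemma pcoefE u n : inner u (fun x => zeta x ^+ n) = (gam n)%:C * pcoef u n.
Proof. by rewrite /pcoef mulrA -rmorphM divff ?mul1r // gt_eqF. Qed.

(** Completing the square in each coefficient; Bessel's inequality and the optimality of the
    coefficients [pcoef] both drop out. *)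
Lemma nrm2_sub_ppoly u c N : L2 u -> nrm2 (u \- ppoly c N) =
  nrm2 u - \sum_(n < N) gam n * sqn (pcoef u n) + \sum_(n < N) gam n * sqn (pcoef u n - c n).
Proof.
move=> Lu; rewrite nrm2B //; last exact: L2_ppoly.
rewrite nrm2_ppoly inner_ppolyr // Re_sum mulr_sumr -!addrA; congr (_ + _).
rewrite -!sumrN -!big_split /=; apply: eq_bigr => n _.
by rewrite pcoefE /sqn !partsE; ring.
Qed.

Lemma nrm2_sub_proj u N : L2 u ->
  nrm2 (u \- ppoly (pcoef u) N) = nrm2 u - \sum_(n < N) gam n * sqn (pcoef u n).
Proof.
move=> Lu; rewrite nrm2_sub_ppoly // [X in _ + X]big1 ?addr0 // => n _.
by rewrite subrr sqn0 mulr0.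
Qed.

Lemma bessel u N : L2 u -> \sum_(n < N) gam n * sqn (pcoef u n) <= nrm2 u.
Proof.
by move=> Lu; rewrite -subr_ge0 -nrm2_sub_proj //; exact: nrm2_ge0.
Qed.

Lemma ppoly_pad a N M : (N <= M)%N ->
  ppoly a N = ppoly (fun n => if (n < N)%N then a n else 0) M.
Proof.
move=> le; apply/funext => x; rewrite /ppoly (big_ord_widen M (fun n => a n * zeta x ^+ n)) //.
by rewrite big_mkcond; apply: eq_bigr => n _; case: ifP => //; rewrite mul0r.
Qed.

(** Padding [c] with zeros allows [M] to exceed [N]: one good polynomial controls all later Fourier
    sums. *)
Lemma best_approx u c N M : L2 u -> (N <= M)%N ->
  nrm2 (u \- ppoly (pcoef u) M) <= nrm2 (u \- ppoly c N).
Proof.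
move=> Lu le; rewrite (ppoly_pad _ le) nrm2_sub_proj // nrm2_sub_ppoly // lerDl.
by apply: sumr_ge0 => n _; rewrite mulr_ge0 ?sqn_ge0 // ltW.
Qed.

Lemma ppolyM a b K x : ppoly a K x * ppoly b K x =
  ppoly (fun N => \sum_(n < K) \sum_(m < K) ((n + m == N)%N%:R)%:C * (a n * b m)) (K + K) x.
Proof.
rewrite /ppoly mulr_suml.
under [RHS]eq_bigr do rewrite mulr_suml.
rewrite exchange_big; apply: eq_bigr => n _; rewrite mulr_sumr.
under [RHS]eq_bigr do rewrite mulr_suml.
rewrite exchange_big; apply: eq_bigr => m _ /=.
have lt : (n + m < K + K)%N by have := ltn_ord n; have := ltn_ord m; lia.
rewrite (bigD1 (Ordinal lt)) //= eqxx big1 ?addr0 => [|N ne].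
  by rewrite mul1r exprD; ring.
rewrite (_ : (n + m == N)%N = false) ?mul0r //.
by apply/eqP => e; move/eqP: ne; apply; apply: val_inj.
Qed.

(** The truncated product [conj psi * f]: [b] holds the coefficients of the symbol, [a] those of
    [f]. *)
Definition cprod a b K : T -> CC R := fun x => (ppoly b K x)^* * ppoly a K x.

Lemma cprodE a b K x : cprod a b K x =
  \sum_(m < K) (b m)^* * ((zeta x ^+ m)^* * ppoly a K x).
Proof.
rewrite /cprod {1}/ppoly rmorph_sum mulr_suml; apply: eq_bigr => m _.
by rewrite rmorphM mulrA.
Qed.

Lemma L2_cprod a b K : L2 (cprod a b K).
Proof.
apply: (L2_eq mD mw w0 (fun x _ => esym (cprodE a b K x))).
by apply: L2_sum => // m; apply: L2Z => //; apply: L2_mul_Jpower; exact: L2_ppoly.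
Qed.

Lemma inner_Jpower u m k : L2 u ->
  inner (fun x => (zeta x ^+ m)^* * u x) (fun x => zeta x ^+ k) =
  inner u (fun x => zeta x ^+ (m + k)).
Proof.
move=> Lu; rewrite !innerE; apply: eq_cint => x _.
by rewrite /wprod exprD rmorphM; ring.
Qed.

Lemma inner_cprod_power a b K k : inner (cprod a b K) (fun x => zeta x ^+ k) =
  \sum_(n < K) \sum_(m < K) ((n == m + k :> nat)%N%:R * gam n)%:C * (a n * (b m)^*).
Proof.
rewrite (eq_inner _ _ (fun x _ => cprodE a b K x) (fun x _ => erefl)) inner_suml //; last 2 first.
- by move=> m; apply: L2Z => //; apply: L2_mul_Jpower; exact: L2_ppoly.
- exact: L2_power.
rewrite exchange_big; apply: eq_bigr => m _ /=.
rewrite innerZl //; [|by apply: L2_mul_Jpower; exact: L2_ppoly|exact: L2_power].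
rewrite inner_Jpower; last exact: L2_ppoly.
rewrite inner_ppoly_power; case: ltnP => [lt|ge].
  rewrite (bigD1 (Ordinal lt)) //= eqxx mul1r big1 ?addr0 => [|n ne]; first by ring.
  rewrite (_ : (n == m + k :> nat)%N = false) ?mul0r //.
  by apply/eqP => e; move/eqP: ne; apply; apply: val_inj.
rewrite mulr0 big1 // => n _.
by rewrite (_ : (n == m + k :> nat)%N = false) ?mul0r //; have := ltn_ord n; lia.
Qed.

(** Degrees below [K] exhaust the projection, because pairing with a conjugated power can only lower
    the degree of the truncated [f]. *)
Definition cprod_proj a b K := ppoly (pcoef (cprod a b K)) K.

Lemma nrm2_hankel_ppoly (alpha : R) a b K : -1 <= alpha ->
  (forall n, gam n.+1 * (n%:R + alpha + 2) = n.+1%:R * gam n) ->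
  nrm2 (cprod a b K \- cprod_proj a b K) <=
  (\sum_(n < K) gam n * sqn (a n)) * (\sum_(m < K) m%:R * sqn (b m)) / (2 + alpha).
Proof.
move=> halpha gam_rec; rewrite nrm2_sub_proj; last exact: L2_cprod.
apply: le_trans (hankel_finite_inequality halpha gam_gt0 gam_rec a b K).
rewrite le_eqVlt; apply/orP; left; apply/eqP; congr (_ - _).
  (* [conj psi * f] has the modulus of [psi * f], and the latter is a polynomial in [zeta] with an
     explicit norm. *)
  rewrite -(nrm2_ppoly (fun N =>
    \sum_(n < K) \sum_(m < K) ((n + m == N)%N%:R)%:C * (a n * b m)) (K + K)).
  apply: eq_Rintegral => x _; congr (_ * _).
  by rewrite /cprod sqnM sqnJ mulrC -sqnM ppolyM.
apply: eq_bigr => k _; rewrite /pcoef sqnM sqnR inner_cprod_power mulrA; congr (_ * _).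
by field; rewrite gt_eqF.
Qed.

End OrthogonalPowers.

(** * Orthogonal projections and the Hankel norm *)

Section Projection.
Context {R : realType} {d : measure_display} {T : measurableType d}.
Variables (mu : {measure set T -> \bar R}) (D : set T) (w : T -> R).
Hypothesis mD : measurable D.
Hypothesis mw : measurable_fun D w.
Hypothesis w0 : forall x, D x -> 0 <= w x.
Variable H : set (T -> CC R).
Hypothesis HL2 : H `<=` L2 mu D w.

Lemma orthproj_min u g h : L2 mu D w u -> is_orthproj mu D w H u g -> H h ->
  nrm2 mu D w (u \- g) <= nrm2 mu D w (u \- h).
Proof.
move=> Lu [Hg og] Hh; have Lg := HL2 Hg; have Lh := HL2 Hh.
rewrite (_ : u \- h = (u \- g) \+ (g \- h)); last first.
  by apply/funext => x /=; rewrite addrA subrK.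
have [Lug Lgh] := (L2B mD mw w0 Lu Lg, L2B mD mw w0 Lg Lh).
rewrite [leRHS](nrm2D mD mw w0 Lug Lgh) innerBr //.
by rewrite og // og // subr0 mulr0 addr0 lerDl nrm2_ge0.
Qed.

(** [orthproj] is an arbitrary choice among the orthogonal projections. Each of them minimizes the
    distance to [u], so any explicit one computes the norm. *)
Lemma L2norm_hankel psi f g : L2 mu D w (fun x => (psi x)^* * f x) ->
  is_orthproj mu D w H (fun x => (psi x)^* * f x) g ->
  L2norm mu D w (hankel mu D w H psi f) =
  (Num.sqrt (nrm2 mu D w ((fun x => (psi x)^* * f x) \- g)))%:E.
Proof.
move=> Lu og; set u := fun x => _.
have op : is_orthproj mu D w H u (orthproj mu D w H u) by exact: xgetI og.
rewrite /hankel -/u L2normE //; last by apply: L2B => //; apply: HL2; exact: op.1.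
congr ((Num.sqrt _)%:E); apply/eqP; rewrite eq_le; apply/andP; split.
  by apply: orthproj_min => //; exact: og.1.
by apply: orthproj_min => //; exact: op.1.
Qed.

Lemma hankel_opnorm_le psi (B : \bar R) : (0 <= B)%E ->
  (forall f, H f -> L2 mu D w (fun x => (psi x)^* * f x) -> nrm2 mu D w f = 1 ->
    exists2 g, is_orthproj mu D w H (fun x => (psi x)^* * f x) g &
      ((Num.sqrt (nrm2 mu D w ((fun x => (psi x)^* * f x) \- g)))%:E <= B)%E) ->
  (hankel_opnorm mu D w H psi <= B)%E.
Proof.
move=> B0 h; apply: ge_ereal_sup => _ [->//|[f [[Hf Lu] nf]] <-].
have nf1 : nrm2 mu D w f = 1.
  move: nf; rewrite L2normE //; last exact: HL2.
  move=> [s1]; rewrite -[LHS](@sqr_sqrtr _ (nrm2 mu D w f)) ?nrm2_ge0 //.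
  by rewrite s1 expr1n.
have [g og le] := h f Hf Lu nf1.
by rewrite (L2norm_hankel Lu og).
Qed.

Lemma hankel_opnorm_ge psi f g : H f -> nrm2 mu D w f = 1 ->
  L2 mu D w (fun x => (psi x)^* * f x) ->
  is_orthproj mu D w H (fun x => (psi x)^* * f x) g ->
  ((Num.sqrt (nrm2 mu D w ((fun x => (psi x)^* * f x) \- g)))%:E <=
   hankel_opnorm mu D w H psi)%E.
Proof.
move=> Hf nf Lu og; rewrite -(L2norm_hankel Lu og); apply: ereal_sup_ubound; right.
exists f => //; split => //; rewrite L2normE ?nf ?sqrtr1 //; exact: HL2.
Qed.

End Projection.

(** * Power series of holomorphic functions *)

Section ComplexDerivative.
Context {R : realType}.
Implicit Types (f g : CC R -> CC R) (z l m h : CC R).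

(** Complex differentiability with real epsilon and delta and without division: [h = 0] is allowed,
    which spares case distinctions in the chain rule and in Goursat's estimate. *)
Definition cdiff f z l := forall e : R, 0 < e -> exists2 dl : R, 0 < dl &
  forall h, normc h < dl -> normc (f (z + h) - f z - l * h) <= e * normc h.

(** Neighbourhoods in [CC R] have radii that are positive elements of [R[i]]; the partial order
    forces these to be real. *)
Lemma posC (e : CC R) : 0 < e -> exists2 r : R, 0 < r & e = r%:C.
Proof.
case: e => a b; rewrite ltcE /= => /andP[/eqP -> a0]; by exists a.
Qed.

Lemma near0P (P : CC R -> Prop) : (\forall h \near (0 : CC R)^', P h) <->
  exists2 dl : R, 0 < dl & forall h : CC R, h != 0 -> normc h < dl -> P h.
Proof.
split.
  case=> dl /= /posC[r r0 ->] h; exists r => // k k0 kr; apply: h => //=.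
  by rewrite sub0r normrN normrE ltcR.
case=> r r0 h; exists r%:C => /=; first by rewrite ltcR.
by move=> k /=; rewrite sub0r normrN normrE ltcR => kr k0; exact: h.
Qed.

Lemma cdiffP f z l :
  cdiff f z l <-> (h^-1 *: (f (h *: 1 + z) - f z)) @[h --> (0 : CC R)^'] --> l.
Proof.
have E h : h != 0 -> normc (f (z + h) - f z - l * h) =
    normc (l - h^-1 *: (f (h *: 1 + z) - f z)) * normc h.
  move=> h0; rewrite -ComplexField.Normc.normcM -normcN; congr normc.
  rewrite [h *: 1]mulr1 (addrC h) /GRing.scale /= mulrBl mulrAC mulVf // mul1r.
  by rewrite opprB.
split=> H.
  apply/cvgrPdist_le => _ /posC[e e0 ->]; have [dl d0 hd] := H _ e0.
  apply/near0P; exists dl => // h h0 hdl; rewrite normrE lecR.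
  have n0 : 0 < normc h.
    rewrite lt_def normc_ge0 andbT; apply/eqP => /ComplexField.Normc.eq0_normc e'.
    by rewrite e' eqxx in h0.
  by rewrite -(ler_pM2r n0) -E // hd.
move=> e e0; move/cvgrPdist_le : H => /(_ e%:C); rewrite ltcR => /(_ e0)/near0P[dl d0 hd].
exists dl => // h hdl; have [->|h0] := eqVneq h 0.
  by rewrite addr0 subrr mulr0 subrr ComplexField.Normc.normc0 mulr0.
by rewrite E // ler_wpM2r ?normc_ge0 //; have := hd h h0 hdl; rewrite normrE lecR.
Qed.

Lemma cdiff_derivable f z l : cdiff f z l -> derivable f z 1 /\ derive1 f z = l.
Proof.
move=> /cdiffP h; have dv : derivable f z 1 by apply/cvg_ex; exists l.
split=> //; rewrite derive1E; exact: (cvg_lim _ h).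
Qed.

Lemma derivable_cdiff f z : derivable f z 1 -> cdiff f z (derive1 f z).
Proof. by move=> h; apply/cdiffP; rewrite derive1E. Qed.

Lemma cdiff_lip f z l : cdiff f z l -> exists2 dl : R, 0 < dl &
  forall h, normc h < dl -> normc (f (z + h) - f z) <= (normc l + 1) * normc h.
Proof.
move=> /(_ 1 ltr01)[dl d0 hd]; exists dl => // h /hd; rewrite mul1r => le.
rewrite -[f (z + h) - f z](subrK (l * h)) (le_trans (le_normcD _ _)) //.
by rewrite mulrDl mul1r addrC lerD // ComplexField.Normc.normcM.
Qed.

Lemma cdiff_comp f g z l m : cdiff g z l -> cdiff f (g z) m ->
  cdiff (fun x => f (g x)) z (m * l).
Proof.
move=> dg df e e0; have [dg1 dg10 lip] := cdiff_lip dg.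
have l0 := normc_ge0 l; have m0 := normc_ge0 m.
pose e1 := e / 2 / (normc l + 1); pose e2 := e / 2 / (normc m + 1).
have e10 : 0 < e1 by rewrite !divr_gt0 // ltr_wpDl.
have e20 : 0 < e2 by rewrite !divr_gt0 // ltr_wpDl.
have [df1 df10 hf] := df _ e10; have [dg2 dg20 hg] := dg _ e20.
exists (Num.min dg1 (Num.min dg2 (df1 / (normc l + 1)))) => [|h].
  by rewrite !lt_min dg10 dg20 divr_gt0 // ltr_wpDl.
rewrite !lt_min => /and3P[h1 h2 h3]; set k := g (z + h) - g z.
have kl : normc k <= (normc l + 1) * normc h by exact: lip.
have kd : normc k < df1.
  by apply: le_lt_trans kl _; rewrite mulrC -ltr_pdivlMr // ltr_wpDl.
have := hf k kd; rewrite /k [g z + _]addrC subrK -/k => fk.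
have -> : f (g (z + h)) - f (g z) - m * l * h =
    (f (g (z + h)) - f (g z) - m * k) + m * (k - l * h) by ring.
apply: le_trans (le_normcD _ _) _; rewrite ComplexField.Normc.normcM.
have -> : e * normc h = e / 2 * normc h + e / 2 * normc h by field.
apply: lerD.
  apply: le_trans fk _; apply: le_trans (ler_wpM2l (ltW e10) kl) _.
  rewrite mulrA ler_wpM2r ?normc_ge0 // /e1 mulfVK // gt_eqF // ltr_wpDl //.
apply: le_trans (ler_wpM2l m0 (hg h h2)) _.
rewrite mulrA ler_wpM2r ?normc_ge0 //.
have <- : e2 * (normc m + 1) = e / 2 by rewrite /e2 mulfVK // gt_eqF // ltr_wpDl.
by rewrite mulrC ler_wpM2l ?(ltW e20) // lerDl.
Qed.

Lemma cdiffM f g z l m : cdiff f z l -> cdiff g z m ->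
  cdiff (fun x => f x * g x) z (l * g z + f z * m).
Proof.
move=> df dg e e0; have [d1 d10 lf] := cdiff_lip df; have [d2 d20 lg] := cdiff_lip dg.
have n0 := @normc_ge0 R.
pose K := 1 + normc (g z) + normc (f z) + (normc l + 1) * (normc m + 1).
have K0 : 0 < K.
  rewrite /K -!addrA ltr_pwDl // !addr_ge0 // mulr_ge0 // addr_ge0 //.
have eK : 0 < e / K by rewrite divr_gt0.
have [d3 d30 hf] := df _ eK; have [d4 d40 hg] := dg _ eK.
exists (Num.min (Num.min d1 d2) (Num.min (Num.min d3 d4) (e / K))) => [|h].
  by rewrite !lt_min d10 d20 d30 d40 eK.
rewrite !lt_min => /andP[/andP[h1 h2] /andP[/andP[h3 h4] h5]].
have -> : f (z + h) * g (z + h) - f z * g z - (l * g z + f z * m) * h =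
  (f (z + h) - f z - l * h) * g z + f z * (g (z + h) - g z - m * h)
  + (f (z + h) - f z) * (g (z + h) - g z) by ring.
apply: le_trans (le_normcD _ _) _; apply: le_trans (lerD (le_normcD _ _) (lexx _)) _.
rewrite !ComplexField.Normc.normcM.
have -> : e * normc h = e / K * normc h * K by field; rewrite gt_eqF.
have a1 := ler_wpM2r (n0 (g z)) (hf h h3).
have a2 := ler_wpM2l (n0 (f z)) (hg h h4).
have a3 := ler_pM (n0 _) (n0 _) (lf h h1) (lg h h2).
have a4 : (normc l + 1) * normc h * ((normc m + 1) * normc h) <=
    e / K * normc h * ((normc l + 1) * (normc m + 1)).
  have : 0 <= (e / K - normc h) * (normc h * ((normc l + 1) * (normc m + 1))).
    by rewrite mulr_ge0 ?subr_ge0 ?(ltW h5) // mulr_ge0 // mulr_ge0 // addr_ge0.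
  lra.
have a5 : 0 <= e / K * normc h by rewrite mulr_ge0 // ltW.
apply: le_trans (lerD (lerD a1 a2) (le_trans a3 a4)) _.
move: a5; set t := e / K * normc h; rewrite /K => a5; lra.
Qed.

Lemma cdiff_id z : cdiff id z 1.
Proof.
move=> e e0; exists 1 => // h _; rewrite (_ : _ - _ = 0) ?ComplexField.Normc.normc0; last by rewrite /=; ring.
by rewrite mulr_ge0 ?normc_ge0 // ltW.
Qed.

Lemma cdiff_cst (c : CC R) z : cdiff (fun=> c) z 0.
Proof.
move=> e e0; exists 1 => // h _; rewrite subrr mul0r subrr ComplexField.Normc.normc0.
by rewrite mulr_ge0 ?normc_ge0 // ltW.
Qed.

Lemma cdiffB f g z l m : cdiff f z l -> cdiff g z m -> cdiff (fun x => f x - g x) z (l - m).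
Proof.
move=> df dg e e0; have e2 : 0 < e / 2 by rewrite divr_gt0.
have [d1 d10 h1] := df _ e2; have [d2 d20 h2] := dg _ e2.
exists (Num.min d1 d2) => [|h]; first by rewrite lt_min d10 d20.
rewrite lt_min => /andP[/h1 k1 /h2 k2].
have -> : f (z + h) - g (z + h) - (f z - g z) - (l - m) * h =
  (f (z + h) - f z - l * h) - (g (z + h) - g z - m * h) by ring.
apply: le_trans (le_normcD _ _) _; rewrite normcN.
by have -> : e * normc h = e / 2 * normc h + e / 2 * normc h; [field|rewrite lerD].
Qed.

Lemma cdiffV z : z != 0 -> cdiff (fun x => x^-1) z (- z ^- 2).
Proof.
move=> z0; apply/cdiffP.
have cz : (h *: 1 + z)^-1 @[h --> (0 : CC R)^'] --> z^-1.
  apply: cvgV => //; rewrite -[X in _ --> X]add0r; apply: cvgD; last exact: cvg_cst.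
  rewrite -[X in _ --> X](scale0r (1 : CC R)); apply: cvgZr_tmp.
  exact: cvg_within.
have : (- (z^-1 * (h *: 1 + z)^-1)) @[h --> (0 : CC R)^'] --> - (z ^- 2).
  by apply: cvgN; rewrite expr2 invfM; apply: cvgM => //; exact: cvg_cst.
apply: cvg_trans; apply: near_eq_cvg; apply/near0P.
exists (normc z) => [|h h0 hz].
  rewrite lt_def normc_ge0 andbT; apply/eqP => /ComplexField.Normc.eq0_normc e; by rewrite e eqxx in z0.
have hz0 : h + z != 0.
  rewrite addr_eq0; apply/eqP => e; by rewrite e normcN ltxx in hz.
rewrite [h *: 1]mulr1 /GRing.scale /=; field.
by rewrite z0 h0 hz0.
Qed.

Lemma cdiff_continuous f z l : cdiff f z l -> forall e : R, 0 < e ->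
  exists2 dl : R, 0 < dl & forall z', normc (z' - z) < dl -> normc (f z' - f z) < e.
Proof.
move=> /cdiff_lip[d1 d10 h] e e0; have l0 := normc_ge0 l.
have l1 : 0 < normc l + 1 by rewrite ltr_wpDl.
exists (Num.min d1 (e / (normc l + 1))) => [|z'].
  by rewrite lt_min d10 divr_gt0.
rewrite lt_min => /andP[/h + lt]; have -> : z + (z' - z) = z' by ring.
move=> /le_lt_trans; apply.
by rewrite mulrC -ltr_pdivlMr.
Qed.

End ComplexDerivative.

(** * Integrals of complex functions along segments *)

Section SegmentIntegral.
Context {R : realType}.
Local Notation leb := (@lebesgue_measure R).
Implicit Types (g : R -> CC R) (a b c x : R).

Definition ccts g x := forall e : R, 0 < e ->
  exists2 dl : R, 0 < dl & forall x', `|x' - x| < dl -> normc (g x' - g x) < e.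

Definition sint a b g : R[i] := cint leb `[a, b] g.

Lemma ccts_parts g x : ccts g x ->
  {for x, continuous (fun y => Re (g y))} /\ {for x, continuous (fun y => Im (g y))}.
Proof.
move=> h; split; apply/cvgrPdist_lt => e /h[dl d0 hd]; near=> y.
- rewrite -normrN opprB -ReB; apply: le_lt_trans (Re_le_normc _) _; apply: hd.
  by rewrite distrC; near: y; exact: (@cvgr_dist_lt _ _ _ (nbhs x) _ id x).
- rewrite -normrN opprB -ImB; apply: le_lt_trans (Im_le_normc _) _; apply: hd.
  by rewrite distrC; near: y; exact: (@cvgr_dist_lt _ _ _ (nbhs x) _ id x).
Unshelve. all: by end_near. Qed.

Lemma ccts_within g a b : (forall x, a <= x <= b -> ccts g x) ->
  {within `[a, b], continuous (fun y => Re (g y))} /\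
  {within `[a, b], continuous (fun y => Im (g y))}.
Proof.
move=> h; split; apply: continuous_in_subspaceT => x; rewrite inE /= in_itv /= => xab;
  by case: (ccts_parts (h x xab)).
Qed.

Lemma ccts_integrable g a b : (forall x, a <= x <= b -> ccts g x) ->
  cintegrable leb `[a, b] g.
Proof.
by move=> /ccts_within[h k]; split; apply: continuous_compact_integrable => //;
  exact: segment_compact.
Qed.

Lemma sint_cat g a b c : a <= b -> b <= c -> (forall x, a <= x <= c -> ccts g x) ->
  sint a c g = sint a b g + sint b c g.
Proof.
move=> ab bc /ccts_integrable[i1 i2]; rewrite /sint /cint.
have key (f : R -> R) : leb.-integrable `[a, c] (EFin \o f) ->
    \int[leb]_(x in `[a, c]) f x =
    \int[leb]_(x in `[a, b]) f x + \int[leb]_(x in `[b, c]) f x.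
  move=> i; apply/eqP; rewrite addrC -subr_eq; apply/eqP.
  rewrite Rintegral_itvB //; apply: Rintegral_itv_obnd_cbnd.
  apply: integrableS i => // t /=; rewrite !in_itv /= => /andP[bt ->].
  by rewrite (le_trans ab (ltW bt)).
by apply: complexP => /=; rewrite ?partsE /=; exact: key.
Qed.

(** The factor 2 comes from bounding the real and the imaginary integral separately; Goursat's
    argument tolerates any constant. *)
Lemma sint_le g a b (M : R) : a <= b -> 0 <= M -> (forall x, a <= x <= b -> ccts g x) ->
  (forall x, a <= x <= b -> normc (g x) <= M) -> normc (sint a b g) <= 2 * (M * (b - a)).
Proof.
move=> ab M0 /ccts_integrable[i1 i2] hM.
have key (f : R -> R) : leb.-integrable `[a, b] (EFin \o f) ->
    (forall x, a <= x <= b -> `|f x| <= M) -> `|\int[leb]_(x in `[a, b]) f x| <= M * (b - a).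
  move=> i h; have fin : leb `[a, b] = (b - a)%:E.
    rewrite lebesgue_measure_itv /= lte_fin; move: (ab); rewrite le_eqVlt => /predU1P[->|->].
      by rewrite ltxx subrr.
    by rewrite EFinB.
  apply: le_trans (le_normr_Rintegral _ i) _ => //.
  have := @le_Rintegral _ _ _ leb `[a, b]%classic (fun x => `|f x|) (fun=> M).
  have cE : \int[leb]_(x in `[a, b]) M = M * (b - a).
    by rewrite Rintegral_cst // -[b - a]/(fine (b - a)%:E) -fin.
  rewrite cE; apply => //.
  - exact: integrable_norm.
  - apply: (@continuous_compact_integrable _ (fun=> M)); first exact: segment_compact.
    by apply: continuous_subspaceT => ?; exact: cvg_cst.
apply: le_trans (normc_le_parts _) _; rewrite mulr2n mulrDl mul1r lerD //; apply: key => // x xab.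
- exact: le_trans (Re_le_normc _) (hM x xab).
- exact: le_trans (Im_le_normc _) (hM x xab).
Qed.

Lemma Rint_affine a b (p q : R) : a <= b ->
  \int[leb]_(x in `[a, b]) (p + q * x) = p * (b - a) + q * (b ^+ 2 - a ^+ 2) / 2.
Proof.
rewrite le_eqVlt => /predU1P[->|ab].
  by rewrite set_itv1 Rintegral_set1 !subrr !mulr0 mul0r addr0.
have hF x : is_derive x 1 (fun x : R => p * x + q / 2 * x ^+ 2) (p + q * x).
  apply: is_derive_eq.
  by rewrite /GRing.scale /=; field.
have cF x : {for x, continuous (fun x : R => p * x + q / 2 * x ^+ 2)}.
  by apply/differentiable_continuous/derivable1_diffP; have [] := hF x.
rewrite /Rintegral (@continuous_FTC2 _ _ (fun x => p * x + q / 2 * x ^+ 2)) //=.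
- by field.
- apply: continuous_subspaceT => x; apply: cvgD; first exact: cvg_cst.
  by apply: cvgMl_tmp; exact: cvg_id.
- split; first by move=> x _; have [] := hF x.
  + by apply: cvg_at_right_filter; exact: cF.
  + by apply: cvg_at_left_filter; exact: cF.
- by move=> x _; rewrite derive1E; have [_] := hF x.
Qed.

Lemma sint_affine a b (p q : CC R) : a <= b ->
  sint a b (fun x => p + q * x%:C) = p * (b - a)%:C + q * ((b ^+ 2 - a ^+ 2) / 2)%:C.
Proof.
move=> ab; apply: complexP; rewrite /sint /cint /=.
- rewrite (_ : (\int[leb]_(x in `[a, b]) _) = \int[leb]_(x in `[a, b]) (Re p + Re q * x)).
    by rewrite Rint_affine // !partsE; field.
  by apply: eq_Rintegral => x _; rewrite !partsE mulr0 subr0.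
- rewrite (_ : (\int[leb]_(x in `[a, b]) _) = \int[leb]_(x in `[a, b]) (Im p + Im q * x)).
    by rewrite Rint_affine // !partsE; field.
  by apply: eq_Rintegral => x _; rewrite !partsE mulr0 add0r.
Qed.

End SegmentIntegral.

(** * Goursat's theorem on rectangles *)

Section Goursat.
Context {R : realType}.
Variable F : CC R -> CC R.
Implicit Types (a b c d x y : R) (G : CC R -> CC R).

Definition hseg G y : R -> CC R := fun x => G (x +i* y).
Definition vseg G x : R -> CC R := fun y => G (x +i* y).

(* The integral of G over the boundary of [a, b] x [c, d]. *)
Definition bint G a b c d : R[i] :=
  sint a b (hseg G c) - sint a b (hseg G d) + 'i * (sint c d (vseg G b) - sint c d (vseg G a)).

Definition inrect a b c d x y := (a <= x <= b) && (c <= y <= d).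
Definition diff_on a b c d := forall x y, inrect a b c d x y -> exists l, cdiff F (x +i* y) l.

Lemma normc_real_add x x' y : normc ((x' +i* y) - (x +i* y)) = `|x' - x|.
Proof. by rewrite (_ : _ - _ = (x' - x)%:C) ?normcR //; apply: complexP; rewrite /= ?subrr. Qed.

Lemma normc_imag_add x y y' : normc ((x +i* y') - (x +i* y)) = `|y' - y|.
Proof.
rewrite normc_sqrt -sqrtr_sqr; congr Num.sqrt.
by rewrite /sqn !partsE /= subrr expr0n add0r.
Qed.

Lemma cdiff_hseg G x y l : cdiff G (x +i* y) l -> ccts (hseg G y) x.
Proof.
move=> /cdiff_continuous h e /h[dl d0 hd]; exists dl => // x' lt.
by apply: hd; rewrite normc_real_add.
Qed.

Lemma cdiff_vseg G x y l : cdiff G (x +i* y) l -> ccts (vseg G x) y.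
Proof.
move=> /cdiff_continuous h e /h[dl d0 hd]; exists dl => // x' lt.
by apply: hd; rewrite normc_imag_add.
Qed.

Lemma bint_split a b c d x y : a <= x <= b -> c <= y <= d -> diff_on a b c d ->
  bint F a b c d = bint F a x c y + bint F x b c y + bint F a x y d + bint F x b y d.
Proof.
move=> /andP[ax xb] /andP[cy yd] dF.
have H t : c <= t <= d -> sint a b (hseg F t) = sint a x (hseg F t) + sint x b (hseg F t).
  move=> tcd; apply: sint_cat => // s sab.
  by have [|l] := dF s t; [rewrite /inrect sab tcd|exact: cdiff_hseg].
have V s : a <= s <= b -> sint c d (vseg F s) = sint c y (vseg F s) + sint y d (vseg F s).
  move=> sab; apply: sint_cat => // t tcd.
  by have [|l] := dF s t; [rewrite /inrect sab tcd|exact: cdiff_vseg].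
have cd := le_trans cy yd; have ab := le_trans ax xb.
rewrite /bint !H ?V ?lexx ?ab ?cd ?cy //.
by ring.
Qed.

(** Cauchy's theorem for affine functions, by explicit integration of the four sides; it disposes of
    the linear approximation in Goursat's argument. *)
Lemma bint_affine (p q : CC R) a b c d : a <= b -> c <= d ->
  bint (fun z => p + q * z) a b c d = 0.
Proof.
have alg : (p + q * (0 +i* c)) * (b - a)%:C + q * ((b ^+ 2 - a ^+ 2) / 2)%:C -
    ((p + q * (0 +i* d)) * (b - a)%:C + q * ((b ^+ 2 - a ^+ 2) / 2)%:C) +
    'i * ((p + q * b%:C) * (d - c)%:C + q * 'i * ((d ^+ 2 - c ^+ 2) / 2)%:C -
      ((p + q * a%:C) * (d - c)%:C + q * 'i * ((d ^+ 2 - c ^+ 2) / 2)%:C)) = 0.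
  have iE (y : R) : (0 +i* y : CC R) = 'i * y%:C by apply: complexP; rewrite !partsE /=; ring.
  rewrite !iE !rmorphB /=; move: (b%:C) (a%:C) (c%:C) (d%:C) (_ / _)%:C (_ / _)%:C => b' a' c' d' X Y.
  by ring.
move=> ab cd; rewrite /bint.
have hE y : sint a b (hseg (fun z => p + q * z) y) =
    (p + q * (0 +i* y)) * (b - a)%:C + q * ((b ^+ 2 - a ^+ 2) / 2)%:C.
  rewrite -sint_affine //; apply: eq_cint => x _; rewrite /hseg -addrA -mulrDr; congr (_ + _ * _).
  by apply: complexP => /=; rewrite ?add0r ?addr0.
have vE x : sint c d (vseg (fun z => p + q * z) x) =
    (p + q * x%:C) * (d - c)%:C + q * 'i * ((d ^+ 2 - c ^+ 2) / 2)%:C.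
  rewrite -sint_affine //; apply: eq_cint => y _; rewrite /vseg -addrA -[q * 'i * _]mulrA -mulrDr.
  congr (_ + _ * _); apply: complexP; rewrite !partsE /=; ring.
rewrite !hE !vE; exact: alg.
Qed.

Lemma rect_sides_le (x1 x2 x3 x4 M r s : R) : x1 <= 2 * (M * r) -> x2 <= 2 * (M * r) ->
  x3 <= 2 * (M * s) -> x4 <= 2 * (M * s) -> x1 + x2 + (x4 + x3) <= 4 * (M * (r + s)).
Proof. by move=> *; lra. Qed.

(** The affine part integrates to zero and only the remainder counts. The 4 is the factor 2 of
    [sint_le] times the two sides in each direction. *)
Lemma bint_rem_le (p q : CC R) a b c d (M : R) : a <= b -> c <= d -> diff_on a b c d ->
  0 <= M -> (forall x y, inrect a b c d x y ->
     normc (F (x +i* y) - (p + q * (x +i* y))) <= M) ->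
  normc (bint F a b c d) <= 4 * (M * ((b - a) + (d - c))).
Proof.
move=> ab cd dF M0 hM; pose G (z : CC R) : CC R := p + q * z; pose E z := F z - G z.
have dG z : cdiff G z (- (0 - (0 * z + q * 1))).
  have -> : G = fun z => p - (0 - q * z) by apply/funext => t; rewrite /G sub0r opprK.
  rewrite -sub0r; apply: cdiffB; first exact: cdiff_cst.
  by apply: cdiffB; [exact: cdiff_cst | apply: cdiffM; [exact: cdiff_cst|exact: cdiff_id]].
have dE x y : inrect a b c d x y -> exists l, cdiff E (x +i* y) l.
  by move=> /dF[l dl]; eexists; apply: cdiffB dl (dG _).
have FE z : F z = E z + G z by rewrite /E subrK.
have hs y : c <= y <= d -> sint a b (hseg F y) = sint a b (hseg E y) + sint a b (hseg G y) /\
    normc (sint a b (hseg E y)) <= 2 * (M * (b - a)).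
  move=> ycd; have cE x : a <= x <= b -> ccts (hseg E y) x.
    by move=> xab; have [|l] := dE x y; [rewrite /inrect xab ycd|exact: cdiff_hseg].
  split; last first.
    apply: sint_le => // x xab; apply: hM; by rewrite /inrect xab ycd.
  rewrite -cintD //; last 2 first.
  - exact: ccts_integrable.
  - by apply: ccts_integrable => x _; exact: cdiff_hseg (dG _).
  by apply: eq_cint => x _; rewrite /hseg FE.
have vs x : a <= x <= b -> sint c d (vseg F x) = sint c d (vseg E x) + sint c d (vseg G x) /\
    normc (sint c d (vseg E x)) <= 2 * (M * (d - c)).
  move=> xab; have cE y : c <= y <= d -> ccts (vseg E x) y.
    by move=> ycd; have [|l] := dE x y; [rewrite /inrect xab ycd|exact: cdiff_vseg].
  split; last first.
    apply: sint_le => // y ycd; apply: hM; by rewrite /inrect xab ycd.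
  rewrite -cintD //; last 2 first.
  - exact: ccts_integrable.
  - by apply: ccts_integrable => y _; exact: cdiff_vseg (dG _).
  by apply: eq_cint => y _; rewrite /vseg FE.
have [|h1 h2] := hs c; first by rewrite lexx cd.
have [|h3 h4] := hs d; first by rewrite lexx cd.
have [|v1 v2] := vs a; first by rewrite lexx ab.
have [|v3 v4] := vs b; first by rewrite lexx ab.
have := bint_affine p q ab cd; rewrite /bint -/G => B0.
rewrite h1 h3 v1 v3.
set H1 := sint a b (hseg E c) in h2 *; set H2 := sint a b (hseg E d) in h4 *.
set V1 := sint c d (vseg E a) in v2 *; set V2 := sint c d (vseg E b) in v4 *.
rewrite [X in normc X](_ : _ = (H1 - H2) + 'i * (V2 - V1)); last first.
  by rewrite -[RHS]addr0 -B0; ring.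
apply: le_trans (le_normcD _ _) _.
rewrite ComplexField.Normc.normcM (_ : normc 'i = 1); last first.
  by rewrite normc_sqrt /sqn /= expr0n expr1n add0r sqrtr1.
rewrite mul1r; apply: le_trans (lerD (le_normcD _ _) (le_normcD _ _)) _.
rewrite !normcN; exact: rect_sides_le h2 h4 v2 v4.
Qed.

Definition rect := ((R * R) * (R * R))%type.

Definition rbint (Q : rect) := bint F Q.1.1 Q.1.2 Q.2.1 Q.2.2.

Definition half (i : bool) (s : R * R) : R * R :=
  if i then ((s.1 + s.2) / 2, s.2) else (s.1, (s.1 + s.2) / 2).

(** A quarter carrying at least a fourth of the boundary integral. The last one is taken by default;
    [bisect_le] shows that it then qualifies, as the four cannot all fail. *)
Definition bisect (Q : rect) : rect :=
  let q i j := (half i Q.1, half j Q.2) in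
  let big i j := normc (rbint Q) <= 4 * normc (rbint (q i j)) in
  if big false false then q false false else if big true false then q true false
  else if big false true then q false true else q true true.

Lemma bisectE Q : exists i j, bisect Q = (half i Q.1, half j Q.2).
Proof.
rewrite /bisect; case: ifP => _; first by exists false, false.
by case: ifP => _; [exists true, false|case: ifP => _; [exists false, true|exists true, true]].
Qed.

Lemma midpoint_between (a b : R) : a <= b -> a <= (a + b) / 2 <= b.
Proof. by move=> ab; apply/andP; split; lra. Qed.

Lemma normc_sum4_lt (A B C D : CC R) (x : R) : 4 * normc A < x -> 4 * normc B < x ->
  4 * normc C < x -> 4 * normc D < x -> normc (A + B + C + D) < x.
Proof.
move: (le_normcD (A + B + C) D) (le_normcD (A + B) C) (le_normcD A B).
move: (normc A) (normc B) (normc C) (normc D) (normc (A + B)) (normc (A + B + C)) => *.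
by lra.
Qed.

Lemma bisect_le Q : Q.1.1 <= Q.1.2 -> Q.2.1 <= Q.2.2 ->
  diff_on Q.1.1 Q.1.2 Q.2.1 Q.2.2 -> normc (rbint Q) <= 4 * normc (rbint (bisect Q)).
Proof.
case: Q => [[a b] [c d]] /= ab cd dF.
rewrite /bisect; case: ifPn => // /negbTE h1; case: ifPn => // /negbTE h2.
case: ifPn => // /negbTE h3; rewrite leNgt; apply/negP => h4.
move/negbT : h1; move/negbT : h2; move/negbT : h3; rewrite -!ltNge => h3 h2 h1.
have hx := midpoint_between ab; have hy := midpoint_between cd.
have e : rbint ((a, b), (c, d)) = rbint (half false (a, b), half false (c, d)) +
  rbint (half true (a, b), half false (c, d)) + rbint (half false (a, b), half true (c, d))
  + rbint (half true (a, b), half true (c, d)) by exact: bint_split hx hy dF.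
move: h1 h2 h3 h4; set A := rbint (half false _, half false _) in e *.
set B := rbint (half true _, half false _) in e *.
set C := rbint (half false _, half true _) in e *.
set D := rbint (half true _, half true _) in e *.
by move=> h1 h2 h3 h4; have := normc_sum4_lt h1 h2 h3 h4; rewrite -e ltxx.
Qed.

Lemma half_le i (s : R * R) : s.1 <= s.2 ->
  [/\ s.1 <= (half i s).1, (half i s).1 <= (half i s).2, (half i s).2 <= s.2 &
      (half i s).2 - (half i s).1 = (s.2 - s.1) / 2].
Proof. by case: s => a b /= ab; case: i => /=; split; lra. Qed.

Lemma nested_point (s : nat -> R * R) : (forall n, (s n).1 <= (s n).2) ->
  (forall n, (s n).1 <= (s n.+1).1 /\ (s n.+1).2 <= (s n).2) ->
  exists x, forall n, (s n).1 <= x <= (s n).2.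
Proof.
move=> ok mon.
have mon1 n k : (s n).1 <= (s (n + k)%N).1 /\ (s (n + k)%N).2 <= (s n).2.
  elim: k => [|k [h1 h2]]; first by rewrite addn0.
  rewrite addnS; have [h3 h4] := mon (n + k)%N.
  by split; [exact: le_trans h1 h3|exact: le_trans h4 h2].
have cross n m : (s n).1 <= (s m).2.
  have [h1 _] := mon1 n m; have [_ h2] := mon1 m n; rewrite addnC in h2.
  exact: le_trans h1 (le_trans (ok _) h2).
pose A := [set (s n).1 | n in [set: nat]].
have ub : has_ubound A by exists (s 0%N).2 => _ [n _ <-].
exists (sup A) => n; apply/andP; split; first by apply: ub_le_sup => //; exists n.
by apply: ge_sup => [|_ [m _ <-]]; [exists (s 0%N).1, 0%N|exact: cross].
Qed.

Theorem goursat a b c d : a <= b -> c <= d -> diff_on a b c d -> bint F a b c d = 0.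
Proof.
move=> ab cd dF; pose Q n := iter n bisect (((a, b), (c, d)) : rect).
pose L := (b - a) + (d - c).
have inv n : [/\ a <= (Q n).1.1, (Q n).1.1 <= (Q n).1.2, (Q n).1.2 <= b &
    [/\ c <= (Q n).2.1, (Q n).2.1 <= (Q n).2.2, (Q n).2.2 <= d,
     ((Q n).1.2 - (Q n).1.1) + ((Q n).2.2 - (Q n).2.1) = L / 2 ^+ n &
     normc (bint F a b c d) <= 4 ^+ n * normc (rbint (Q n))]].
  elim: n => [|n [h1 h2 h3 [h4 h5 h6 h7 h8]]].
    by split => //; split => //; rewrite expr0 ?divr1 ?mul1r.
  have := bisect_le h2 h5; rewrite /Q iterS -/(Q n).
  have [i [j ->]] /= := bisectE (Q n).
  have [k1 k2 k3 k4] := half_le i h2; have [k5 k6 k7 k8] := half_le j h5 => hb.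
  split; [exact: le_trans h1 k1|exact: k2|exact: le_trans k3 h3|split].
  - exact: le_trans h4 k5.
  - exact: k6.
  - exact: le_trans k7 h6.
  - by rewrite k4 k8 -mulrDl h7 exprSr invfM mulrA.
  - apply: le_trans h8 _; rewrite exprSr -mulrA ler_wpM2l ?exprn_ge0 //; apply: hb.
    move=> x y /andP[/andP[x1 x2] /andP[y1 y2]]; apply: dF.
    by rewrite /inrect (le_trans h1 x1) (le_trans x2 h3) (le_trans h4 y1) (le_trans y2 h6).
have step n : [/\ (Q n).1.1 <= (Q n.+1).1.1, (Q n.+1).1.2 <= (Q n).1.2,
    (Q n).2.1 <= (Q n.+1).2.1 & (Q n.+1).2.2 <= (Q n).2.2].
  have [_ h2 _ [_ h5 _ _ _]] := inv n.
  rewrite /Q iterS -/(Q n); have [i [j ->]] /= := bisectE (Q n).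
  by have [k1 k2 k3 k4] := half_le i h2; have [k5 k6 k7 k8] := half_le j h5.
have [x hx] : exists x, forall n, (Q n).1.1 <= x <= (Q n).1.2.
  apply: (@nested_point (fun n => (Q n).1)) => n; first by have [] := inv n.
  by have [] := step n.
have [y hy] : exists y, forall n, (Q n).2.1 <= y <= (Q n).2.2.
  apply: (@nested_point (fun n => (Q n).2)) => n; first by have [_ _ _ []] := inv n.
  by have [] := step n.
have [l dl] : exists l, cdiff F (x +i* y) l.
  by apply: dF; rewrite /inrect (hx 0%N) (hy 0%N).
have L0 : 0 <= L by rewrite addr_ge0 // subr_ge0.
suff small e : 0 < e -> normc (bint F a b c d) <= e * (4 * L ^+ 2).
  apply: ComplexField.Normc.eq0_normc; apply/eqP; rewrite eq_le normc_ge0 andbT.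
  apply/ler_addgt0Pr => e e0; rewrite add0r.
  have K0 : 0 < 4 * L ^+ 2 + 1 by rewrite ltr_wpDl // mulr_ge0 ?sqr_ge0.
  apply: le_trans (small (e / (4 * L ^+ 2 + 1)) _) _; first by rewrite divr_gt0.
  by rewrite mulrAC ler_pdivrMr // ler_wpM2l ?(ltW e0) // lerDl.
move=> e0; have [dd dd0 hd] := dl _ e0.
have [n hn] : exists n, L / 2 ^+ n < dd.
  exists (Num.truncn (L / dd)).+1.
  rewrite ltr_pdivrMr ?exprn_gt0 // mulrC -ltr_pdivrMr //.
  apply: lt_trans (truncnS_gt _) _.
  by rewrite -natrX ltr_nat ltn_expl.
have [h1 h2 h3 [h4 h5 h6 h7 h8]] := inv n.
apply: le_trans h8 _.
(* The [n]-th rectangle has half perimeter [L / 2^n] and the remainder on it is at most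
   [e * L / 2^n]; their product gains [4^n], exactly what the bisections have cost. *)
have := @bint_rem_le (F (x +i* y) - l * (x +i* y)) l (Q n).1.1 (Q n).1.2 (Q n).2.1 (Q n).2.2
  (e * (L / 2 ^+ n)) h2 h5.
rewrite h7 => rem.
have p2 : 0 < 2 ^+ n :> R by rewrite exprn_gt0.
apply: (@le_trans _ _ (4 ^+ n * (4 * (e * (L / 2 ^+ n) * (L / 2 ^+ n))))).
  rewrite ler_wpM2l ?exprn_ge0 //; apply: rem.
  - move=> x' y' /andP[/andP[x1 x2] /andP[y1 y2]]; apply: dF.
    by rewrite /inrect (le_trans h1 x1) (le_trans x2 h3) (le_trans h4 y1) (le_trans y2 h6).
  - by rewrite mulr_ge0 ?(ltW e0) // divr_ge0 // ltW.
  - move=> x' y' /andP[/andP[x1 x2] /andP[y1 y2]].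
    pose h : CC R := (x' - x) +i* (y' - y).
    have hE : (x +i* y) + h = x' +i* y'.
      by apply: complexP => /=; rewrite addrC subrK.
    have hle : normc h <= L / 2 ^+ n.
      apply: le_trans (normc_le_parts _) _; rewrite -h7 /=.
      have /andP[hx1 hx2] := hx n; have /andP[hy1 hy2] := hy n.
      by apply: lerD; rewrite ler_norml; apply/andP; split; lra.
    have := hd h (le_lt_trans hle hn); rewrite hE => hb.
    rewrite (_ : _ - _ = F (x' +i* y') - F (x +i* y) - l * h); last by rewrite -hE; ring.
    by apply: le_trans hb _; rewrite ler_wpM2l // ltW.
rewrite (_ : (4 : R) ^+ n = 2 ^+ n * 2 ^+ n); last by rewrite -exprMn -natrM.
rewrite le_eqVlt; apply/orP; left; apply/eqP.
by field; rewrite gt_eqF.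
Qed.

End Goursat.

(** * The complex exponential *)

Section ComplexExponential.
Context {R : realType}.
Implicit Types (z h : CC R).

Definition cexp z : CC R := (expR (Re z))%:C * circle (Im z).

Lemma cexpD z h : cexp (z + h) = cexp z * cexp h.
Proof.
rewrite /cexp /circle ReD ImD expRD cosD sinD.
by apply: complexP; rewrite !partsE; ring.
Qed.

Lemma is_derive_eps (f : R -> R) (x df : R) : is_derive x 1 f df ->
  forall e : R, 0 < e -> exists2 dl : R, 0 < dl &
    forall h : R, `|h| < dl -> `|f (x + h) - f x - df * h| <= e * `|h|.
Proof.
move=> [dv dfE] e e0.
have : (h^-1 *: (f (h *: 1 + x) - f x)) @[h --> (0 : R)^'] --> df.
  by rewrite -dfE; exact: dv.
move/cvgrPdist_le => /(_ _ e0)[dl /= d0 hd]; exists dl => // h hl.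
have [->|h0] := eqVneq h 0; first by rewrite addr0 subrr mulr0 subrr normr0 mulr0.
have n0 : 0 < `|h| by rewrite normr_gt0.
have := hd h; rewrite /= sub0r normrN => /(_ hl h0).
suff -> : `|f (x + h) - f x - df * h| = `|df - h^-1 *: (f (h *: 1 + x) - f x)| * `|h|.
  by rewrite ler_pM2r.
rewrite -normrM -normrN; congr Num.norm.
by rewrite [h *: 1]mulr1 (addrC h) /GRing.scale /= mulrBl mulrAC mulVf // mul1r opprB.
Qed.

Lemma cdiff_cexp z : cdiff cexp z (cexp z).
Proof.
(* The addition law carries the derivative at 0 to every other point. *)
suff H0 : cdiff cexp 0 1.
  move=> e e0; have n0 := normc_ge0 (cexp z).
  have K0 : 0 < normc (cexp z) + 1 by rewrite ltr_wpDl.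
  have eK : 0 < e / (normc (cexp z) + 1) by rewrite divr_gt0.
  have [dl d0 hd] := H0 _ eK; exists dl => // h /hd; rewrite add0r mul1r => le.
  have c0 : cexp 0 = 1.
    by rewrite /cexp /circle expR0 cos0 sin0; apply: complexP; rewrite !partsE; ring.
  rewrite c0 in le.
  have -> : cexp (z + h) - cexp z - cexp z * h = cexp z * (cexp h - 1 - h).
    by rewrite cexpD; ring.
  rewrite ComplexField.Normc.normcM; apply: le_trans (ler_wpM2l n0 le) _.
  rewrite mulrA ler_wpM2r ?normc_ge0 // mulrCA ger_pMr // ler_pdivrMr // mul1r lerDl //.
(* The error terms below add up to [9 * m * |h|], so [m <= e / 16] leaves room, while [m <= 1] keeps
   [|expR x|] below 3. *)
move=> e e0; have [m [m0 m1 m8]] : exists m : R, [/\ 0 < m, m <= 1 & m <= e / 16].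
  exists (Num.min (e / 16) 1); split; last by rewrite ge_min lexx.
    by rewrite lt_min ltr01 andbT divr_gt0.
  by rewrite ge_min lexx orbT.
have [d1 d10 h1] := is_derive_eps (is_derive_expR (0 : R)) m0.
have [d2 d20 h2] := is_derive_eps (is_derive_cos (0 : R)) m0.
have [d3 d30 h3] := is_derive_eps (is_derive_sin (0 : R)) m0.
exists (Num.min (Num.min d1 d2) (Num.min d3 m)) => [|h].
  by rewrite !lt_min d10 d20 d30 m0.
rewrite !lt_min => /andP[/andP[k1 k2] /andP[k3 k4]].
have hx := Re_le_normc h; have hy := Im_le_normc h.
have c0 : cexp 0 = 1.
  by rewrite /cexp /circle expR0 cos0 sin0; apply: complexP; rewrite !partsE; ring.
rewrite add0r c0 mul1r; move: hx hy.
set x := Re h; set y := Im h; set t : R := normc h => hx hy.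
have := h1 x (le_lt_trans hx k1); have := h2 y (le_lt_trans hy k2).
have := h3 y (le_lt_trans hy k3).
rewrite !add0r expR0 cos0 sin0 !mul1r !oppr0 mul0r !(subr0, oppr0, addr0).
set E := expR x; set C := cos y; set S := sin y => s1 s2 s3.
have t0 : 0 <= t := normc_ge0 _.
have k4' : t < m := k4.
have bE : `|E| <= 3.
  have := ler_normD (E - 1 - x) (1 + x).
  rewrite (_ : E - 1 - x + (1 + x) = E); last by ring.
  move=> le.
  have h4 := ler_normD 1 x; rewrite normr1 in h4.
  have : m * `|x| <= 1 by rewrite mulr_ile1 // ?(ltW m0) //; lra.
  lra.
have bE1 : `|E - 1| <= 2 * `|x|.
  have := ler_normD (E - 1 - x) x; rewrite subrK => le.
  have : m * `|x| <= `|x| by rewrite ler_piMl.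
  lra.
have mt : m * `|x| <= m * t by rewrite ler_wpM2l // ltW.
have mt' : m * `|y| <= m * t by rewrite ler_wpM2l // ltW.
have me : m * t <= e / 16 * t by rewrite ler_wpM2r.
apply: le_trans (normc_le_parts _) _.
have -> : Re (cexp h - 1 - h) = E * C - 1 - x by rewrite /cexp /circle !partsE mul0r subr0.
have -> : Im (cexp h - 1 - h) = E * S - y by rewrite /cexp /circle !partsE mul0r addr0 subr0.
have -> : E * C - 1 - x = E * (C - 1) + (E - 1 - x) by ring.
have -> : E * S - y = E * (S - y) + (E - 1) * y by ring.
have r1 := ler_normD (E * (C - 1)) (E - 1 - x).
have r2 := ler_normD (E * (S - y)) ((E - 1) * y).
rewrite !normrM in r1 r2.
have p1 : `|E| * `|C - 1| <= 3 * (m * t) by rewrite ler_pM // (le_trans s2).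
have p2 : `|E| * `|S - y| <= 3 * (m * t) by rewrite ler_pM // (le_trans s1).
have p3 : `|E - 1| * `|y| <= 2 * t * m.
  by apply: ler_pM => //; [apply: le_trans bE1 _; rewrite ler_wpM2l|rewrite (le_trans hy) // ltW].

have et0 : 0 <= e * t by rewrite mulr_ge0 // ltW.
lra.
Qed.
End ComplexExponential.

(** * Continuous complex-valued paths *)

Section ContinuousPaths.
Context {R : realType}.
Local Notation leb := (@lebesgue_measure R).
Implicit Types (u v : R -> CC R) (x : R).

Lemma ccts_of_parts u x : {for x, continuous (fun y => Re (u y))} ->
  {for x, continuous (fun y => Im (u y))} -> ccts u x.
Proof.
move=> h k e e0; have e2 : 0 < e / 2 by rewrite divr_gt0.
move/cvgrPdist_lt : h => /(_ _ e2)[d1 /= d10 h1].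
move/cvgrPdist_lt : k => /(_ _ e2)[d2 /= d20 h2].
exists (Num.min d1 d2) => [|y]; first by rewrite lt_min d10.
rewrite lt_min distrC => /andP[/h1 k1 /h2 k2].
rewrite normcB; apply: le_lt_trans (normc_le_parts _) _; rewrite ReB ImB.
by rewrite [ltRHS](splitr e) ltrD.
Qed.

Lemma cctsM u v x : ccts u x -> ccts v x -> ccts (fun y => u y * v y) x.
Proof.
move=> /ccts_parts[a b] /ccts_parts[c d]; apply: ccts_of_parts.
- rewrite (_ : (fun y => _) = fun y => Re (u y) * Re (v y) - Im (u y) * Im (v y)).
    by apply: cvgB; apply: cvgM.
  by apply/funext => y; rewrite ReM.
- rewrite (_ : (fun y => _) = fun y => Re (u y) * Im (v y) + Im (u y) * Re (v y)).
    by apply: cvgD; apply: cvgM.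
  by apply/funext => y; rewrite ImM.
Qed.

Lemma cctsB u v x : ccts u x -> ccts v x -> ccts (fun y => u y - v y) x.
Proof.
move=> /ccts_parts[a b] /ccts_parts[c d]; apply: ccts_of_parts.
- rewrite (_ : (fun y => _) = fun y => Re (u y) - Re (v y)); first exact: cvgB.
  by apply/funext => y; rewrite ReB.
- rewrite (_ : (fun y => _) = fun y => Im (u y) - Im (v y)); first exact: cvgB.
  by apply/funext => y; rewrite ImB.
Qed.

Lemma cctsJ u x : ccts u x -> ccts (fun y => (u y)^*) x.
Proof.
move=> h e /h[dl d0 hd]; exists dl => // y /hd; by rewrite -rmorphB normc_conj.
Qed.

Lemma ccts_cst (c : CC R) x : ccts (fun=> c) x.
Proof. by move=> e e0; exists 1 => // y _; rewrite subrr ComplexField.Normc.normc0. Qed.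

Lemma cctsX u x n : ccts u x -> ccts (fun y => u y ^+ n) x.
Proof.
move=> h; elim: n => [|n IH].
  by rewrite (_ : (fun y => _) = fun=> 1); [exact: ccts_cst|apply/funext => y; rewrite expr0].
rewrite (_ : (fun y => _) = fun y => u y * u y ^+ n); first exact: cctsM.
by apply/funext => y; rewrite exprS.
Qed.

End ContinuousPaths.

(** * Means over circles and orthogonality on the unit circle *)

Section Circle.
Context {R : realType}.
Local Notation leb := (@lebesgue_measure R).
Local Notation pi2 := (2 * (pi : R)).
Local Notation L2c := (L2 leb (@angles R) (@dtheta R)).
Local Notation innerc := (L2inner leb (@angles R) (@dtheta R)).
Local Notation nrm2c := (nrm2 leb (@angles R) (@dtheta R)).
Local Notation circ := (@circle R).
Implicit Types (g : CC R -> CC R) (u v : R -> CC R) (r t : R).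

Lemma pi2_gt0 : 0 < pi2. Proof. by rewrite mulr_gt0 // pi_gt0. Qed.

Lemma mangles : measurable (@angles R : set (measurableTypeR R)). Proof. exact: measurable_itv. Qed.
Lemma mdtheta :
  measurable_fun (@angles R : set (measurableTypeR R)) (@dtheta R : measurableTypeR R -> R). Proof. exact: measurable_cst. Qed.
Lemma dtheta_ge0 x : (@angles R) x -> 0 <= (@dtheta R) x.
Proof. by move=> _; rewrite invr_ge0 ltW // pi2_gt0. Qed.

Lemma cexp_circle r t : 0 < r -> cexp ((ln r) +i* t) = r%:C * circ t.
Proof. by move=> r0; rewrite /cexp ReC ImC lnK. Qed.

Lemma circle_pi2 : circ pi2 = circ 0.
Proof.
by rewrite /circle cos0 sin0 mulr_natl cos2pi sin2pi.
Qed.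

Lemma sqn_circle t : sqn (circ t) = 1.
Proof. by rewrite /sqn /circle ReC ImC cos2Dsin2. Qed.

Lemma normc_circle t : normc (circ t) = 1.
Proof. by rewrite normc_sqrt sqn_circle sqrtr1. Qed.

Lemma circle_neq0 t : circ t != 0.
Proof. by apply/eqP => e; have := sqn_circle t; rewrite e sqn0 => /eqP; rewrite eq_sym oner_eq0. Qed.

Lemma circleJ t : (circ t)^* = (circ t)^-1.
Proof.
apply: (mulfI (circle_neq0 t)); rewrite mulJ_sqn sqn_circle mulfV //; exact: circle_neq0.
Qed.

(** The exponential maps the rectangle [[ln r1, ln r2] x [0, 2 pi]] onto the annulus. By periodicity
    the horizontal sides cancel, and Goursat's theorem equates the vertical ones. The origin is
    excluded from the hypothesis so that [g] may contain negative powers. *)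
Lemma annulus_mean g r1 r2 : 0 < r1 -> r1 <= r2 ->
  (forall z : CC R, 0 < normc z <= r2 -> exists l, cdiff g z l) ->
  sint 0 pi2 (fun t => g (r1%:C * circ t)) = sint 0 pi2 (fun t => g (r2%:C * circ t)).
Proof.
move=> r10 r12 dg; have r20 := lt_le_trans r10 r12.
pose F z := g (cexp z).
have nE (x y : R) : normc (cexp (x +i* y)) = expR x.
  rewrite /cexp ReC ImC ComplexField.Normc.normcM normcR. rewrite normc_circle mulr1.
  by rewrite ger0_norm // expR_ge0.
have dF : diff_on F (ln r1) (ln r2) 0 pi2.
  move=> x y /andP[/andP[x1 x2] _].
  have [|l dl] := dg (cexp (x +i* y)).
    by rewrite nE expR_gt0 /= -(lnK r20) ler_expR.
  by eexists; apply: cdiff_comp dl; exact: cdiff_cexp.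
have := goursat _ _ dF; rewrite /bint.
have -> : hseg F 0 = hseg F pi2.
  by apply/funext => x; rewrite /hseg /F /cexp !ReC !ImC circle_pi2.
rewrite subrr add0r => /(_ _ _)/eqP; rewrite mulf_eq0.
rewrite ler_ln ?posrE // r12 (ltW pi2_gt0) => /(_ isT isT)/orP[|].
  by rewrite eq_complex /= oner_eq0 andbF.
rewrite subr_eq0 => /eqP e.
have vE r : 0 < r -> sint 0 pi2 (fun t => g (r%:C * circ t)) = sint 0 pi2 (vseg F (ln r)).
  by move=> r0; apply: eq_cint => t _; rewrite /vseg /F cexp_circle.
rewrite (vE r1 r10) (vE r2 r20); exact: esym e.
Qed.

Lemma ccts_cdiff_circle g r t l : 0 < r -> cdiff g (r%:C * circ t) l ->
  ccts (fun t => g (r%:C * circ t)) t.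
Proof.
move=> r0 dg; rewrite (_ : (fun t => _) = vseg (fun z => g (cexp z)) (ln r)).
  apply: (@cdiff_vseg _ (fun z => g (cexp z))); apply: cdiff_comp (cdiff_cexp _) _.
  by rewrite cexp_circle //; exact: dg.
by apply/funext => s; rewrite /vseg cexp_circle.
Qed.

Lemma ccts_circle t : ccts circ t.
Proof.
have := @ccts_cdiff_circle id 1 t 1 ltr01 (cdiff_id _).
by rewrite (_ : (fun t => _) = circ) //; apply/funext => s; rewrite mul1r.
Qed.

Lemma L2_ccts u : (forall t, ccts u t) -> L2c u.
Proof.
move=> cu; have c t (_ : 0 <= t <= pi2) := cu t.
apply/(L2P leb mdtheta dtheta_ge0); split.
  have [/integrableP[/measurable_EFinP a _] /integrableP[/measurable_EFinP b _]] :=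
    ccts_integrable c.
  by [].
have cJ t (_ : 0 <= t <= pi2) := cctsM (cu t) (cctsJ (cu t)).
have [h _] := ccts_integrable cJ.
have := integrableZl mangles (2 * pi)^-1 h; apply: eq_integrable => [|t _]; first exact: mangles.
by rewrite mulJ_sqn /= -EFinM.
Qed.

Lemma innercE u v : (forall t, ccts u t) -> (forall t, ccts v t) ->
  innerc u v = (pi2^-1)%:C * sint 0 pi2 (fun t => u t * (v t)^*).
Proof.
move=> cu cv.
have ci : cintegrable leb (@angles R) (fun t => u t * (v t)^*).
  by apply: ccts_integrable => t _; apply: cctsM => //; exact: cctsJ.
rewrite innerE; exact: (cintZ mangles (pi2^-1)%:C ci).
Qed.

Lemma L2c_one : L2c (fun=> 1).
Proof. by apply: L2_ccts => t; exact: ccts_cst. Qed.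

Lemma sint_cst (c : CC R) : sint 0 pi2 (fun=> c) = c * pi2%:C.
Proof.
have := @sint_affine R 0 pi2 c 0 (ltW pi2_gt0).
rewrite mul0r addr0 subr0 => <-; apply: eq_cint => x _; by rewrite mul0r addr0.
Qed.

(** For a positive power the integrals over the radii 1/2 and 1 agree, yet one is [2^-(n+1)] times
    the other, so both vanish. *)
Lemma sint_circleX n : sint 0 pi2 (fun t => circ t ^+ n) = if n == 0%N then pi2%:C else 0.
Proof.
case: n => [|n] /=.
  by under [X in sint _ _ X]eq_fun do rewrite expr0; rewrite sint_cst mul1r.
have ci : cintegrable leb `[0, pi2] (fun t => circ t ^+ n.+1).
  by apply: ccts_integrable => t _; apply: cctsX; exact: ccts_circle.
have dX (z : CC R) : exists l, cdiff (fun z => z ^+ n.+1) z l.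
  elim: (n.+1) => [|k [l dl]].
    exists 0; rewrite (_ : (fun z => _) = fun=> 1); first exact: cdiff_cst.
    by apply/funext => y; rewrite expr0.
  eexists; rewrite (_ : (fun z => _) = fun z => z * z ^+ k).
    by apply: cdiffM; [exact: cdiff_id|exact: dl].
  by apply/funext => y; rewrite exprS.
have h : (2^-1 : R) <= 1 by lra.
have := @annulus_mean (fun z => z ^+ n.+1) 2^-1 1 _ h (fun z _ => dX z).
have sE r : sint 0 pi2 (fun t => (r%:C * circ t) ^+ n.+1) =
    (r ^+ n.+1)%:C * sint 0 pi2 (fun t => circ t ^+ n.+1).
  by rewrite -(cintZ mangles) //; apply: eq_cint => t _; rewrite exprMn rmorphXn.
rewrite !sE expr1n => /(_ _)/eqP; rewrite invr_gt0 ltr0n => /(_ isT).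
rewrite -subr_eq0 -mulrBl mulf_eq0 => /orP[|/eqP//].
rewrite -rmorphB fmorph_eq0 subr_eq0 => /eqP e; exfalso.
have : (2^-1 : R) ^+ n.+1 < 1 by rewrite exprn_ilt1 // ?invr_ge0 //; lra.
by rewrite e ltxx.
Qed.

Lemma inner_circle n m : innerc (fun t => circ t ^+ n) (fun t => circ t ^+ m) =
  (if n == m then 1 else 0)%:C.
Proof.
have H k l : innerc (fun t => circ t ^+ (k + l)) (fun t => circ t ^+ l) =
    (if k == 0%N then 1 else 0)%:C.
  rewrite innercE; [|by move=> t; apply: cctsX; exact: ccts_circle..].
  rewrite (_ : sint _ _ _ = sint 0 pi2 (fun t => circ t ^+ k)); last first.
    apply: eq_cint => t _; rewrite rmorphXn /= circleJ exprD -mulrA -exprMn mulfV ?expr1n ?mulr1 //.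
    exact: circle_neq0.
  rewrite sint_circleX; case: eqP => _; rewrite ?mulr0 //.
  by rewrite -rmorphM mulVf // gt_eqF // pi2_gt0.
have [le|lt] := leqP m n.
  have e : (n - m == 0)%N = (n == m) by apply/eqP/eqP; lia.
  by have := H (n - m)%N m; rewrite subnK // e.
rewrite (innerJ mangles mdtheta dtheta_ge0); [|by apply: L2_ccts => t; apply: cctsX; exact: ccts_circle..].
have e : (m - n == 0)%N = (n == m) by apply/eqP/eqP; lia.
by have := H (m - n)%N n; rewrite subnK ?(ltnW lt) // e => ->; apply: complexP; rewrite !partsE ?oppr0.
Qed.

End Circle.

Lemma bounded_series_cvg0 {R : realType} (x : nat -> R) (B : R) : (forall n, 0 <= x n) ->
  (forall N, \sum_(n < N) x n <= B) -> x n @[n --> \oo] --> (0 : R).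
Proof.
move=> x0 xB; apply: cvg_series_cvg_0; apply: nondecreasing_is_cvgn.
  by apply: nondecreasing_series => n _ _; exact: x0.
by exists B => _ [N _ <-]; rewrite /series /= big_mkord.
Qed.

(** * Decay of Fourier coefficients on the circle *)

Section CircleFourier.
Context {R : realType}.
Local Notation leb := (@lebesgue_measure R).
Local Notation pi2 := (2 * (pi : R)).
Local Notation L2c := (L2 leb (@angles R) (@dtheta R)).
Local Notation innerc := (L2inner leb (@angles R) (@dtheta R)).
Local Notation nrm2c := (nrm2 leb (@angles R) (@dtheta R)).
Local Notation circ := (@circle R).
Implicit Types (u v : R -> CC R).

Lemma cmeas_circle : cmeas (@angles R : set (measurableTypeR R)) circ.
Proof.
by have := L2_ccts (@ccts_circle R) => /(L2_cmeas mdtheta (@dtheta_ge0 R)).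
Qed.

Lemma sqn_circle_le t : (@angles R) t -> sqn (circ t) <= 1.
Proof. by move=> _; rewrite sqn_circle. Qed.

Lemma bessel_circle u N : L2c u ->
  \sum_(n < N) sqn (innerc u (fun t => circ t ^+ n)) <= nrm2c u.
Proof.
move=> Lu.
have := bessel mangles mdtheta (@dtheta_ge0 R) cmeas_circle sqn_circle_le L2c_one
  (fun=> ltr01) (@inner_circle R) N Lu.
apply: le_trans; apply: ler_sum => n _.
by rewrite /pcoef invr1 mul1r mul1r.
Qed.

(** The Riemann-Lebesgue lemma, obtained from Bessel's inequality. *)
Lemma inner_circle_cvg0 u : L2c u ->
  (sqn (innerc u (fun t => circ t ^+ n))) @[n --> \oo] --> (0 : R).
Proof.
move=> Lu; apply: (bounded_series_cvg0 (B := nrm2c u)) => [n|N]; first exact: sqn_ge0.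
exact: bessel_circle.
Qed.

Lemma innerJJ u v : L2c u -> L2c v ->
  innerc (fun t => (u t)^*) (fun t => (v t)^*) = (innerc u v)^*.
Proof.
move=> Lu Lv; rewrite -(innerJ mangles mdtheta (@dtheta_ge0 R)) // !innerE.
by apply: eq_cint => t _; rewrite /wprod conjCK; ring.
Qed.

Lemma L2_circleX n : L2c (fun t => circ t ^+ n).
Proof. by apply: L2_ccts => t; apply: cctsX; exact: ccts_circle. Qed.

Lemma L2c_J u : L2c u -> L2c (fun t => (u t)^*).
Proof. exact: (L2J mdtheta (@dtheta_ge0 R)). Qed.

Lemma inner_circleJ_cvg0 u : L2c u ->
  (sqn (innerc u (fun t => (circ t ^+ n)^*))) @[n --> \oo] --> (0 : R).
Proof.
move=> Lu; rewrite (_ : (fun n => _) =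
    fun n => sqn (innerc (fun t => (u t)^*) (fun t => circ t ^+ n))).
  exact: inner_circle_cvg0 (L2c_J Lu).
apply/funext => n; rewrite -(sqnJ (innerc u _)) -innerJJ //; last by apply: L2c_J; exact: L2_circleX.
congr sqn; rewrite !innerE; apply: eq_cint => t _.
by rewrite /wprod conjCK.
Qed.

End CircleFourier.

(** * Cauchy coefficients and convergence of the Taylor series *)

Section PowerSeries.
Context {R : realType}.
Local Notation leb := (@lebesgue_measure R).
Local Notation pi2 := (2 * (pi : R)).
Local Notation L2c := (L2 leb (@angles R) (@dtheta R)).
Local Notation innerc := (L2inner leb (@angles R) (@dtheta R)).
Local Notation nrm2c := (nrm2 leb (@angles R) (@dtheta R)).
Local Notation circ := (@circle R).
Variable f : CC R -> CC R.
Hypothesis hf : holomorphic_disc f.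

Definition on_circle (g : CC R -> CC R) (r : R) : R -> CC R := fun t => g (r%:C * circ t).

Lemma normc_rcircle r t : 0 <= r -> normc (r%:C * circ t) = r.
Proof.
by move=> r0; rewrite ComplexField.Normc.normcM normc_circle mulr1 normcR ger0_norm.
Qed.

Let df z : normc z < 1 -> cdiff f z (derive1 f z).
Proof. by move=> /hf /derivable_cdiff. Qed.

Let cfr r t : 0 < r < 1 -> ccts (on_circle f r) t.
Proof.
move=> /andP[r0 r1]; apply: (@ccts_cdiff_circle _ f) => //; apply: df.
by rewrite normc_rcircle ?ltW.
Qed.

Lemma annulus_mean_disc (g : CC R -> CC R) r1 r2 : 0 < r1 < 1 -> 0 < r2 < 1 ->
  (forall z : CC R, 0 < normc z < 1 -> exists l, cdiff g z l) ->
  sint 0 pi2 (on_circle g r1) = sint 0 pi2 (on_circle g r2).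
Proof.
move=> /andP[r10 r11] /andP[r20 r21] dg.
have [le|/ltW le] := leP r1 r2; [|symmetry]; apply: annulus_mean => // z /andP[z0 z1];
  by apply: dg; rewrite z0 (le_lt_trans z1).
Qed.

Lemma cdiff_exp n (z : CC R) : exists l, cdiff (fun x => x ^+ n) z l.
Proof.
elim: n => [|n [l dl]].
  by exists 0; rewrite (_ : (fun _ => _) = fun=> 1); [exact: cdiff_cst|apply/funext => y; rewrite expr0].
eexists; rewrite (_ : (fun _ => _) = fun x => x * x ^+ n).
  by apply: cdiffM; [exact: cdiff_id|exact: dl].
by apply/funext => y; rewrite exprS.
Qed.

Lemma normc_gt0 (z : CC R) : (0 < normc z) = (z != 0).
Proof.
rewrite lt_def normc_ge0 andbT; congr (~~ _); apply/eqP/eqP => [|->].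
  exact: ComplexField.Normc.eq0_normc.
exact: ComplexField.Normc.normc0.
Qed.

(** The Taylor coefficient read off the circle of radius 1/2. The radius is arbitrary, as
    [inner_on_circle] shows. *)
Definition tcoef n : CC R := 2 ^+ n * innerc (on_circle f 2^-1) (fun t => circ t ^+ n).

Let half1 : 0 < (2^-1 : R) < 1. Proof. by apply/andP; split; lra. Qed.

(** [f z / z^n] is differentiable off the origin, so its circle means do not depend on the
    radius. *)
Lemma inner_on_circle r n : 0 < r < 1 ->
  innerc (on_circle f r) (fun t => circ t ^+ n) = tcoef n * (r ^+ n)%:C.
Proof.
pose g z := f z * z^-1 ^+ n.
have dg z : 0 < normc z < 1 -> exists l, cdiff g z l.
  move=> /andP[z0 z1]; have [l dl] := cdiff_exp n z^-1.
  eexists; apply: cdiffM; first exact: df.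
  apply: (@cdiff_comp _ (fun x => x ^+ n) (fun x => x^-1)); last exact: dl.
  by apply: cdiffV; rewrite -normc_gt0.
have gE r' : 0 < r' < 1 -> innerc (on_circle f r') (fun t => circ t ^+ n) =
    (pi2^-1)%:C * ((r' ^+ n)%:C * sint 0 pi2 (on_circle g r')).
  move=> r01; have /andP[r0 r1] := r01.
  rewrite innercE; [|by move=> t; exact: cfr|by move=> t; apply: cctsX; exact: ccts_circle].
  congr (_ * _).
  have ci : cintegrable leb `[0, pi2] (on_circle g r').
    apply: ccts_integrable => t _.
    have [|l dl] := dg (r'%:C * circ t); first by rewrite normc_rcircle ?ltW // r0.
    exact: (@ccts_cdiff_circle _ g) dl.
  rewrite /sint -(cintZ mangles _ ci); apply: eq_cint => t _.
  have rn : (r' ^+ n)%:C * (r'%:C)^-1 ^+ n = 1 :> CC R.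
    by rewrite rmorphXn /= -exprMn mulfV ?expr1n // fmorph_eq0 gt_eqF.
  rewrite /on_circle /g rmorphXn /= circleJ invfM exprMn -[LHS]mul1r -rn; ring.
move=> r01; rewrite gE // /tcoef gE //.
have e2 : (2 : CC R) ^+ n * ((2^-1 : R) ^+ n)%:C = 1.
  rewrite rmorphXn /= -exprMn (_ : 2 * (2^-1)%:C = 1) ?expr1n //.
  by apply: complexP; rewrite !partsE /=; field.
have alg (c b p a S : CC R) : c * b = 1 -> p * (a * S) = c * (p * (b * S)) * a.
  by move=> cb; rewrite -[LHS]mul1r -cb; ring.
rewrite -(alg _ _ _ _ _ e2).
exact: (congr1 (fun S => _ * (_ * S)) (annulus_mean_disc r01 half1 dg)).
Qed.

(** The exponential never reaches the origin; shrinking the radius fills this gap for functions that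
    are small near 0, such as [f z * z^(n+1)] and [f z - f 0]. *)
Lemma sint_small (g : CC R -> CC R) (c : CC R) : (forall r, 0 < r < 1 -> forall t, ccts (on_circle g r) t) ->
  (forall r, 0 < r < 1 -> sint 0 pi2 (on_circle g r) = c) ->
  (forall e : R, 0 < e -> exists2 dl : R, 0 < dl & forall z, normc z < dl -> normc (g z) <= e) ->
  c = 0.
Proof.
move=> cg gc g0; apply: ComplexField.Normc.eq0_normc; apply/eqP.
rewrite eq_le normc_ge0 andbT; apply/ler_addgt0Pr => e e0; rewrite add0r.
have p0 := @pi2_gt0 R.
have [dl d0 hd] := g0 (e / (2 * pi2)) (divr_gt0 e0 (mulr_gt0 (ltr0n _ 2) p0)).
have [r /andP[r0 r1] rd] : exists2 r : R, 0 < r < 1 & r < dl.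
  exists (Num.min dl 1 / 2); last first.
    have : Num.min dl 1 <= dl by rewrite ge_min lexx.
    lra.
  have : Num.min dl 1 <= 1 by rewrite ge_min lexx orbT.
  have : 0 < Num.min dl 1 by rewrite lt_min d0 ltr01.
  by move=> h1 h2; apply/andP; split; lra.
rewrite -(gc r) ?r0 //.
have := @sint_le R (on_circle g r) 0 pi2 (e / (2 * pi2)) (ltW p0).
rewrite subr0 => h; apply: le_trans (h _ _ _) _.
- by rewrite divr_ge0 ?(ltW e0) // mulr_ge0 // ltW.
- by move=> t _; apply: cg; rewrite r0.
- by move=> t _; apply: hd; rewrite normc_rcircle // ltW.
- have pn : (pi : R) != 0 by rewrite gt_eqF // pi_gt0.
  rewrite le_eqVlt; apply/orP; left; apply/eqP; move: (pi : R) pn => p pn; by field.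
Qed.

Lemma inner_on_circleJ r n : 0 < r < 1 ->
  innerc (on_circle f r) (fun t => (circ t ^+ n.+1)^*) = 0.
Proof.
move=> r01; have /andP[r0 r1] := r01; pose g z := f z * z ^+ n.+1.
have dg z : normc z < 1 -> exists l, cdiff g z l.
  move=> z1; have [l dl] := cdiff_exp n.+1 z.
  by eexists; apply: cdiffM; [exact: df|exact: dl].
have cg r' : 0 < r' < 1 -> forall t, ccts (on_circle g r') t.
  move=> /andP[r'0 r'1] t.
  have [|l dl] := dg (r'%:C * circ t); first by rewrite normc_rcircle // ltW.
  exact: (@ccts_cdiff_circle _ g) dl.
have z0 : sint 0 pi2 (on_circle g r) = 0.
  apply: (sint_small cg) => [r' r'01|e e0].
    by apply: annulus_mean_disc => // z /andP[_]; exact: dg.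
  have [|dl d0 hd] := cdiff_continuous (df (z := 0) _) e0; first by rewrite ComplexField.Normc.normc0.
  pose K := normc (f 0) + e; have K0 : 0 < K by rewrite ltr_wpDl // normc_ge0.
  exists (Num.min dl (Num.min 1 (e / K))) => [|z].
    by rewrite !lt_min d0 ltr01 divr_gt0.
  rewrite !lt_min => /and3P[h1 h2 h3].
  rewrite /g ComplexField.Normc.normcM normcX exprS.
  have fz : normc (f z) <= K.
    have := hd z; rewrite subr0 => /(_ h1) h.
    have := le_normcD (f 0) (f z - f 0); rewrite addrC subrK /K; lra.
  apply: le_trans (ler_wpM2r _ fz) _; first by rewrite mulr_ge0 ?exprn_ge0 ?normc_ge0.
  apply: (@le_trans _ _ (K * normc z)).
    rewrite ler_wpM2l ?(ltW K0) // ler_piMr ?normc_ge0 // exprn_ile1 ?normc_ge0 //.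
    exact: ltW.
  by rewrite mulrC -ler_pdivlMr // ltW.
rewrite innercE; [|by move=> t; exact: cfr|by move=> t; apply: cctsJ; apply: cctsX; exact: ccts_circle].
have rn0 : (r ^+ n.+1)%:C != 0 :> CC R by rewrite fmorph_eq0 expf_neq0 // gt_eqF.
rewrite (_ : sint _ _ _ = 0) ?mulr0 //; apply: (mulfI rn0); rewrite mulr0 -z0.
rewrite /sint -(cintZ mangles); last first.
  apply: ccts_integrable => t _; apply: cctsM; first exact: cfr.
  by apply: cctsJ; apply: cctsJ; apply: cctsX; exact: ccts_circle.
by apply: eq_cint => t _; rewrite conjCK /on_circle /g exprMn rmorphXn; ring.
Qed.

Lemma tcoef0 : tcoef 0 = f 0.
Proof.
apply/eqP; rewrite -subr_eq0; apply/eqP.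
have p0 := @pi2_gt0 R.
suff : sint 0 pi2 (on_circle (fun z => f z - f 0) 2^-1) = 0.
  have cf1 t := cfr t half1.
  have ci : cintegrable leb `[0, pi2] (on_circle f 2^-1) by apply: ccts_integrable => t _.
  have := innercE cf1 (fun t => ccts_cst 1 t).
  rewrite (_ : innerc _ _ = tcoef 0); last first.
    by rewrite /tcoef expr0 mul1r !innerE; apply: eq_cint => t _; rewrite /wprod /= ?expr0.
  move=> -> h.
  have e : sint 0 pi2 (fun t => on_circle f 2^-1 t * 1^*) =
      sint 0 pi2 (on_circle (fun z => f z - f 0) 2^-1) + sint 0 pi2 (fun=> f 0).
    rewrite /sint -(cintD mangles).
    - by apply: eq_cint => t _; rewrite rmorph1 mulr1 /on_circle subrK.
    - by apply: ccts_integrable => t _; apply: cctsB; [exact: cf1|exact: ccts_cst].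
    - by apply: ccts_integrable => t _; exact: ccts_cst.
  rewrite e h add0r sint_cst mulrCA -rmorphM mulVf ?mulr1 ?subrr //.
  by rewrite gt_eqF.
apply: (@sint_small (fun z => f z - f 0)) => [r r01 t|r r01|e e0].
- by apply: cctsB; [exact: cfr|exact: ccts_cst].
- apply: annulus_mean_disc => // z /andP[_ z1].
  by eexists; apply: cdiffB; [exact: df|exact: cdiff_cst].
- have [|dl d0 hd] := cdiff_continuous (df (z := 0) _) e0; first by rewrite ComplexField.Normc.normc0.
  by exists dl => // z zd; apply/ltW/hd; rewrite subr0.
Qed.

Definition dquot (z0 z : CC R) : CC R :=
  if z == z0 then derive1 f z0 else (f z - f z0) * (z - z0)^-1.

Lemma dquotE z0 z : f z - f z0 = (z - z0) * dquot z0 z.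
Proof.
rewrite /dquot; case: eqP => [->|/eqP ne]; first by rewrite !subrr mul0r.
by rewrite mulrC mulfVK // subr_eq0.
Qed.

(** At [z0] this is the differentiability of [f]. Continuity is what Chernoff's argument asks of the
    quotient, of which only the Fourier coefficients on one circle enter. *)
Lemma dquot_continuous z0 z : normc z0 < 1 -> normc z < 1 -> forall e : R, 0 < e ->
  exists2 dl : R, 0 < dl &
    forall z', normc (z' - z) < dl -> normc (dquot z0 z' - dquot z0 z) < e.
Proof.
move=> z01 z1 e e0; have [->|ne] := eqVneq z z0.
  have e2 : 0 < e / 2 by rewrite divr_gt0.
  have [dl d0 hd] := df z01 e2; exists dl => // z' zd.
  rewrite /dquot eqxx; case: eqP => [_|/eqP ne].
    by rewrite subrr ComplexField.Normc.normc0.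
  have := hd _ zd; rewrite (_ : z0 + (z' - z0) = z'); last by ring.
  have nz : z' - z0 != 0 by rewrite subr_eq0.
  have n0 : 0 < normc (z' - z0) by rewrite normc_gt0.
  rewrite (_ : f z' - f z0 - _ = ((f z' - f z0) / (z' - z0) - derive1 f z0) * (z' - z0)).
    by rewrite ComplexField.Normc.normcM ler_pM2r // => /le_lt_trans; apply; lra.
  by rewrite mulrBl mulfVK.
have nz : z - z0 != 0 by rewrite subr_eq0.
have n0 : 0 < normc (z - z0) by rewrite normc_gt0.
have [l dk] : exists l, cdiff (fun x => (f x - f z0) * (x - z0)^-1) z l.
  eexists; apply: cdiffM; first by apply: cdiffB; [exact: df|exact: cdiff_cst].
  apply: (@cdiff_comp _ (fun x => x^-1) (fun x => x - z0)).
    by apply: cdiffB; [exact: cdiff_id|exact: cdiff_cst].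
  exact: cdiffV.
have [dl d0 hd] := cdiff_continuous dk e0.
exists (Num.min dl (normc (z - z0))) => [|z']; first by rewrite lt_min d0.
rewrite lt_min => /andP[/hd h k]; rewrite /dquot (negbTE ne).
case: eqP => // e'; by rewrite e' normcB ltxx in k.
Qed.

Lemma ccts_dquot z0 r t : normc z0 < 1 -> 0 < r < 1 -> ccts (on_circle (dquot z0) r) t.
Proof.
move=> z01 /andP[r0 r1] e e0.
have [|dl d0 hd] := @dquot_continuous z0 (r%:C * circ t) z01 _ e e0.
  by rewrite normc_rcircle // ltW.
have [d1 d10 h1] := ccts_circle t (divr_gt0 d0 r0).
exists d1 => // t' /h1 lt; apply: hd.
rewrite -mulrBr ComplexField.Normc.normcM normcR ger0_norm ?(ltW r0) //.
by rewrite mulrC -ltr_pdivlMr.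
Qed.

(* Chernoff's argument: the Fourier coefficients of f - f z0 = (z - z0) q on the
   circle |z| = |z0| are differences of those of q, so the partial sums telescope. *)
Theorem holomorphic_power_series (z : CC R) : normc z < 1 ->
  normc (\sum_(n < N) tcoef n * z ^+ n - f z) @[N --> \oo] --> (0 : R).
Proof.
move=> z1; have [->|z0] := eqVneq z 0.
  apply: cvg_near_cst; exists 1%N => // -[//|N] _ /=.
  rewrite big_ord_recl expr0 mulr1 big1 ?addr0 ?tcoef0 ?subrr ?ComplexField.Normc.normc0 // => n _.
  by rewrite exprS mul0r mulr0.
set r := normc z in z1 *.
have r0 : 0 < r by rewrite normc_gt0.
have r01 : 0 < r < 1 by rewrite r0.
pose h := on_circle (dquot z) r.
have ch t : ccts h t by exact: ccts_dquot.
have Lh : L2c h by exact: L2_ccts.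
have Lch : L2c (fun t => circ t * h t).
  by apply: L2_ccts => t; apply: cctsM => //; exact: ccts_circle.
have Lfr : L2c (on_circle f r) by apply: L2_ccts => t; exact: cfr.
have rel t : on_circle f r t = (f z * 1 + (r%:C * (circ t * h t) - z * h t)).
  by rewrite mulr1 mulrA -mulrBl /h /on_circle -dquotE addrC subrK.
have LL (v : R -> CC R) : L2c v -> innerc (on_circle f r) v =
    f z * innerc (fun=> 1) v + (r%:C * innerc (fun t => circ t * h t) v - z * innerc h v).
  move=> Lv; have mA := @mangles R; have mD := @mdtheta R; have w0 := @dtheta_ge0 R.
  have l1 := L2Z mA mD w0 r%:C Lch; have l2 := L2Z mA mD w0 z Lh.
  rewrite -(innerZl mA mD w0 (f z) (L2c_one (R := R)) Lv) -(innerZl mA mD w0 _ Lch Lv) -(innerZl mA mD w0 _ Lh Lv).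
  rewrite -(innerBl mA mD w0 l1 l2 Lv) -(innerDl mA mD w0 _ _ Lv).
  - by apply: eq_inner => // t _; rewrite rel.
  - exact: (L2Z mA mD w0 (f z) (L2c_one (R := R))).
  - exact: (L2B mA mD w0 l1 l2).
pose H n := innerc h (fun t => circ t ^+ n).
pose H' n := innerc h (fun t => (circ t ^+ n)^*).
have one_inner n : innerc (fun=> 1) (fun t => circ t ^+ n) = (if n == 0%N then 1 else 0)%:C.
  rewrite eq_sym -(inner_circle 0 n); apply: eq_inner => // t _; by rewrite expr0.
have one_innerJ n : innerc (fun=> 1) (fun t => (circ t ^+ n.+1)^*) = 0.
  rewrite (_ : 0 = (if n.+1 == 0%N then 1 else 0)%:C) // -(inner_circle n.+1 0) !innerE.
  by apply: eq_cint => t _; rewrite /wprod conjCK expr0 rmorph1; ring.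
have circ_inner n : innerc (fun t => circ t * h t) (fun t => circ t ^+ n.+1) = H n.
  rewrite /H !innerE; apply: eq_cint => t _; rewrite /wprod exprS rmorphM /= circleJ.
  have c0 := circle_neq0 t; congr (_ * _).
  by rewrite [circ t * h t]mulrC -mulrA (mulrA (circ t)) mulfV // mul1r.
have circ_innerJ n : innerc (fun t => circ t * h t) (fun t => (circ t ^+ n)^*) = H' n.+1.
  rewrite /H' !innerE; apply: eq_cint => t _; rewrite /wprod !conjCK exprS; ring.
(* The coefficients of negative index of [f] vanish, so those of [h] obey a recursion whose factor
   has modulus 1, as [r = |z|]. Their modulus is thus constant; it also tends to 0, so they are all
   0. *)
have H'S n : r%:C * H' n.+2 = z * H' n.+1.
  have := LL _ (L2c_J (L2_circleX n.+1)); rewrite inner_on_circleJ // one_innerJ.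
  rewrite circ_innerJ mulr0 add0r => /esym/eqP; rewrite subr_eq0 => /eqP -> //.
have H'n n : sqn (H' n.+1) = sqn (H' 1%N).
  elim: n => // n <-; have := congr1 (@sqn R) (H'S n); rewrite !sqnM sqnR.
  rewrite -(sqr_normc_sqn z) -/r; apply: mulfI; by rewrite expf_neq0 // gt_eqF.
have H'1 : H' 1%N = 0.
  apply: ComplexField.Normc.eq0_normc; rewrite normc_sqrt.
  suff -> : sqn (H' 1%N) = 0 by rewrite sqrtr0.
  have := inner_circleJ_cvg0 Lh => /(cvg_lim (@Rhausdorff R)) <-.
  apply/esym/(cvg_lim (@Rhausdorff R)); apply: cvg_near_cst.
  by exists 1%N => // -[//|n] _; exact: H'n.
pose u := z / r%:C.
have rC0 : r%:C != 0 :> CC R by rewrite fmorph_eq0 gt_eqF.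
have zE : z = r%:C * u by rewrite mulrC mulfVK.
have nu : normc u = 1.
  by rewrite /u ComplexField.Normc.normcM ComplexField.Normc.normcV normcR gtr0_norm // divff // gt_eqF.
(* With [u] the phase of [z], the remainder is one Fourier coefficient of [h] times a factor of
   modulus [r], and it tends to 0 by Bessel's inequality. *)
have tele N : \sum_(n < N.+1) tcoef n * z ^+ n - f z = - (r%:C * u ^+ N.+1 * H N).
  elim: N => [|N IH].
    rewrite big_ord1 expr0 mulr1.
    have := LL _ (L2_circleX 0); rewrite inner_on_circle // expr0 mulr1 one_inner /= mulr1 => ->.
    rewrite (_ : innerc (fun t => circ t * h t) _ = H' 1%N).
      by rewrite H'1 mulr0 sub0r addrC addKr expr1 -zE.
    rewrite -circ_innerJ; apply: eq_inner => // t _; by rewrite !expr0 rmorph1.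
  rewrite big_ord_recr /= addrAC IH.
  have := LL _ (L2_circleX N.+1); rewrite inner_on_circle // one_inner circ_inner /= mulr0 add0r => e.
  have zX : z ^+ N.+1 = (r ^+ N.+1)%:C * u ^+ N.+1.
    by rewrite [in LHS]zE exprMn rmorphXn.
  have zH : z * H N.+1 = r%:C * u * H N.+1 by rewrite [in LHS]zE.
  by rewrite zX mulrA e -/(H N.+1) zH [u ^+ N.+2]exprS; ring.
have := inner_circle_cvg0 Lh => h0.
apply/cvgrPdist_le => e e0.
have e2 : 0 < e ^+ 2 by rewrite exprn_gt0.
move/cvgrPdist_le : h0 => /(_ _ e2)[N0 _ hN]; exists N0.+1 => // -[//|N] /= lt.
rewrite tele sub0r normrN ger0_norm ?normc_ge0 // normcN !ComplexField.Normc.normcM normcX nu expr1n mulr1.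
rewrite normcR ger0_norm ?(ltW r0) //.
have := hN N lt; rewrite /= sub0r normrN ger0_norm ?sqn_ge0 // -/(H N) -sqr_normc_sqn.
rewrite ler_pXn2r ?nnegrE ?normc_ge0 ?(ltW e0) // => le.
by apply: le_trans le; rewrite ler_piMl ?normc_ge0 // ltW.
Qed.

End PowerSeries.

(** * Polar integration on the disc *)

Section Rotation.
Context {R : realType}.
Local Notation leb := (@lebesgue_measure R).
Local Notation mR := (measurableTypeR R).
Local Notation mu2 := (@plane_mu R).
Implicit Types (a b c s : R) (X : set (mR * mR)).

Lemma measurable_shift c : measurable_fun [set: mR] (fun y : mR => y + c : mR).
Proof. by apply: measurable_funD; [exact: measurable_id|exact: measurable_cst]. Qed.

Lemma lebesgue_shift c (A : set mR) : measurable A -> leb ((fun y => y + c) @^-1` A) = leb A.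
Proof.
move=> mA; rewrite -[LHS]/(pushforward leb (fun y : mR => y + c : mR) A).
apply/esym; apply: lebesgue_measure_unique mA; first exact: measurable_shift.
move=> m X /= [[x y] _ <-] /=; rewrite /pushforward.
rewrite (_ : (fun _ => _) @^-1` _ = `]x - c, y - c]%classic); last first.
  by apply/seteqP; split => z /=; rewrite !in_itv /= ltrBlDr lerBrDr.
by rewrite !lebesgue_measure_itv /= !lte_fin ltrD2r; case: ifP => // _; rewrite -!EFinB; congr (_%:E); ring.
Qed.

Definition shear_y a (p : mR * mR) : mR * mR := (p.1, p.2 + a * p.1).
Definition shear_x a (p : mR * mR) : mR * mR := (p.1 + a * p.2, p.2).

Lemma measurable_lin a (f g : mR * mR -> mR) : measurable_fun setT f -> measurable_fun setT g ->
  measurable_fun setT (fun p => f p + a * g p : mR).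
Proof. by move=> mf mg; apply: measurable_funD => //; apply: measurable_funM => //; exact: measurable_cst. Qed.

Lemma measurable_shear_y a : measurable_fun setT (shear_y a).
Proof.
by apply: measurable_fun_pair; [exact: measurable_fst|apply: measurable_lin; [exact: measurable_snd|exact: measurable_fst]].
Qed.

Lemma measurable_shear_x a : measurable_fun setT (shear_x a).
Proof.
by apply: measurable_fun_pair; [apply: measurable_lin; [exact: measurable_fst|exact: measurable_snd]|exact: measurable_snd].
Qed.

Lemma shear_y_preserving a X : measurable X -> mu2 (shear_y a @^-1` X) = mu2 X.
Proof.
move=> mX; apply: eq_integral => x _ /=.
rewrite -(lebesgue_shift (a * x) (measurable_xsection x mX)); congr (leb _).
Qed.

(** Horizontal shears translate horizontal sections, which calls for the iterated integral in the
    other order. *)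
Lemma mu2E2 X : measurable X -> mu2 X = (leb \x^ leb)%E X.
Proof.
by move=> mX; apply: product_measure_unique mX => A B mA mB; exact: product_measure2E.
Qed.

Lemma shear_x_preserving a X : measurable X -> mu2 (shear_x a @^-1` X) = mu2 X.
Proof.
move=> mX; have mY : measurable (shear_x a @^-1` X).
  by rewrite -[X in measurable X]setTI; exact: measurable_shear_x.
rewrite !mu2E2 //; apply: eq_integral => y _ /=.
rewrite -(lebesgue_shift (a * y) (measurable_ysection y mX)); congr (leb _).
Qed.

Definition rot c s (p : mR * mR) : mR * mR := (c * p.1 - s * p.2, s * p.1 + c * p.2).

(* A rotation is a product of shears, which preserve the plane measure by Fubini. *)
Lemma rot_shears c s : s != 0 -> c ^+ 2 + s ^+ 2 = 1 ->
  rot c s = shear_x ((c - 1) / s) \o shear_y s \o shear_x ((c - 1) / s).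
Proof.
move=> s0 cs; apply/funext => -[x y]; rewrite /rot /shear_x /shear_y /=.
(* For the rotation by [theta], the coefficient [(c - 1) / s] is [- tan (theta / 2)]. *)
have e : s * ((c - 1) / s) = c - 1 by rewrite mulrC mulfVK.
have e2 : (c - 1) / s * (c + 1) = - s.
  apply: (mulfI s0); rewrite mulrA e mulrN -expr2 -[s ^+ 2](addKr (c ^+ 2)) cs; ring.
have -> : s * (x + (c - 1) / s * y) = s * x + (c - 1) * y by rewrite mulrDr mulrA e.
congr (_, _); last by ring.
have -> : x + (c - 1) / s * y + (c - 1) / s * (y + (s * x + (c - 1) * y)) =
  x + s * ((c - 1) / s) * x + (c - 1) / s * (c + 1) * y by ring.
by rewrite e e2; ring.
Qed.

Lemma measurable_rot c s : measurable_fun setT (rot c s).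
Proof.
apply: measurable_fun_pair; first apply: measurable_funB; last apply: measurable_funD.
all: by apply: measurable_funM; [exact: measurable_cst|]; do ?[exact: measurable_fst|exact: measurable_snd].
Qed.

Lemma rot_preserving c s X : s != 0 -> c ^+ 2 + s ^+ 2 = 1 -> measurable X ->
  mu2 (rot c s @^-1` X) = mu2 X.
Proof.
move=> s0 cs mX; rewrite rot_shears // !comp_preimage.
have m1 : measurable (shear_x ((c - 1) / s) @^-1` X).
  by rewrite -[X in measurable X]setTI; exact: measurable_shear_x.
have m2 : measurable (shear_y s @^-1` (shear_x ((c - 1) / s) @^-1` X)).
  by rewrite -[X in measurable X]setTI; exact: measurable_shear_y.
by rewrite shear_x_preserving // shear_y_preserving // shear_x_preserving.
Qed.

Lemma integral_rot c s (S : set (mR * mR)) (f : mR * mR -> \bar R) :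
  s != 0 -> c ^+ 2 + s ^+ 2 = 1 -> measurable S -> rot c s @^-1` S = S ->
  measurable_fun setT f -> mu2.-integrable S (f \o rot c s) ->
  (\int[mu2]_(p in S) f p = \int[mu2]_(p in S) f (rot c s p))%E.
Proof.
move=> s0 cs mS SE mf ir.
have mrot := measurable_rot c s.
have := @integral_pushforward _ _ _ _ R _ mrot mu2 S f mf; rewrite SE => /(_ ir mS) <-.
apply: eq_measure_integral => A mA _; exact/esym/rot_preserving.
Qed.

End Rotation.

(** * Areas of discs and the distribution of the squared radius *)

Section DiscArea.
Context {R : realType}.
Local Notation leb := (@lebesgue_measure R).
Local Notation mR := (measurableTypeR R).
Local Notation mu2 := (@plane_mu R).
Implicit Types (r s x y : R).

Definition sqnorm (p : mR * mR) : mR := p.1 ^+ 2 + p.2 ^+ 2.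

Lemma measurable_sqnorm : measurable_fun setT sqnorm.
Proof. by apply: measurable_funD; apply: measurable_funX; [exact: measurable_fst|exact: measurable_snd]. Qed.

Lemma lebesgue_sqr_le c : leb [set y : mR | y ^+ 2 <= c] = (2 * Num.sqrt c)%:E.
Proof.
have [c0|c0] := leP 0 c; last first.
  rewrite ltr0_sqrtr // mulr0 (_ : [set _ | _] = set0) ?measure0 //.
  apply/seteqP; split => y //=; apply/negP; rewrite -ltNge.
  by rewrite (lt_le_trans c0) // sqr_ge0.
rewrite (_ : [set _ | _] = `[- Num.sqrt c, Num.sqrt c]%classic); last first.
  apply/seteqP; split => y /=; rewrite in_itv /= -ler_norml => h.
    by rewrite -sqrtr_sqr ler_wsqrtr.
  by rewrite -(sqr_sqrtr c0) -real_normK ?num_real // ler_pXn2r // ?nnegrE ?sqrtr_ge0.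
have q0 := sqrtr_ge0 c.
rewrite lebesgue_measure_itv /= lte_fin; case: ifPn => [_|].
  by rewrite -EFinB; congr (_%:E); ring.
rewrite -leNgt => h; have -> : Num.sqrt c = 0 by apply/eqP; rewrite eq_le q0 andbT; lra.
by rewrite mulr0.
Qed.

(** Substitute [x = r sin t] with [t] between [- pi / 2] and [pi / 2], where the cosine is
    nonnegative and the square root simplifies. *)
Lemma integral_half_circle r : 0 < r ->
  (\int[leb]_(x in `[(- r)%R, r]) (2 * Num.sqrt (r ^+ 2 - x ^+ 2))%R%:E = (pi * r ^+ 2)%R%:E)%E.
Proof.
move=> r0; pose F t : R := r * sin t; pose G x : R := 2 * Num.sqrt (r ^+ 2 - x ^+ 2).
pose h : R := pi / 2.
have p0 : (0 : R) < pi := pi_gt0 R.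
have h0 : 0 < h by rewrite divr_gt0.
have sh : sin h = 1 by exact: sin_pihalf.
have Fa : F (- h) = - r by rewrite /F sinN sh mulrN1.
have Fb : F h = r by rewrite /F sh mulr1.
have dF (t : R) : is_derive t 1 F (r * cos t).
  by apply: is_derive_eq; rewrite /GRing.scale /= ?scaler0 ?addr0.
have F'E : derive1 F = fun t => r * cos t.
  by apply/funext => t; rewrite derive1E; have [_] := dF t.
have cF (t : R) : {for t, continuous F}.
  by apply/differentiable_continuous/derivable1_diffP; have [] := dF t.
have cF' (t : R) : {for t, continuous (derive1 F)}.
  by rewrite F'E; apply: cvgMl_tmp; exact: continuous_cos.
transitivity (\int[leb]_(x in `[F (- h)%R, F h]) (G x)%:E)%E; first by rewrite Fa Fb.
rewrite (@integration_by_substitution_increasing R F G (- h) h).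
- have E t : t \in `[- h, h]%classic -> ((G \o F) * (derive1 F)) t = 2 * r ^+ 2 * cos t ^+ 2.
    rewrite inE /= in_itv /= => th; have c0 : 0 <= cos t by exact: cos_ge0_pihalf.
    rewrite -[LHS]/(G (F t) * derive1 F t) F'E /G /F exprMn sin2cos2.
    have -> : r ^+ 2 - r ^+ 2 * (1 - cos t ^+ 2) = (r * cos t) ^+ 2 by ring.
    by rewrite sqrtr_sqr ger0_norm ?mulr_ge0 ?(ltW r0) //; ring.
  under eq_integral => t th do rewrite E //.
  pose H t : R := r ^+ 2 * (t + sin t * cos t).
  have dH (t : R) : is_derive t 1 H (2 * r ^+ 2 * cos t ^+ 2).
    apply: is_derive_eq; rewrite /GRing.scale /= ?scaler0 ?addr0.
    by have := cos2Dsin2 t; move: (cos t) (sin t) => C S e; rewrite -[X in X + _]e; ring.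
  have cH (t : R) : {for t, continuous H}.
    by apply/differentiable_continuous/derivable1_diffP; have [] := dH t.
  rewrite (@continuous_FTC2 _ _ H) //.
  + by rewrite /H sinN cosN cos_pihalf !mulr0 !addr0 -EFinB; congr (_%:E); rewrite /h; field.
  + lra.
  + apply: continuous_subspaceT => t; apply: cvgMl_tmp; rewrite expr2.
    by under eq_fun do rewrite expr2; apply: cvgM; exact: continuous_cos.
  + split; first by move=> t _; have [] := dH t.
    * by apply: cvg_at_right_filter; exact: cH.
    * by apply: cvg_at_left_filter; exact: cH.
  + by move=> t _; rewrite derive1E; have [_] := dH t.
- lra.
- move=> x y xh yh xy; rewrite /F ltr_pM2l //; rewrite ltr_sin //.
- by move=> t _; exact: cF'.
- by apply/cvg_ex; exists (derive1 F (- h)); apply: cvg_at_right_filter; exact: cF'.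
- by apply/cvg_ex; exists (derive1 F h); apply: cvg_at_left_filter; exact: cF'.
- split; first by move=> t _; have [] := dF t.
  + by apply: cvg_at_right_filter; exact: cF.
  + by apply: cvg_at_left_filter; exact: cF.
- apply: continuous_subspaceT => x; apply: cvgMl_tmp.
  apply: (@continuous_comp _ _ _ (fun x : R => r ^+ 2 - x ^+ 2)); last exact: sqrt_continuous.
  by apply: cvgB; [exact: cvg_cst|rewrite expr2; under eq_fun do rewrite expr2; apply: cvgM; exact: cvg_id].
Qed.

Lemma disc_area s : 0 <= s -> mu2 [set p | sqnorm p <= s] = (pi * s)%:E.
Proof.
move=> s0; rewrite /plane_mu /product_measure1.
have -> : (\int[leb]_x (leb \o xsection [set p | sqnorm p <= s]%R) x =
  \int[leb]_x (2 * Num.sqrt (s - x ^+ 2))%R%:E)%E.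
  apply: eq_integral => x _ /=; rewrite -lebesgue_sqr_le; congr (leb _).
  apply/seteqP; split => y; rewrite /xsection /= inE /sqnorm /=; lra.
move: s0; rewrite le_eqVlt => /predU1P[<-|s0].
  rewrite mulr0 integral0_eq // => x _; rewrite sub0r ler0_sqrtr ?mulr0 //.
  by rewrite oppr_le0 sqr_ge0.
pose r := Num.sqrt s; have r0 : 0 < r by rewrite sqrtr_gt0.
have sE : s = r ^+ 2 by rewrite sqr_sqrtr // ltW.
(* The square root of a negative number is 0, so the integral over the whole line reduces to the one
   over [[-r, r]]. *)
rewrite sE -integral_half_circle // [RHS]integral_mkcond; apply: eq_integral => x _.
rewrite patchE; case: ifPn => // /negP; rewrite inE /= in_itv /= -ler_norml => /negP.
rewrite -ltNge => h; rewrite ler0_sqrtr ?mulr0 //.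
rewrite subr_le0 -[leRHS]real_normK ?num_real // ler_pXn2r ?nnegrE ?(ltW r0) //.
exact: ltW.
Qed.

Lemma measurable_disc_le s : measurable [set p | sqnorm p <= s].
Proof.
have := measurable_sqnorm measurableT (measurable_itv `]-oo, s]).
by rewrite setTI; congr measurable; apply/seteqP; split => p /=; rewrite in_itv.
Qed.

Lemma measure_disc_le s : mu2 [set p | sqnorm p <= s] = (pi * Num.max s 0)%:E.
Proof.
have [s0|s0] := leP 0 s; first by rewrite disc_area.
rewrite mulr0 (_ : [set _ | _] = set0) ?[mu2 _]measure0 //.
apply/seteqP; split => p //=; apply/negP; rewrite -ltNge.
by rewrite (lt_le_trans s0) // addr_ge0 // sqr_ge0.
Qed.

Lemma lebesgue_neg_part a b : a < b ->
  leb (`]a, b] `&` `]-oo, 0[) = ((b - Num.max b 0) - (a - Num.max a 0))%:E.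
Proof.
move=> ab; have [b0|b0] := ltP b 0.
  have a0 : a < 0 by exact: lt_trans ab b0.
  rewrite (max_r (ltW a0)) setIidl; last first.
    by move=> x /=; rewrite !in_itv /= => /andP[_ /le_lt_trans]; exact.
  by rewrite lebesgue_measure_itv /= lte_fin ab -EFinB; congr (_%:E); ring.
have [a0|a0] := ltP a 0.
  rewrite (_ : _ `&` _ = `]a, 0[%classic); last first.
    apply/seteqP; split => x /=; rewrite !in_itv /=; first by case=> /andP[-> _] ->.
    by move=> /andP[-> x0]; split => //; rewrite (le_trans (ltW x0)).
  by rewrite lebesgue_measure_itv /= lte_fin a0 -EFinB; congr (_%:E); ring.
rewrite (_ : _ `&` _ = set0) ?measure0 ?subrr //.
apply/seteqP; split => x //=; rewrite !in_itv /= => -[/andP[ax _] x0].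
by have := lt_trans (le_lt_trans a0 ax) x0; rewrite ltxx.
Qed.

(** The disc [x^2 + y^2 <= s] has area [pi * s], so the squared radius has constant density [pi] on
    the half line. This takes the place of polar coordinates for radial functions. *)
Lemma sqnorm_distribution (A : set mR) : measurable A -> A `<=` [set x : mR | 0 <= x] ->
  mu2 (sqnorm @^-1` A) = (pi%:E * leb A)%E.
Proof.
move=> mA A0.
have p0 : (0 : R) < pi := pi_gt0 R.
have pge : (0 : R) <= pi^-1 by rewrite invr_ge0 ltW.
have mN : measurable (`]-oo, 0[%classic : set mR) by exact: measurable_itv.
pose m0 : {measure set mR -> \bar R} :=
  measure_function_pushforward__canonical__measure_function_Measure mu2 measurable_sqnorm.
pose m1 : {measure set mR -> \bar R} :=
  measure_function_mscale__canonical__measure_function_Measure (NngNum pge) m0.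
(* Lebesgue measure is characterized on the whole line, so its mass on the negative axis is added
   back; [A] does not meet that part. *)
pose m2 : {measure set mR -> \bar R} := mrestr leb mN.
have key : leb A = measure_add m1 m2 A.
  apply: lebesgue_measure_unique mA => _ [[a b] _ <-].
  rewrite -[RHS]/(measure_add m1 m2 `]a, b]) measure_addE [(a, b).1]/= [(a, b).2]/=; have [ba|ab] := leP b a.
    by rewrite set_itv_ge ?measure0 ?adde0 // -leNgt bnd_simp.
  have -> : m1 `]a, b]%classic = (Num.max b 0 - Num.max a 0)%:E.
    rewrite /m1 /= /mscale /=.
    have -> : m0 `]a, b]%classic = (pi * Num.max b 0 - pi * Num.max a 0)%:E.
      pose B s : set (mR * mR) := [set p | sqnorm p <= s].
      have -> : m0 `]a, b]%classic = mu2 (B b `\` B a).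
        rewrite -[LHS]/(mu2 (sqnorm @^-1` `]a, b]%classic)); congr (mu2 _).
        apply/seteqP; split => p /=; rewrite in_itv /=.
          by move=> /andP[ap pb]; split => //; apply/negP; rewrite -ltNge.
        by move=> [pb /negP]; rewrite -ltNge pb => ->.
      have -> : mu2 (B b `\` B a) = (mu2 (B b) - mu2 (B b `&` B a))%E.
        by apply: measureD; [exact: measurable_disc_le..|rewrite [ltLHS]measure_disc_le ltry].
      rewrite /B.
      rewrite (_ : _ `&` _ = [set p | sqnorm p <= a]) ?measure_disc_le ?EFinB //.
      apply/seteqP; split => p /=; first by case.
      by move=> pa; split => //; exact: le_trans pa (ltW ab).
    rewrite -EFinM; congr (_%:E); rewrite -mulrBr mulrA mulVf ?mul1r //.
    by rewrite gt_eqF.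
  have -> : m2 `]a, b]%classic = ((b - Num.max b 0) - (a - Num.max a 0))%:E.
    exact: lebesgue_neg_part.
  by rewrite lebesgue_measure_itv /= lte_fin ab -!EFinD; congr (_%:E); ring.
rewrite key measure_addE.
have -> : m2 A = 0%E.
  rewrite /m2 /= /mrestr (_ : A `&` _ = set0) ?measure0 //.
  apply/seteqP; split => x //= -[/A0 /= x0]; rewrite in_itv /= => x1.
  by have := le_lt_trans x0 x1; rewrite ltxx.
rewrite adde0 /m1 /= /mscale /= muleA -EFinM divff ?mul1e //.
by rewrite gt_eqF.
Qed.

End DiscArea.

(* The squared norm of z^n in A^2_alpha. *)
Fixpoint bgam {R : realType} (alpha : R) (n : nat) : R :=
  if n is m.+1 then m.+1%:R / (m%:R + alpha + 2) * bgam alpha m else 1.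

(** * Beta integrals and the norms of monomials *)

Section BergmanMoments.
Context {R : realType}.
Local Notation leb := (@lebesgue_measure R).
Local Notation mR := (measurableTypeR R).
Local Notation mu2 := (@plane_mu R).
Variable alpha : R.

Lemma bgam_gt0 n : -1 <= alpha -> 0 < bgam alpha n.
Proof.
move=> a1; elim: n => //= n IH; rewrite mulr_gt0 // divr_gt0 //.
by move: (ler0n R n); move: n%:R => x; lra.
Qed.

Lemma bgam_rec n : -1 <= alpha ->
  bgam alpha n.+1 * (n%:R + alpha + 2) = n.+1%:R * bgam alpha n.
Proof.
move=> a1 /=; rewrite mulrAC mulfVK // gt_eqF //.
by move: (ler0n R n); move: n%:R => x; lra.
Qed.

Hypothesis halpha : -1 < alpha.

Let b0 : 0 < 1 + alpha. Proof. by have := halpha; lra. Qed.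

Let is_derive_pow (t : R) : t < 1 ->
  is_derive t 1 (fun t : R => (1 - t) `^ (1 + alpha)) (- ((1 + alpha) * (1 - t) `^ alpha)).
Proof.
move=> t1; have p : 0 < 1 - t by rewrite subr_gt0.
have d1 := is_derive1_powR (1 + alpha) p.
have d2 : is_derive t 1 (fun t : R => 1 - t) (-1).
  by apply: is_derive_eq; ring.
have := @is_derive1_comp R (fun y => y `^ (1 + alpha)) (fun t => 1 - t) t _ _ d1 d2; rewrite mulrN1.
by rewrite (_ : 1 + alpha - 1 = alpha) //; ring.
Qed.

Let cont_pow (t : R) : t < 1 -> {for t, continuous (fun t : R => (1 - t) `^ alpha)}.
Proof.
move=> t1; have p : 0 < 1 - t by rewrite subr_gt0.
have d1 := is_derive1_powR alpha p.
have d2 : is_derive t 1 (fun t : R => 1 - t) (-1).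
  by apply: is_derive_eq; ring.
have [dd _] := @is_derive1_comp R (fun y => y `^ alpha) (fun t => 1 - t) t _ _ d1 d2.
by apply/differentiable_continuous/derivable1_diffP.
Qed.

Definition bker n (t : R) : R := t ^+ n * (1 - t) `^ alpha.

Lemma bker_ge0 n t : 0 <= t -> 0 <= bker n t.
Proof. by move=> t0; rewrite mulr_ge0 ?exprn_ge0 ?powR_ge0. Qed.

Lemma measurable_bker n : measurable_fun [set: mR] (bker n : mR -> mR).
Proof.
apply: measurable_funM; first exact: measurable_funX.
apply: (measurableT_comp (@measurable_powR R alpha)).
by apply: measurable_funB; [exact: measurable_cst|exact: measurable_id].
Qed.

Lemma cont_X n (t : R) : {for t, continuous (fun t : R => t ^+ n)}.
Proof. exact: exprn_continuous. Qed.

Lemma bker_cont n (t : R) : t < 1 -> {for t, continuous (bker n)}.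
Proof. by move=> t1; apply: cvgM; [exact: cont_X|exact: cont_pow]. Qed.

Lemma bker_within n (x : R) : x < 1 -> {within `[0, x], continuous (bker n)}.
Proof.
move=> x1; apply: continuous_in_subspaceT => t; rewrite inE /= in_itv /= => /andP[_ tx].
by apply: bker_cont; exact: le_lt_trans tx x1.
Qed.

Lemma bker_integrable n (x : R) : x < 1 -> leb.-integrable `[0, x] (EFin \o bker n).
Proof.
by move=> x1; apply: continuous_compact_integrable; [exact: segment_compact|exact: bker_within].
Qed.

Lemma bint0 (x : R) : 0 < x < 1 ->
  \int[leb]_(t in `[0, x]) bker 0 t = (1 - (1 - x) `^ (1 + alpha)) / (1 + alpha).
Proof.
move=> /andP[x0 x1]; pose F (t : R) : R := - (1 + alpha)^-1 * (1 - t) `^ (1 + alpha).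
have dF (t : R) : t < 1 -> is_derive t 1 F (bker 0 t).
  move=> t1; have d := is_derive_pow t1.
  have dz := is_deriveZ (- (1 + alpha)^-1) d; apply: (is_derive_eq dz).
  by rewrite /bker /GRing.scale /= expr0; field; rewrite gt_eqF.
have cF (t : R) : t < 1 -> {for t, continuous F}.
  by move=> t1; apply/differentiable_continuous/derivable1_diffP; have [] := dF t t1.
rewrite /Rintegral (@continuous_FTC2 _ _ F) //.
- by rewrite /= /F subr0 powR1; field; rewrite gt_eqF.
- exact: bker_within.
- split.
  + move=> t; rewrite in_itv /= => /andP[_ tx]; have [|//] := dF t.
    exact: lt_trans tx x1.
  + by apply: cvg_at_right_filter; apply: cF; lra.
  + by apply: cvg_at_left_filter; apply: cF.
- move=> t; rewrite in_itv /= => /andP[_ tx]; rewrite derive1E; have [|_] := dF t => //.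
  exact: lt_trans tx x1.
Qed.

(** The recursion of the beta function, from the derivative of [t^(n+1) * (1 - t)^(1 + alpha)]. The
    integral stops at [x < 1], since the kernel is unbounded near 1 when [alpha < 0]; this leaves a
    boundary term that vanishes in the limit. *)
Lemma bint_rec n (x : R) : 0 < x < 1 ->
  \int[leb]_(t in `[0, x]) bker n.+1 t = (n%:R + alpha + 2)^-1 *
   (n.+1%:R * (\int[leb]_(t in `[0, x]) bker n t) - x ^+ n.+1 * (1 - x) `^ (1 + alpha)).
Proof.
move=> /andP[x0 x1]; pose F (t : R) : R := t ^+ n.+1 * (1 - t) `^ (1 + alpha).
pose f t : R := n.+1%:R * bker n t + (- (n%:R + alpha + 2)) * bker n.+1 t.
have dF (t : R) : t < 1 -> is_derive t 1 F (f t).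
  move=> t1; have d := is_derive_pow t1.
  have dX : is_derive t 1 (fun t : R => t ^+ n.+1) (n.+1%:R * t ^+ n).
    by apply: DeriveDef; [exact: exprn_derivable|rewrite exp_derive /GRing.scale /= mulr1].
  have dm := is_deriveM dX d; apply: (is_derive_eq dm).
  rewrite /f /bker /GRing.scale /= (powRD _) ?powRr1 ?exprS; last first.
  - by apply/implyP => _; rewrite subr_eq0 gt_eqF.
  - by rewrite subr_ge0 ltW.
  rewrite -[n.+1%:R]natr1; ring.
have cF (t : R) : t < 1 -> {for t, continuous F}.
  by move=> t1; apply/differentiable_continuous/derivable1_diffP; have [] := dF t t1.
have fI : \int[leb]_(t in `[0, x]) f t = F x.
  rewrite /Rintegral (@continuous_FTC2 _ _ F) //.
  - by rewrite /= /F expr0n /= mul0r subr0.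
  - apply: continuous_in_subspaceT => t; rewrite inE /= in_itv /= => /andP[_ tx].
    have t1 := le_lt_trans tx x1.
    by apply: cvgD; apply: cvgMl_tmp; exact: bker_cont.
  - split.
    + move=> t; rewrite in_itv /= => /andP[_ tx]; have [|//] := dF t.
      exact: lt_trans tx x1.
    + by apply: cvg_at_right_filter; apply: cF; lra.
    + by apply: cvg_at_left_filter; apply: cF.
  - move=> t; rewrite in_itv /= => /andP[_ tx]; rewrite derive1E; have [|_] := dF t => //.
    exact: lt_trans tx x1.
have n2 : n%:R + alpha + 2 != 0 :> R.
  by rewrite gt_eqF //; move: (ler0n R n) halpha; move: n%:R => y; lra.
move: fI; rewrite /f Rintegral_lincomb //; [|exact: bker_integrable..].
rewrite /F => <-; by field.
Qed.

(** The shift by 2 keeps the first point, 1/2, strictly inside the interval. *)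
Let xk (k : nat) : R := 1 - k.+2%:R^-1.

Let xk01 k : 0 < xk k < 1.
Proof.
have i0 : 0 < (k.+2%:R : R)^-1 by rewrite invr_gt0.
have i1 : (k.+2%:R : R)^-1 < 1 by rewrite invf_lt1 // ltr1n.
by rewrite /xk; move: (_^-1) i0 i1 => y i0 i1; apply/andP; split; lra.
Qed.

Let pow_xk : (1 - xk k) `^ (1 + alpha) @[k --> \oo] --> (0 : R).
Proof.
apply/cvgrPdist_le => e e0.
pose d := e `^ (1 + alpha)^-1; have d0 : 0 < d by rewrite powR_gt0.
exists (Num.truncn d^-1) => // k /= hk; rewrite sub0r normrN ger0_norm ?powR_ge0 //.
have -> : e = d `^ (1 + alpha).
  by rewrite /d -powRrM mulVf ?powRr1 ?(ltW e0) // gt_eqF.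
rewrite /xk subKr ge0_ler_powR ?nnegrE ?(ltW b0) ?(ltW d0) ?invr_ge0 //.
rewrite -[d]invrK lef_pV2 ?posrE ?invr_gt0 //.
apply: (@le_trans _ _ (Num.truncn d^-1).+1%:R); first by rewrite ltW // truncnS_gt.
by rewrite ler_nat; lia.
Qed.

Lemma bker_cvg n :
  (\int[leb]_(t in `[0, xk k]) bker n t)%:E @[k --> \oo] -->
  (\int[leb]_(t in `[0%R, 1%R[) (bker n t)%:E)%E.
Proof.
have mono : {homo xk : i j / (i <= j)%N >-> i <= j}.
  by move=> i j ij; rewrite /xk lerB // lef_pV2 ?posrE // ler_nat; lia.
have -> : `[(0 : R), 1[%classic = \bigcup_k `[0, xk k]%classic.
  apply/seteqP; split => t /=.
    rewrite in_itv /= => /andP[t0 t1].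
    exists (Num.truncn (1 - t)^-1) => //=; rewrite in_itv /= t0 /= /xk.
    have p : 0 < 1 - t by rewrite subr_gt0.
    have := truncnS_gt (1 - t)^-1.
    set N := Num.truncn _ => h.
    have : N.+2%:R^-1 <= 1 - t.
      rewrite -[1 - t]invrK lef_pV2 ?posrE ?invr_gt0 //.
      by apply: le_trans (ltW h) _; rewrite ler_nat.
    by move: (N.+2%:R^-1) => y; lra.
  move=> [k _ /=]; rewrite !in_itv /= => /andP[-> tx].
  by have /andP[_ x1] := xk01 k; exact: le_lt_trans tx x1.
have E k : (\int[leb]_(t in `[0, xk k]) bker n t)%:E =
    (\int[leb]_(t in `[0%R, xk k]) (bker n t)%:E)%E.
  have /andP[_ x1] := xk01 k.
  by rewrite /Rintegral fineK //; exact: integrable_fin_num (bker_integrable n x1).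
under eq_fun do rewrite E.
apply: ge0_nondecreasing_set_cvg_integral.
- move=> i j ij; apply/subsetPset => t /=; rewrite !in_itv /= => /andP[-> tx].
  exact: le_trans tx (mono _ _ ij).
- by move=> i; exact: measurable_itv.
- by move=> i; apply/measurable_EFinP; apply: measurable_funTS; exact: measurable_bker.
- by move=> i t /=; rewrite in_itv /= => /andP[t0 _]; rewrite lee_fin bker_ge0.
Qed.

Lemma bker_integral n :
  (\int[leb]_(t in `[0%R, 1%R[) (bker n t)%:E)%E = (bgam alpha n / (1 + alpha))%:E.
Proof.
have bn0 : 1 + alpha != 0 by rewrite gt_eqF.
suff h : \int[leb]_(t in `[0, xk k]) bker n t @[k --> \oo] --> bgam alpha n / (1 + alpha).
  have h1 : (\int[leb]_(t in `[0, xk k]) bker n t)%:E @[k --> \oo] -->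
      (bgam alpha n / (1 + alpha))%:E by apply: cvg_EFin => //; near=> k.
  by rewrite -(cvg_lim (@ereal_hausdorff R) (@bker_cvg n)) (cvg_lim (@ereal_hausdorff R) h1).
elim: n => [|n IH].
  under eq_fun do rewrite bint0 //.
  have -> : bgam alpha 0 / (1 + alpha) = (1 - 0) / (1 + alpha) by rewrite subr0.
  apply: cvgMr_tmp; apply: cvgB => //.
  exact: cvg_cst.
under eq_fun do rewrite bint_rec //.
have n2 : n%:R + alpha + 2 != 0 :> R.
  by rewrite gt_eqF //; move: (ler0n R n) halpha; move: n%:R => y; lra.
have -> : bgam alpha n.+1 / (1 + alpha) = (n%:R + alpha + 2)^-1 *
   (n.+1%:R * (bgam alpha n / (1 + alpha)) - 0).
  by rewrite subr0 /=; field; rewrite bn0.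
apply: cvgMl_tmp; apply: cvgB; first exact: cvgMl_tmp.
apply/cvgrPdist_le => e e0; move/cvgrPdist_le : pow_xk => /(_ _ e0)[N _ hN].
exists N => // k /hN; rewrite !sub0r !normrN => h; apply: le_trans h.
have /andP[x0 x1] := xk01 k.
by rewrite normrM ler_piMl // ger0_norm ?exprn_ge0 ?exprn_ile1 // ?ltW.
Unshelve. all: by end_near. Qed.

End BergmanMoments.

(** * Radial integrals and orthogonality of monomials on the disc *)

Section DiscL2.
Context {R : realType}.
Local Notation leb := (@lebesgue_measure R).
Local Notation mR := (measurableTypeR R).
Local Notation mu2 := (@plane_mu R).
Variable alpha : R.
Hypothesis halpha : -1 < alpha.
Local Notation D := (@disc R : set (mR * mR)).
Local Notation w := (@dA R alpha : mR * mR -> mR).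

Lemma discE : D = @sqnorm R @^-1` `[0, 1[%classic.
Proof.
apply/seteqP; split => p /=; rewrite in_itv /=; last by case/andP.
by move=> h; rewrite /sqnorm addr_ge0 ?sqr_ge0.
Qed.

Lemma measurable_disc : measurable D.
Proof.
rewrite discE -[X in measurable X]setTI; apply: measurable_sqnorm => //.
Qed.

Lemma measurable_dA : measurable_fun setT w.
Proof.
apply: measurable_funM; last exact: measurable_cst.
apply: measurable_funM; first exact: measurable_cst.
apply: (measurableT_comp (@measurable_powR R alpha)).
by apply: measurable_funB; [exact: measurable_cst|exact: measurable_sqnorm].
Qed.

Lemma measurable_dA_disc : measurable_fun D w.
Proof. exact: measurable_funTS measurable_dA. Qed.

Lemma dA_ge0 p : 0 <= w p.
Proof.
rewrite /dA divr_ge0 ?(ltW (pi_gt0 R)) // mulr_ge0 ?powR_ge0 //.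
by have := halpha; lra.
Qed.

Lemma radial_integral (f : R -> R) : measurable_fun [set: mR] (f : mR -> mR) ->
  (forall t, 0 <= t -> 0 <= f t) ->
  (\int[mu2]_(p in D) (f (sqnorm p))%:E = pi%:E * \int[leb]_(t in `[0%R, 1%R[) (f t)%:E)%E.
Proof.
move=> mf f0.
have p0 : (0 : R) <= pi := ltW (pi_gt0 R).
have mI : measurable (`[0%R, 1%R[%classic : set mR) by exact: measurable_itv.
have mF : measurable_fun (`[0%R, 1%R[%classic : set mR) (EFin \o f).
  by apply/measurable_EFinP; exact: measurable_funTS.
have f0' y : (`[0%R, 1%R[%classic : set mR) y -> (0 <= (f y)%:E)%E.
  by rewrite /= in_itv /= => /andP[y0 _]; rewrite lee_fin f0.
have h := ge0_integral_pushforward (@measurable_sqnorm R) mu2 mI mF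
  (fun y (hy : y \in _) => f0' y (set_mem hy)).
rewrite discE -[LHS]h -(ge0_integral_mscale leb mI (NngNum p0) mF f0').
apply: eq_measure_integral; first exact: measurable_sqnorm.
move=> mphi A mA A1.
rewrite -[LHS]/(mu2 (@sqnorm R @^-1` A)) sqnorm_distribution //.
by move=> x /A1; rewrite /= in_itv /= => /andP[].
Qed.

Lemma disc_moment n : (\int[mu2]_(p in D) (w p * sqnorm p ^+ n)%:E = (bgam alpha n)%:E)%E.
Proof.
have b0 : 0 < 1 + alpha by have := halpha; lra.
have p0 : (0 : R) < pi := pi_gt0 R.
pose f t : R := (1 + alpha) / pi * bker alpha n t.
have -> : (\int[mu2]_(p in D) (w p * sqnorm p ^+ n)%:E =
  \int[mu2]_(p in D) (f (sqnorm p))%:E)%E.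
  by apply: eq_integral => p _; congr (_%:E); rewrite /dA /f /bker /sqnorm; ring.
rewrite radial_integral; last 2 first.
- by apply: measurable_funM; [exact: measurable_cst|exact: measurable_bker].
- by move=> t t0; rewrite mulr_ge0 ?bker_ge0 // divr_ge0 // ltW.
rewrite /f; under eq_integral do rewrite EFinM.
rewrite ge0_integralZl //; last 3 first.
- by apply/measurable_EFinP; apply: measurable_funTS; exact: measurable_bker.
- by move=> t; rewrite /= in_itv /= => /andP[t0 _]; rewrite lee_fin bker_ge0.
- by rewrite lee_fin divr_ge0 // ltW.
rewrite bker_integral // -!EFinM; congr (_%:E).
by move: (pi : R) p0 => q q0; field; rewrite !gt_eqF.
Qed.

Lemma sqn_toC (p : R * R) : sqn (toC p) = sqnorm p. Proof. by []. Qed.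

Lemma cmeas_toC (S : set (mR * mR)) : cmeas S (@toC R : mR * mR -> CC R).
Proof.
by split; apply: measurable_funTS; [exact: measurable_fst|exact: measurable_snd].
Qed.

Lemma sqn_toC_le p : D p -> sqn (@toC R p) <= 1.
Proof. by move=> h; rewrite sqn_toC ltW. Qed.

Let mD := measurable_disc.
Let mw := measurable_dA_disc.
Let w0 (p : mR * mR) (_ : D p) : 0 <= w p := dA_ge0 p.

Lemma L2_disc_one : L2 mu2 D w (fun=> 1).
Proof.
apply/(L2P mu2 mw w0); split; first exact: cmeas_cst.
have h p : (EFin \o (fun x => w x * sqn (1 : R[i]))) p = (w p * sqnorm p ^+ 0)%:E.
  by rewrite /= sqn1 expr0.
apply/integrableP; split.
  by apply/measurable_EFinP/measurable_funM => //; exact: measurable_cst.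
rewrite (_ : (\int[mu2]_(x in D) _)%E = (bgam alpha 0)%:E) ?ltry // -disc_moment.
by apply: eq_integral => p _; rewrite h gee0_abs // lee_fin mulr_ge0 ?dA_ge0 // expr0.
Qed.

Lemma L2_disc_power n : L2 mu2 D w (fun p => toC p ^+ n).
Proof. exact: (L2_power mD mw w0 (cmeas_toC _) sqn_toC_le L2_disc_one). Qed.

Lemma toC_rot c s (p : R * R) : toC (rot c s p) = (c +i* s) * toC p.
Proof. by apply: complexP; rewrite /rot /toC !partsE /=; ring. Qed.

Lemma sqnorm_rot c s (p : R * R) : c ^+ 2 + s ^+ 2 = 1 -> sqnorm (rot c s p) = sqnorm p.
Proof. by move=> e; rewrite -!sqn_toC toC_rot sqnM /sqn !partsE e mul1r. Qed.

Lemma circleX (t : R) k : circle t ^+ k = circle (k%:R * t).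
Proof.
elim: k => [|k IH].
  by rewrite expr0 mul0r /circle cos0 sin0; apply: complexP; rewrite !partsE.
rewrite exprS IH -natr1 mulrDl mul1r addrC /circle cosD sinD.
by apply: complexP; rewrite !partsE; ring.
Qed.

(** A suitable rotation multiplies the integrand by ['i], so the integral [I] satisfies
    [I = 'i * I]. The set [S] is any rotation-invariant part of the disc, because smaller concentric
    discs occur later. *)
Lemma inner_disc_orthogonal (S : set (mR * mR)) n m : measurable S -> S `<=` D ->
  (forall c s : R, c ^+ 2 + s ^+ 2 = 1 -> rot c s @^-1` S = S) -> (m < n)%N ->
  L2inner mu2 S w (fun p => toC p ^+ n) (fun p => toC p ^+ m) = 0.
Proof.
move=> mS SD Srot mn; pose k := (n - m)%N; have k0 : (0 < k)%N by rewrite subn_gt0.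
(* A quarter turn divided by [k], so that [circle t ^+ k = 'i]; [0 < t < pi] keeps [sin t] nonzero,
   as the factorization into shears requires. *)
pose t : R := pi / 2 / k%:R.
have p0 : (0 : R) < pi := pi_gt0 R.
have k1 : (1 : R) <= k%:R by rewrite ler1n.
have t0 : 0 < t by rewrite !divr_gt0 // (lt_le_trans ltr01).
have tpi : t < pi.
  rewrite /t ltr_pdivrMr ?(lt_le_trans ltr01) //.
  have : pi <= (pi : R) * k%:R by rewrite ler_peMr // ltW.
  lra.
have s0 : sin t != 0 by rewrite gt_eqF // sin_gt0_pi // t0.
have cs : cos t ^+ 2 + sin t ^+ 2 = 1 := cos2Dsin2 t.
have ck : circle t ^+ k = 'i.
  rewrite circleX /t mulrC divfK ?gt_eqF ?(lt_le_trans ltr01) //.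
  by rewrite /circle cos_pihalf sin_pihalf.
pose g := wprod w (fun p => toC p ^+ n) (fun p => toC p ^+ m).
have grot p : g (rot (cos t) (sin t) p) = 'i * g p.
  rewrite /g /wprod toC_rot -/(circle t).
  have -> : w (rot (cos t) (sin t) p) = w p.
    by rewrite /dA -!/(sqnorm _) sqnorm_rot.
  have un : circle t ^+ n = 'i * circle t ^+ m.
    by rewrite -ck -exprD subnK // ltnW.
  have cc : circle t ^+ m * (circle t ^+ m)^* = 1 by rewrite mulJ_sqn sqnX sqn_circle expr1n.
  rewrite !exprMn un.
  have -> : (circle t ^+ m * toC p ^+ m)^* = (circle t ^+ m)^* * (toC p ^+ m)^* by exact: rmorphM.
  have alg (W I U U' Z Z' : CC R) : U * U' = 1 -> W * (I * U * Z * (U' * Z')) = I * (W * (Z * Z')).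
    by move=> e; transitivity (W * I * (U * U') * Z * Z'); [|rewrite e]; ring.
  exact: alg cc.
have mg : cmeas setT g.
  apply: cmeasM; first by apply: cmeasR; exact: measurable_dA.
  have mX k' : cmeas setT (fun p : mR * mR => toC p ^+ k') by exact/cmeasX/cmeas_toC.
  exact: cmeasM (mX n) (cmeasJ (mX m)).
have ig : cintegrable mu2 S g.
  have [h1 h2] := wprod_cint mD mw w0 (L2_disc_power n) (L2_disc_power m).
  by split; [apply: integrableS h1|apply: integrableS h2].
have igr : cintegrable mu2 S (fun p => 'i * g p) := cintegrableZ mS _ ig.
have e1 : (\int[mu2]_(p in S) Re (g p)) = - (\int[mu2]_(p in S) Im (g p)).
  have hr := @integral_rot R (cos t) (sin t) S (EFin \o (fun p => Re (g p))) s0 cs mS (Srot _ _ cs).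
  rewrite /Rintegral hr; last 2 first.
  - by apply/measurable_EFinP; case: mg.
  - have -> : (EFin \o (fun p => Re (g p))) \o rot (cos t) (sin t) =
        (fun p => (Re ('i * g p))%:E).
      by apply/funext => p; rewrite -grot.
    by case: igr.
  transitivity (\int[mu2]_(p in S) (-1 * Im (g p))).
    congr fine; apply: eq_integral => p _.
    by rewrite -[LHS]/((Re (g (rot (cos t) (sin t) p)))%:E) grot !partsE; congr (_%:E); ring.
  have [_ im] := ig; by rewrite (RintegralZl (-1) mS im) mulN1r.
have e2 : (\int[mu2]_(p in S) Im (g p)) = \int[mu2]_(p in S) Re (g p).
  have hr := @integral_rot R (cos t) (sin t) S (EFin \o (fun p => Im (g p))) s0 cs mS (Srot _ _ cs).
  rewrite /Rintegral hr; last 2 first.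
  - by apply/measurable_EFinP; case: mg.
  - have -> : (EFin \o (fun p => Im (g p))) \o rot (cos t) (sin t) =
        (fun p => (Im ('i * g p))%:E).
      by apply/funext => p; rewrite -grot.
    by case: igr.
  congr fine; apply: eq_integral => p _.
  by rewrite -[LHS]/((Im (g (rot (cos t) (sin t) p)))%:E) grot !partsE; congr (_%:E); ring.
have A0 : \int[mu2]_(p in S) Re (g p) = 0.
  move: e1 e2; move: (\int[mu2]_(p in S) Re (g p)) (\int[mu2]_(p in S) Im (g p)) => A B.
  by move=> *; lra.
rewrite innerE; apply: complexP; [exact: A0|exact: etrans e2 A0].
Qed.

End DiscL2.

(** * Power series in the disc *)

Section PowerSeriesTools.
Context {R : realType}.
Implicit Types (a c : nat -> CC R) (f g : CC R -> CC R) (r : R) (z h : CC R).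

Definition psum a N z : CC R := \sum_(n < N) a n * z ^+ n.

Definition pser a f := forall z, normc z < 1 ->
  normc (psum a N z - f z) @[N --> \oo] --> (0 : R).

(** Cauchy's bounds: the radius of convergence of the power series is at least 1. *)
Definition subexp a := forall r, 0 <= r < 1 -> exists C : R, forall n, normc (a n) * r ^+ n <= C.

Lemma cvg0P (x : nat -> R) : (forall n, 0 <= x n) ->
  (x n @[n --> \oo] --> (0 : R)) <->
  (forall e : R, 0 < e -> exists N, forall n, (N <= n)%N -> x n <= e).
Proof.
move=> x0; split.
  move=> /cvgrPdist_le h e /h[N _ hN]; exists N => n /hN /=.
  by rewrite sub0r normrN ger0_norm.
move=> h; apply/cvgrPdist_le => e /h[N hN]; exists N => // n /hN /=.
by rewrite sub0r normrN ger0_norm.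
Qed.

Lemma normc_lim_unique (x : nat -> CC R) (s t : CC R) :
  normc (x n - s) @[n --> \oo] --> (0 : R) -> normc (x n - t) @[n --> \oo] --> (0 : R) -> s = t.
Proof.
move=> /cvg0P h1 /cvg0P h2; apply/eqP; rewrite -subr_eq0; apply/eqP.
apply: ComplexField.Normc.eq0_normc; apply/eqP; rewrite eq_le normc_ge0 andbT.
apply/ler_addgt0Pr => e e0; rewrite add0r.
have e2 : 0 < e / 2 by rewrite divr_gt0.
have [N1 k1] := h1 (fun n => normc_ge0 _) _ e2; have [N2 k2] := h2 (fun n => normc_ge0 _) _ e2.
have := k1 (N1 + N2)%N (leq_addr _ _); have := k2 (N1 + N2)%N (leq_addl _ _).
set y := x _ => b1 b2.
rewrite (_ : s - t = (y - t) - (y - s)); last by ring.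
by apply: le_trans (le_normcD _ _) _; rewrite normcN (splitr e) lerD.
Qed.

Lemma normc_lim_le (x : nat -> CC R) (s : CC R) (B : R) :
  normc (x n - s) @[n --> \oo] --> (0 : R) ->
  (exists N0, forall n, (N0 <= n)%N -> normc (x n) <= B) -> normc s <= B.
Proof.
move=> /cvg0P h [N0 hB]; apply/ler_addgt0Pr => e e0.
have [N hN] := h (fun n => normc_ge0 _) e e0.
have := hN (N0 + N)%N (leq_addl _ _); have := hB (N0 + N)%N (leq_addr _ _).
set y := x _ => b1 b2; rewrite -[s](subrK y) addrC.
by apply: le_trans (le_normcD _ _) _; rewrite lerD // normcB.
Qed.

Lemma abs_summable_tail (x : nat -> R) (B : R) : (forall n, 0 <= x n) ->
  (forall N, \sum_(n < N) x n <= B) -> forall e : R, 0 < e ->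
  exists N0, forall N M, (N0 <= N)%N -> (N <= M)%N -> \sum_(N <= n < M) x n <= e.
Proof.
move=> x0 xB e e0.
have mono : nondecreasing_seq (series x) by apply: nondecreasing_series => n _ _; exact: x0.
have cv : cvgn (series x).
  apply: nondecreasing_is_cvgn => //; exists B => _ [N _ <-].
  by rewrite /series /= big_mkord.
have := cv => /cvgrPdist_le/(_ _ e0)[N0 _ hN]; exists N0 => N M h1 h2.
have := hN N h1; rewrite /= => l.
have leM : series x M <= limn (series x) by exact: nondecreasing_cvgn_le.
have -> : \sum_(N <= n < M) x n = series x M - series x N.
  by rewrite /series /= [in RHS](@big_cat_nat _ _ _ N 0 M) //= [X in X - _]addrC addrK.
have := ler_norm (limn (series x) - series x N); lra.
Qed.

Lemma abs_summable_cvg (x : nat -> CC R) (B : R) :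
  (forall N, \sum_(n < N) normc (x n) <= B) ->
  exists s : CC R, normc (\sum_(n < N) x n - s) @[N --> \oo] --> (0 : R).
Proof.
move=> xB.
have key (p : nat -> R) : (forall n, `|p n| <= normc (x n)) -> cvgn (series p).
  move=> px; apply: normed_cvg; apply: nondecreasing_is_cvgn.
    by apply: nondecreasing_series => n _ _; rewrite normr_ge0.
  exists B => _ [N _ <-]; rewrite -[X in X <= _]/(\sum_(0 <= k < N) `|p k|) big_mkord.
  by apply: le_trans (xB N); apply: ler_sum => n _; exact: px.
have c1 := key (fun n => Re (x n)) (fun n => Re_le_normc _).
have c2 := key (fun n => Im (x n)) (fun n => Im_le_normc _).
exists (limn (series (fun n => Re (x n))) +i* limn (series (fun n => Im (x n)))).
apply/cvg0P => [n|e e0]; first exact: normc_ge0.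
have e2 : 0 < e / 2 by rewrite divr_gt0.
have [N1 _ h1] : \forall n \near \oo, `|limn (series (fun n => Re (x n))) - series (fun n => Re (x n)) n| <= e / 2.
  by move: c1 => /cvgrPdist_le; exact.
have [N2 _ h2] : \forall n \near \oo, `|limn (series (fun n => Im (x n))) - series (fun n => Im (x n)) n| <= e / 2.
  by move: c2 => /cvgrPdist_le; exact.
exists (N1 + N2)%N => n hn.
have k1 := h1 n (leq_trans (leq_addr _ _) hn); have k2 := h2 n (leq_trans (leq_addl _ _) hn).
apply: le_trans (normc_le_parts _) _; rewrite ReB ImB Re_sum Im_sum [leRHS](splitr e).
by apply: lerD; rewrite distrC; [move: k1|move: k2]; rewrite /= /series /= big_mkord.
Qed.

Lemma psum_geo_bound (C q : R) (x : nat -> R) : 0 <= q < 1 ->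
  (forall n, 0 <= x n <= C * q ^+ n) -> forall N, \sum_(n < N) x n <= C / (1 - q).
Proof.
move=> /andP[q0 q1] hx N.
have C0 : 0 <= C by have /andP[a b] := hx 0%N; move: (le_trans a b); rewrite expr0 mulr1.
have p : 0 < 1 - q by rewrite subr_gt0.
apply: (@le_trans _ _ (\sum_(n < N) C * q ^+ n)).
  by apply: ler_sum => n _; have /andP[] := hx n.
rewrite -mulr_sumr ler_wpM2l // -[leRHS]mul1r ler_pdivlMr // mulrC.
have -> : (1 - q) * \sum_(n < N) q ^+ n = 1 - q ^+ N.
  by rewrite -[in RHS](expr1n _ N) subrXX; congr (_ * _); apply: eq_bigr => n _; rewrite expr1n mul1r.
by rewrite gerBl exprn_ge0.
Qed.

Lemma between_lt1 r : 0 <= r -> r < 1 -> exists s, [/\ 0 < s, 0 <= s < 1 & r < s].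
Proof.
move=> r0 r1; exists ((1 + r) / 2); split; first lra; last lra.
by apply/andP; split; lra.
Qed.

Lemma subexp_abs a r : subexp a -> 0 <= r < 1 ->
  exists B, forall N, \sum_(n < N) normc (a n) * r ^+ n <= B.
Proof.
move=> sa /andP[r0 r1]; have [s [s0 s01 rs]] := between_lt1 r0 r1.
have [C hC] := sa s s01.
exists (C / (1 - r / s)); apply: (@psum_geo_bound C (r / s) (fun n => normc (a n) * r ^+ n)).
  by rewrite divr_ge0 ?(ltW s0) //= ltr_pdivrMr // mul1r.
move=> n; rewrite mulr_ge0 ?normc_ge0 ?exprn_ge0 //= expr_div_n mulrA ler_pdivlMr ?exprn_gt0 //.
by rewrite mulrAC ler_wpM2r ?exprn_ge0.
Qed.

Lemma pser_subexp a f : pser a f -> subexp a.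
Proof.
move=> paf r /andP[r0 r1].
have rn : normc (r%:C : CC R) = r by rewrite normcR ger0_norm.
have := paf r%:C; rewrite rn => /(_ r1)/cvg0P h.
have [N hN] := h (fun n => normc_ge0 _) 1 ltr01.
(* From [N] on, a term is the difference of two partial sums within 1 of the limit, which gives 2;
   the sum covers the terms before [N]. *)
exists (2 + \sum_(n < N) normc (a n) * r ^+ n) => n.
have tn : normc (a n * r%:C ^+ n) = normc (a n) * r ^+ n.
  by rewrite ComplexField.Normc.normcM normcX rn.
have sge : 0 <= \sum_(n < N) normc (a n) * r ^+ n.
  by apply: sumr_ge0 => i _; rewrite mulr_ge0 ?normc_ge0 ?exprn_ge0.
have [lt|ge] := ltnP n N.
  rewrite (bigD1 (Ordinal lt)) //=.
  have : 0 <= \sum_(i < N | i != Ordinal lt) normc (a i) * r ^+ i.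
    by apply: sumr_ge0 => i _; rewrite mulr_ge0 ?normc_ge0 ?exprn_ge0.
  lra.
have h1 := hN n ge; have h2 := hN n.+1 (leqW ge).
rewrite -tn; have -> : a n * r%:C ^+ n = (psum a n.+1 r%:C - f r%:C) - (psum a n r%:C - f r%:C).
  by rewrite /psum big_ord_recr /=; ring.
apply: le_trans (le_normcD _ _) _; rewrite normcN; lra.
Qed.

Lemma subexp_pser a : subexp a -> exists f, pser a f.
Proof.
move=> sa; have H z : exists s : CC R, normc z < 1 -> normc (psum a N z - s) @[N --> \oo] --> (0 : R).
  have [z1|z1] := ltP (normc z) 1; last by exists 0.
  have [|B hB] := @subexp_abs a (normc z) sa; first by rewrite normc_ge0.
  have [|s hs] := @abs_summable_cvg (fun n => a n * z ^+ n) B; last by exists s.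
  move=> N; apply: le_trans (hB N); apply: ler_sum => n _.
  by rewrite ComplexField.Normc.normcM normcX.
exists (fun z => projT1 (cid (H z))) => z z1; exact: (projT2 (cid (H z))).
Qed.

Lemma psumB a N M z : (N <= M)%N ->
  psum a M z - psum a N z = \sum_(N <= n < M) a n * z ^+ n.
Proof.
by move=> le; rewrite /psum -!(big_mkord xpredT (fun n => a n * z ^+ n)) [X in X - _](@big_cat_nat _ _ _ N 0 M) //= [X in X - _]addrC addrK.
Qed.

Lemma pser_uniform a f r (e : R) : pser a f -> 0 <= r < 1 -> 0 < e ->
  exists N0, forall N z, (N0 <= N)%N -> normc z <= r -> normc (psum a N z - f z) <= e.
Proof.
move=> paf r01 e0; have /andP[r0 r1] := r01.
have [B hB] := subexp_abs (pser_subexp paf) r01.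
have [||N0 hN] := @abs_summable_tail (fun n => normc (a n) * r ^+ n) B _ _ e e0 => //.
  by move=> n; rewrite mulr_ge0 ?normc_ge0 ?exprn_ge0.
exists N0 => N z NN zr; rewrite normcB.
have := paf z (le_lt_trans zr r1) => h.
apply: (@normc_lim_le (fun M => psum a M z - psum a N z)).
  rewrite (_ : (fun M => _) = fun M => normc (psum a M z - f z)) //.
  by apply/funext => M; congr normc; ring.
exists N => M NM; rewrite psumB //; apply: le_trans (normc_sum _ _ _) _.
apply: le_trans (hN N M NN NM); apply: ler_sum => n _.
rewrite ComplexField.Normc.normcM normcX ler_wpM2l ?normc_ge0 //.
by apply: lerXn2r => //; rewrite nnegrE ?normc_ge0.
Qed.

Lemma bernoulli_ineq (x : R) n : 0 <= x -> 1 + n%:R * x <= (1 + x) ^+ n.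
Proof.
move=> x0; elim: n => [|n IH]; first by rewrite mul0r addr0 expr0.
rewrite exprS; apply: le_trans (ler_wpM2l _ IH); last by rewrite addr_ge0.
rewrite -natr1; have : 0 <= n%:R * (x * x) by rewrite !mulr_ge0.
by move: (n%:R : R) => k; lra.
Qed.

Lemma bernoulli_sub n (x : R) : 0 <= x -> x <= 1 -> 1 - n%:R * x <= (1 - x) ^+ n.
Proof.
move=> x0 x1; elim: n => [|n IH]; first by rewrite mul0r subr0 expr0.
have y0 : 0 <= 1 - x by rewrite subr_ge0.
rewrite exprS; apply: le_trans (ler_wpM2l y0 IH).
rewrite -[n.+1%:R]natr1; have : 0 <= n%:R * (x * x) by rewrite !mulr_ge0.
by move: (n%:R : R) => k h; nra.
Qed.

(** A slightly larger radius [s] absorbs the factor [n]: with [1 + x = s / r], Bernoulli's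
    inequality gives [n * x <= (s / r)^n]. *)
Lemma subexp_natM a : subexp a -> subexp (fun n => n%:R * a n).
Proof.
move=> sa r /andP[r0 r1]; have [s [s0 s01 rs]] := between_lt1 r0 r1.
have [C hC] := sa s s01.
have [rz|rn] := eqVneq r 0.
  exists 0 => -[|n]; first by rewrite mul0r ComplexField.Normc.normc0 mul0r.
  by rewrite rz exprS mul0r mulr0.
have rp : 0 < r by rewrite lt_def rn.
have [x [x0 ex]] : exists x, 0 < x /\ 1 + x = s / r.
  by exists (s / r - 1); split; [rewrite subr_gt0 ltr_pdivlMr // mul1r|rewrite addrC subrK].
exists (C / x) => n.
have nn : normc (n%:R : CC R) = n%:R.
  by rewrite -(rmorph_nat (real_complex R)) normcR ger0_norm.
rewrite ComplexField.Normc.normcM nn ler_pdivlMr //.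
have b := bernoulli_ineq n (ltW x0).
have e : (1 + x) ^+ n * r ^+ n = s ^+ n.
  by rewrite -exprMn ex mulfVK.
apply: le_trans (hC n).
have : n%:R * x * r ^+ n <= s ^+ n.
  rewrite -e ler_wpM2r ?exprn_ge0 //; apply: le_trans b.
  by rewrite lerDr.
have n0 := normc_ge0 (a n) => h.
have := ler_wpM2l n0 h; move: (n%:R : R) (r ^+ n) (normc (a n)) => A B E; lra.
Qed.

Lemma subexp_shift a : subexp a -> subexp (fun n => a n.+1).
Proof.
move=> sa r /andP[r0 r1]; have [s [s0 s01 rs]] := between_lt1 r0 r1.
have [C hC] := sa s s01; exists (C / s) => n; rewrite ler_pdivlMr //.
apply: le_trans (hC n.+1); rewrite exprSr mulrA ler_wpM2r ?(ltW s0) //.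
rewrite ler_wpM2l ?normc_ge0 //; apply: lerXn2r; rewrite ?nnegrE ?(ltW s0) //.
exact: ltW.
Qed.

Definition dcoef a n : CC R := n.+1%:R * a n.+1.

Lemma subexp_dcoef a : subexp a -> subexp (dcoef a).
Proof. by move=> sa; exact: (subexp_shift (subexp_natM sa)). Qed.

(** The Taylor remainder of a power, with the crude constant [(n + 1)^2]. Multiplying by [r ^+ 2]
    avoids the exponent [n - 1], and the induction stays free of divisions. *)
Lemma expr_second_order (z h : CC R) r n : 0 <= r -> normc z <= r -> normc (z + h) <= r ->
  normc ((z + h) ^+ n.+1 - z ^+ n.+1 - n.+1%:R * z ^+ n * h) * r ^+ 2
   <= normc h ^+ 2 * (n.+1%:R ^+ 2 * r ^+ n.+1).
Proof.
move=> r0 zr zhr; elim: n => [|n IH].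
  rewrite (_ : _ - _ = 0) ?ComplexField.Normc.normc0 ?mul0r; last by rewrite expr0 !expr1; ring.
  by apply: mulr_ge0; [exact: sqr_ge0|apply: mulr_ge0; [exact: sqr_ge0|exact: exprn_ge0]].
have -> : (z + h) ^+ n.+2 - z ^+ n.+2 - n.+2%:R * z ^+ n.+1 * h =
    (z + h) * ((z + h) ^+ n.+1 - z ^+ n.+1 - n.+1%:R * z ^+ n * h) + n.+1%:R * z ^+ n * h ^+ 2.
  by rewrite -[n.+2%:R]natr1 !(exprS _ n.+1) [z ^+ n.+1]exprS; ring.
set E := ((z + h) ^+ n.+1 - _ - _) in IH *.
have nn (k : nat) : normc (k%:R : CC R) = k%:R.
  by rewrite -(rmorph_nat (real_complex R)) normcR ger0_norm.
have r2 : 0 <= r ^+ 2 by rewrite exprn_ge0.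
apply: le_trans (ler_wpM2r r2 (le_normcD _ _)) _.
rewrite !ComplexField.Normc.normcM !normcX nn mulrDl.
have b1 : normc (z + h) * normc E * r ^+ 2 <= r * (normc h ^+ 2 * (n.+1%:R ^+ 2 * r ^+ n.+1)).
  by rewrite -mulrA ler_pM ?mulr_ge0 ?normc_ge0.
have b2 : n.+1%:R * normc z ^+ n * normc h ^+ 2 * r ^+ 2 <= n.+1%:R * r ^+ n * normc h ^+ 2 * r ^+ 2.
  rewrite ler_wpM2r // ler_wpM2r ?sqr_ge0 // ler_wpM2l //.
  by apply: lerXn2r => //; rewrite nnegrE ?normc_ge0.
apply: le_trans (lerD b1 b2) _.
have -> : r ^+ n.+2 = r ^+ n * r ^+ 2 by rewrite -exprD addn2.
have -> : r * (normc h ^+ 2 * (n.+1%:R ^+ 2 * r ^+ n.+1)) =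
    normc h ^+ 2 * (n.+1%:R ^+ 2) * (r ^+ n * r ^+ 2) by rewrite (exprS r n); ring.
have -> : n.+1%:R * r ^+ n * normc h ^+ 2 * r ^+ 2 = normc h ^+ 2 * n.+1%:R * (r ^+ n * r ^+ 2) by ring.
rewrite -mulrDl -mulrDr [leRHS]mulrA ler_wpM2r ?mulr_ge0 ?exprn_ge0 // ler_wpM2l ?sqr_ge0 //.
by rewrite -[n.+2%:R]natr1; move: (ler0n R n.+1); move: (n.+1%:R : R) => k k0; nra.
Qed.

(** Termwise differentiation: the second-order remainders of the powers add up to at most a multiple
    of the sum of [n^2 * |a n| * r^n], finite for [r] between [|z|] and 1. *)
Lemma pser_cdiff a f f1 z : pser a f -> pser (dcoef a) f1 -> normc z < 1 ->
  cdiff f z (f1 z).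
Proof.
move=> paf paf1 z1; have [r [r0 r01 zr]] := between_lt1 (normc_ge0 z) z1.
have [B hB] := subexp_abs (subexp_natM (subexp_natM (pser_subexp paf))) r01.
have nn (k : nat) : normc (k%:R : CC R) = k%:R.
  by rewrite -(rmorph_nat (real_complex R)) normcR ger0_norm.
have B0 : 0 <= B by have := hB 0%N; rewrite big_ord0.
have main h : normc (z + h) <= r ->
    normc (f (z + h) - f z - f1 z * h) * r ^+ 2 <= normc h ^+ 2 * B.
  move=> zhr; have zh1 : normc (z + h) < 1 by apply: le_lt_trans zhr _; have /andP[] := r01.
  have r2 : 0 < r ^+ 2 by rewrite exprn_gt0.
  rewrite -ler_pdivlMr //.
  (* [N.+1] terms of the series against [N] terms of its derivative, since the constant term
     disappears. *)
  pose X N := psum a N.+1 (z + h) - psum a N.+1 z - psum (dcoef a) N z * h.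
  apply: (@normc_lim_le X).
    have c1 := paf _ zh1; have c2 := paf _ z1; have c3 := paf1 _ z1.
    apply/cvg0P => [n|e e0]; first exact: normc_ge0.
    pose K := normc h + 2; have K0 : 0 < K by rewrite ltr_wpDl ?normc_ge0.
    have eK : 0 < e / K by rewrite divr_gt0.
    move/cvg0P : c1 => /(_ (fun n => normc_ge0 _) _ eK)[N1 h1].
    move/cvg0P : c2 => /(_ (fun n => normc_ge0 _) _ eK)[N2 h2].
    move/cvg0P : c3 => /(_ (fun n => normc_ge0 _) _ eK)[N3 h3].
    exists (maxn N1 (maxn N2 N3)) => n; rewrite !geq_max => /and3P[n1 n2 n3].
    have k1 := h1 n.+1 (leqW n1); have k2 := h2 n.+1 (leqW n2); have k3 := h3 n n3.
    rewrite (_ : X n - _ = (psum a n.+1 (z + h) - f (z + h)) - (psum a n.+1 z - f z)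
       - (psum (dcoef a) n z - f1 z) * h); last by rewrite /X; ring.
    apply: le_trans (le_normcD _ _) _; rewrite normcN ComplexField.Normc.normcM.
    apply: le_trans (lerD (le_normcD _ _) (ler_wpM2r (normc_ge0 h) k3)) _; rewrite normcN.
    have eE : e / K + e / K + e / K * normc h = e.
      by rewrite -mulr2n -mulr_natr -mulrDr [2 + _]addrC mulfVK // gt_eqF.
    by rewrite -[leRHS]eE lerD // lerD.
  exists 0%N => N _; rewrite ler_pdivlMr //.
  have -> : X N = \sum_(n < N) a n.+1 * ((z + h) ^+ n.+1 - z ^+ n.+1 - n.+1%:R * z ^+ n * h).
    rewrite /X /psum !big_ord_recl !expr0 mulr_suml.
    have cancel3 (p q u v : CC R) : (p + q) - (p + u) - v = q - u - v by ring.
    rewrite cancel3 -!sumrB.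
    by apply: eq_bigr => n _; rewrite /dcoef lift0; ring.
  apply: le_trans (ler_wpM2r (ltW r2) (normc_sum _ _ _)) _; rewrite mulr_suml.
  apply: le_trans (ler_wpM2l (sqr_ge0 _) (hB N.+1)).
  rewrite big_ord_recl mul0r ComplexField.Normc.normc0 mul0r add0r mulr_sumr.
  apply: ler_sum => n _; rewrite lift0 !ComplexField.Normc.normcM !nn.
  have := expr_second_order n (ltW r0) (ltW zr) zhr => le.
  rewrite -[leLHS]mulrA; apply: le_trans (ler_wpM2l (normc_ge0 (a n.+1)) le) _.
  by rewrite le_eqVlt; apply/orP; left; apply/eqP; ring.
move=> e e0; have B1 : 0 < B + 1 by rewrite ltr_wpDl.
have r2 : 0 < r ^+ 2 by rewrite exprn_gt0.
exists (Num.min (r - normc z) (e * r ^+ 2 / (B + 1))) => [|h].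
  by rewrite lt_min subr_gt0 zr divr_gt0 // mulr_gt0.
rewrite lt_min => /andP[h1 h2].
have zhr : normc (z + h) <= r by have := le_normcD z h; lra.
rewrite -(ler_pM2r r2); apply: le_trans (main h zhr) _.
rewrite expr2 -!mulrA mulrCA [leRHS]mulrCA ler_wpM2l ?normc_ge0 //.
move: h2; rewrite ltr_pdivlMr // => h2; have := normc_ge0 h.
by move: h2; rewrite mulrDr mulr1 => h2 h3; lra.
Qed.

Lemma pser_holomorphic a f : pser a f -> holomorphic_disc f.
Proof.
move=> paf z z1; have [f1 hf1] := subexp_pser (subexp_dcoef (pser_subexp paf)).
by have [] := cdiff_derivable (pser_cdiff paf hf1 z1).
Qed.

Lemma pser_derive1 a f : pser a f -> pser (dcoef a) (derive1 f).
Proof.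
move=> paf z z1; have [f1 hf1] := subexp_pser (subexp_dcoef (pser_subexp paf)).
have [_ ->] := cdiff_derivable (pser_cdiff paf hf1 z1); exact: hf1.
Qed.

End PowerSeriesTools.

(** * The Bergman case *)

Section Exhaustion.
Context {R : realType} {d : measure_display} {T : measurableType d}.
Variables (mu : {measure set T -> \bar R}) (D : set T) (w : T -> R).
Hypothesis mD : measurable D.
Implicit Types (S : nat -> set T) (p : T -> R) (u v G P : T -> CC R).

Lemma Rintegral_exhaust0 S p : (forall j, measurable (S j)) -> (forall j, S j `<=` D) ->
  (forall x, D x -> exists N, forall j, (N <= j)%N -> S j x) ->
  mu.-integrable D (EFin \o p) -> (forall j, \int[mu]_(x in S j) p x = 0) ->
  \int[mu]_(x in D) p x = 0.
Proof.
move=> mS SD ex ip h.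
have := @dominated_convergence _ _ _ mu D mD (fun j => (EFin \o p) \_ (S j)) (EFin \o p)
  (fun x => `|(EFin \o p) x|)%E _ _ _ _ _.
case.
- move=> j; apply/(@measurable_restrict _ _ _ _ (S j) D) => //.
  by apply: measurable_funS (measurable_int _ ip) => // x [].
- exact: measurable_int ip.
- apply: aeW => x Dx; have [N hN] := ex x Dx.
  apply: cvg_near_cst; exists N => // j /= Nj.
  by rewrite patchE mem_set //; exact: hN.
- exact: integrable_abse.
- by apply: aeW => x j _; rewrite patchE; case: ifP => // _; rewrite abse0 abse_ge0.
move=> _ _ cv; rewrite /Rintegral.
have e0 : (fun n => \int[mu]_(x in D) ((EFin \o p) \_ (S n)) x)%E = (fun=> 0%E).
  apply/funext => j; rewrite -integral_mkcondr setIidr //.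
  rewrite -[0%E]/(0%R%:E) -(h j) /Rintegral fineK //.
  by apply: integrable_fin_num => //; exact: integrableS ip.
move: cv; rewrite e0 => cv.
by rewrite -(cvg_lim (@ereal_hausdorff R) cv) (cvg_lim (@ereal_hausdorff R) (cvg_cst _)).
Qed.

Hypothesis mw : measurable_fun D w.
Hypothesis w0 : forall x, D x -> 0 <= w x.

Lemma L2_subset (E : set T) u : measurable E -> E `<=` D -> L2 mu D w u -> L2 mu E w u.
Proof.
move=> mE ED /(L2P _ mw w0)[[c1 c2] i].
apply/L2P; first exact: measurable_funS mw.
  by move=> x /ED; exact: w0.
by split; [split; apply: measurable_funS (c1) || apply: measurable_funS (c2)|exact: integrableS i].
Qed.

(** Cauchy-Schwarz on [E], where constants have finite norm, lets the uniform error control the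
    inner product. *)
Lemma inner_uniform_limit0 (E : set T) G v : measurable E -> E `<=` D ->
  L2 mu D w (fun=> 1) -> L2 mu D w G -> L2 mu D w v ->
  (forall e : R, 0 < e -> exists P, [/\ L2 mu D w P, L2inner mu E w P v = 0 &
     forall x, E x -> sqn (G x - P x) <= e]) -> L2inner mu E w G v = 0.
Proof.
move=> mE ED L1 LG Lv hP.
have mwE : measurable_fun E w by exact: measurable_funS mw.
have w0E x : E x -> 0 <= w x by move=> /ED; exact: w0.
have sub u := @L2_subset E u mE ED.
have n1 := nrm2_ge0 mu w0E (fun=> 1); have nv := nrm2_ge0 mu w0E v.
suff h : sqn (L2inner mu E w G v) <= 0.
  have s0 := sqn_ge0 (L2inner mu E w G v).
  apply: ComplexField.Normc.eq0_normc; rewrite normc_sqrt; apply/eqP; rewrite sqrtr_eq0; exact: h.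
apply/ler_addgt0Pr => e e0; rewrite add0r.
pose K := nrm2 mu E w (fun=> 1) * nrm2 mu E w v + 1.
have K0 : 0 < K by rewrite ltr_wpDl // mulr_ge0.
have [P [LP P0 hGP]] := hP (e / K) (divr_gt0 e0 K0).
have -> : L2inner mu E w G v = L2inner mu E w (G \- P) v.
  by rewrite innerBl ?P0 ?subr0 //; exact: sub.
have LGP : L2 mu E w (G \- P) by apply: L2B => //; exact: sub.
apply: le_trans (cauchy_schwarz mE mwE w0E LGP (sub _ Lv)) _.
have le1 : nrm2 mu E w (G \- P) <= e / K * nrm2 mu E w (fun=> 1).
  have i1 : mu.-integrable E (EFin \o (fun x => w x * sqn (1 : CC R))).
    by have /(L2P _ mwE w0E)[] := sub _ L1.
  rewrite -(RintegralZl (e / K) mE i1); apply: le_Rintegral => //.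
  - by have /(L2P _ mwE w0E)[] := LGP.
  - exact: (@integrableZl _ _ _ mu E mE (e / K) _ i1).
  - move=> x Ex; rewrite sqn1 mulr1 mulrC ler_wpM2r //; [exact: w0E|exact: hGP].
apply: le_trans (ler_wpM2r nv le1) _; rewrite -[leLHS]mulrA.
have leK : nrm2 mu E w (fun=> 1) * nrm2 mu E w v <= K by rewrite /K lerDl.
apply: le_trans (ler_wpM2l _ leK) _; first by rewrite divr_ge0 // ltW.
by rewrite divfK // gt_eqF.
Qed.

End Exhaustion.

Section Limits.
Context {R : realType} {d : measure_display} {T : measurableType d} (D : set T).
Implicit Types (F : nat -> T -> CC R) (u : T -> CC R).

Lemma normc_sqn_cvg0 (x : nat -> CC R) :
  normc (x n) @[n --> \oo] --> (0 : R) -> sqn (x n) @[n --> \oo] --> (0 : R).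
Proof.
move=> h; rewrite (_ : (fun n => sqn (x n)) = (fun n => normc (x n) * normc (x n))); last first.
  by apply/funext => n; rewrite -sqr_normc_sqn expr2.
have hh := cvgM h h; rewrite mulr0 in hh; exact: hh.
Qed.

Lemma cvg0_squeeze (x y : nat -> R) : (forall n, 0 <= x n) -> (forall n, x n <= y n) ->
  y n @[n --> \oo] --> (0 : R) -> x n @[n --> \oo] --> (0 : R).
Proof.
move=> x0 xy cy; apply: (@squeeze_cvgr _ _ _ _ (fun=> 0) y) => //; last exact: cvg_cst.
by apply: nearW => n; rewrite x0 xy.
Qed.

Lemma cmeas_lim F u : measurable D -> (forall n, cmeas D (F n)) ->
  (forall x, D x -> normc (F n x - u x) @[n --> \oo] --> (0 : R)) -> cmeas D u.
Proof.
move=> mD mF cF.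
have key (g : CC R -> R) : (forall z z', g (z - z') = g z - g z') ->
    (forall z, `|g z| <= normc z) -> (forall n, measurable_fun D (fun x => g (F n x))) ->
    measurable_fun D (fun x => g (u x)).
  move=> gB gle mg; apply: (measurable_fun_cvg mg) => x Dx.
  apply/cvgrPdist_le => e e0; have /cvgrPdist_le/(_ _ e0)[N _ hN] := cF x Dx.
  exists N => // n /hN /=; rewrite sub0r normrN ger0_norm ?normc_ge0 // => h.
  by rewrite -gB (le_trans (gle _)) // normcB.
by split; (apply: key; [move=> *; rewrite ?ReB ?ImB|move=> z|move=> n]) => //;
  rewrite ?Re_le_normc ?Im_le_normc //; have [] := mF n.
Qed.

End Limits.

(** * Taylor coefficients as inner products *)

Section Bergman.
Context {R : realType}.
Local Notation mR := (measurableTypeR R).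
Local Notation mu2 := (@plane_mu R).
Variable alpha : R.
Hypothesis halpha : -1 < alpha.
Local Notation D := (@disc R : set (mR * mR)).
Local Notation w := (@dA R alpha : mR * mR -> mR).
Local Notation zeta := (@toC R : mR * mR -> CC R).
Local Notation gam := (bgam alpha).
Let mD : measurable D := @measurable_disc R.
Let mw : measurable_fun D w := @measurable_dA_disc R alpha.
Let w0 (p : mR * mR) (_ : D p) : 0 <= w p := dA_ge0 halpha p.
Let mzeta : cmeas D zeta := cmeas_toC D.
Let zeta1 := @sqn_toC_le R.
Let L1 := L2_disc_one halpha.
Let gam0 n : 0 < gam n := bgam_gt0 n (ltW halpha).

Lemma inner_subdisc_orthogonal (S : set (mR * mR)) n m : measurable S -> S `<=` D ->
  (forall c s, c ^+ 2 + s ^+ 2 = 1 -> rot c s @^-1` S = S) -> (n != m)%N ->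
  L2inner mu2 S w (fun p => toC p ^+ n) (fun p => toC p ^+ m) = 0.
Proof.
move=> mS SD Srot; rewrite neq_ltn => /orP[lt|lt]; last exact: inner_disc_orthogonal lt.
have mwS : measurable_fun S w by exact: measurable_funS mw.
have w0S p : S p -> 0 <= w p by move=> _; exact: dA_ge0.
have LS k : L2 mu2 S w (fun p => toC p ^+ k).
  by apply: (L2_subset mD mw w0 mS SD); exact: L2_disc_power.
by rewrite (innerJ mS mwS w0S (LS m) (LS n)) inner_disc_orthogonal // rmorph0.
Qed.

Lemma inner_disc n m :
  L2inner mu2 D w (fun p => zeta p ^+ n) (fun p => zeta p ^+ m) = (if n == m then gam n else 0)%:C.
Proof.
case: eqP => [<-|/eqP nm].
  rewrite inner_self; congr (_%:C); rewrite /nrm2 /Rintegral.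
  have := disc_moment halpha n; rewrite -[gam n]/(fine (gam n)%:E) => <-; congr fine.
  apply: eq_integral => p _; congr (_%:E); congr (_ * _).
  by rewrite sqnX sqn_toC.
apply: inner_subdisc_orthogonal => // c s cs.
by apply/seteqP; split => p; rewrite discE /= sqnorm_rot.
Qed.

(* The coefficients are read off on smaller discs |z| <= r, where the power series
   converges uniformly and the monomials are still orthogonal by rotation invariance. *)
Lemma bergman_inner a (f : CC R -> CC R) k : pser a f -> L2 mu2 D w (f \o toC) ->
  L2inner mu2 D w (f \o toC) (fun p => zeta p ^+ k) = (gam k)%:C * a k.
Proof.
move=> paf Lf.
have Lz n : L2 mu2 D w (fun p => zeta p ^+ n) := L2_disc_power halpha n.
have Lak : L2 mu2 D w (fun p => a k * zeta p ^+ k) by exact: L2Z.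
(* Once its [k]-th term is removed, the function only has to be shown orthogonal to [z^k]. *)
pose G : mR * mR -> CC R := (f \o toC) \- (fun p => a k * zeta p ^+ k).
have LG : L2 mu2 D w G by exact: L2B.
suff G0 : L2inner mu2 D w G (fun p => zeta p ^+ k) = 0.
  have := innerBl mD mw w0 Lf Lak (Lz k); rewrite -/G G0.
  rewrite (innerZl mD mw w0 _ (Lz k) (Lz k)) inner_disc eqxx => /eqP.
  by rewrite eq_sym subr_eq0 mulrC => /eqP.
pose S j : set (mR * mR) := [set p | sqnorm p <= 1 - j.+1%:R^-1].
have mS j : measurable (S j) by exact: measurable_disc_le.
have SD j : S j `<=` D.
  move=> p /= h; rewrite discE /= in_itv /= {1}/sqnorm addr_ge0 ?sqr_ge0 //=.
  by apply: le_lt_trans h _; rewrite ltrBlDr ltrDl invr_gt0.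
have ex p : D p -> exists N, forall j, (N <= j)%N -> S j p.
  rewrite discE /= in_itv /= => /andP[_ p1].
  have q0 : 0 < 1 - sqnorm p by rewrite subr_gt0.
  have [N hN] : exists N, (1 - sqnorm p)^-1 < N%:R :> R.
    by exists (Num.trunc ((1 - sqnorm p)^-1)).+1; rewrite truncnS_gt.
  exists N => j Nj; rewrite /S /= lerBrDl addrC -lerBrDl addrC.
  rewrite -[leRHS]invrK lef_pV2 ?posrE ?invr_gt0 //; last by rewrite addrC.
  apply: ltW; rewrite addrC; apply: lt_le_trans hN _; rewrite ler_nat; exact: leqW.
have S0 j : L2inner mu2 (S j) w G (fun p => zeta p ^+ k) = 0.
  apply: (inner_uniform_limit0 mD mw w0 (mS j) (@SD j) L1 LG (Lz k)) => e e0.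
  have se : 0 < Num.sqrt e by rewrite sqrtr_gt0.
  pose r := Num.sqrt (1 - j.+1%:R^-1 : R).
  have r01 : 0 <= r < 1.
    rewrite sqrtr_ge0 /=; rewrite -[ltRHS]sqrtr1 ltr_sqrt // ltrBlDr ltrDl invr_gt0 //.
  have [N0 hN] := pser_uniform paf r01 se.
  (* [M] exceeds [k] so that the partial sum contains the [k]-th term, which then cancels
     exactly. *)
  pose M := maxn N0 k.+1.
  exists (ppoly zeta a M \- (fun p => a k * zeta p ^+ k)).
  have mwS : measurable_fun (S j) w by exact: measurable_funS mw.
  have w0S p : S j p -> 0 <= w p by move=> _; exact: dA_ge0.
  have LS u : L2 mu2 D w u -> L2 mu2 (S j) w u by exact: (L2_subset mD mw w0 (mS j) (@SD j)).
  have Lp : L2 mu2 D w (ppoly zeta a M) by exact: L2_ppoly.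
  split; first exact: L2B.
  - rewrite (innerBl (mS j) mwS w0S (LS _ Lp) (LS _ Lak) (LS _ (Lz k))).
    rewrite (innerZl (mS j) mwS w0S _ (LS _ (Lz k)) (LS _ (Lz k))) /ppoly.
    have LSt (n : 'I_M) : L2 mu2 (S j) w (fun p => a n * zeta p ^+ n) by apply/LS; exact: L2Z.
    rewrite (inner_suml (mS j) mwS w0S (index_enum 'I_M) LSt (LS _ (Lz k))).
    have kM : (k < M)%N by rewrite leq_maxr.
    rewrite (bigD1 (Ordinal kM)) //= (innerZl (mS j) mwS w0S _ (LS _ (Lz k)) (LS _ (Lz k))).
    rewrite big1 ?addr0 ?subrr // => n nk.
    rewrite (innerZl (mS j) mwS w0S _ (LS _ (Lz n)) (LS _ (Lz k))).
    rewrite inner_subdisc_orthogonal ?mulr0 //.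
    by move=> c s cs; apply/seteqP; split => p; rewrite /S /= sqnorm_rot.
  - move=> p Sp; have pr : normc (toC p) <= r.
      by rewrite normc_sqrt sqn_toC ler_wsqrtr.
    have := hN M _ (leq_maxl _ _) pr; rewrite normcB => h.
    have cancel (x y z : CC R) : x - z - (y - z) = x - y by ring.
    rewrite -[X in sqn X]/(f (toC p) - a k * toC p ^+ k - (psum a M (toC p) - a k * toC p ^+ k)) cancel.
    rewrite -sqr_normc_sqn -[leRHS]sqr_sqrtr ?(ltW e0) //.
    by apply: lerXn2r => //; rewrite nnegrE ?normc_ge0 ?(ltW se).
have [i1 i2] := wprod_cint mD mw w0 LG (Lz k).
rewrite innerE; apply: complexP.
  by apply: (Rintegral_exhaust0 mD mS SD ex i1) => j; have := S0 j; rewrite innerE => -[].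
by apply: (Rintegral_exhaust0 mD mS SD ex i2) => j; have := S0 j; rewrite innerE => -[].
Qed.

End Bergman.

(** * Limits of inner products and Tannery's theorem *)

Section InnerLimits.
Context {R : realType} {d : measure_display} {T : measurableType d}.
Variables (mu : {measure set T -> \bar R}) (D : set T) (w : T -> R).
Hypothesis mD : measurable D.
Hypothesis mw : measurable_fun D w.
Hypothesis w0 : forall x, D x -> 0 <= w x.
Local Notation L2 := (L2 mu D w).
Local Notation inner := (L2inner mu D w).
Local Notation nrm2 := (nrm2 mu D w).
Implicit Types (u v q h : T -> CC R).

Lemma normc_inner_le u v : L2 u -> L2 v ->
  normc (inner u v) <= Num.sqrt (nrm2 u) * Num.sqrt (nrm2 v).
Proof.
move=> Lu Lv; rewrite -sqrtrM ?nrm2_ge0 // normc_sqrt ler_wsqrtr //.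
exact: cauchy_schwarz.
Qed.

Lemma sqrtr_cvg0 (x : nat -> R) : x n @[n --> \oo] --> (0 : R) ->
  Num.sqrt (x n) @[n --> \oo] --> (0 : R).
Proof.
move=> h; have hh := @continuous_cvg _ _ _ _ _ x Num.sqrt 0 (@sqrt_continuous R 0) h.
rewrite sqrtr0 in hh; exact: hh.
Qed.

Lemma inner_cvg (F G : nat -> T -> CC R) u v : (forall n, L2 (F n)) -> (forall n, L2 (G n)) ->
  L2 u -> L2 v -> nrm2 (F n \- u) @[n --> \oo] --> (0 : R) ->
  nrm2 (G n \- v) @[n --> \oo] --> (0 : R) ->
  normc (inner (F n) (G n) - inner u v) @[n --> \oo] --> (0 : R).
Proof.
move=> LF LG Lu Lv /sqrtr_cvg0 hF /sqrtr_cvg0 hG.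
set s := (fun n => Num.sqrt (nrm2 (F n \- u))) in hF.
set t := (fun n => Num.sqrt (nrm2 (G n \- v))) in hG.
apply: (@cvg0_squeeze _ _ (fun n => s n * t n + s n * Num.sqrt (nrm2 v) + Num.sqrt (nrm2 u) * t n)).
- by move=> n; exact: normc_ge0.
- move=> n; have LFu : L2 (F n \- u) by exact: L2B.
  have LGv : L2 (G n \- v) by exact: L2B.
  have -> : inner (F n) (G n) - inner u v =
      inner (F n \- u) (G n \- v) + inner (F n \- u) v + inner u (G n \- v).
    rewrite (innerBr mD mw w0 LFu (LG n) Lv) (innerBr mD mw w0 Lu (LG n) Lv).
    by rewrite (innerBl mD mw w0 (LF n) Lu (LG n)); ring.
  apply: le_trans (le_normcD _ _) _; apply: lerD; last exact: normc_inner_le.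
  by apply: le_trans (le_normcD _ _) _; apply: lerD; exact: normc_inner_le.
- have cst (k : R) : (fun=> k) @ \oo --> k by exact: cvg_cst.
  have hh := cvgD (cvgD (cvgM hF hG) (cvgM hF (cst (Num.sqrt (nrm2 v)))))
    (cvgM (cst (Num.sqrt (nrm2 u))) hG).
  rewrite !mul0r mulr0 !addr0 in hh; exact: hh.
Qed.

Lemma inner_limit0 q h (G : nat -> T -> CC R) : L2 q -> L2 h -> (forall n, L2 (G n)) ->
  (forall n, inner q (G n) = 0) -> nrm2 (G n \- h) @[n --> \oo] --> (0 : R) -> inner q h = 0.
Proof.
move=> Lq Lh LG q0 cG.
have c0 : nrm2 (q \- q) @[_ --> \oo] --> (0 : R).
  by rewrite nrm2_subxx; exact: cvg_cst.
have := inner_cvg (fun=> Lq) LG Lq Lh c0 cG => h1.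
apply/esym/(normc_lim_unique (x := fun=> 0)).
  by under eq_fun do rewrite subrr ComplexField.Normc.normc0; exact: cvg_cst.
by move: h1; under eq_fun do rewrite q0.
Qed.

End InnerLimits.

Section Tannery.
Context {R : realType}.

(** Dominated convergence for sums whose length grows with [M]: one third of the error goes to a
    fixed finite head, the other two to the tails of [x] and of [y], both below the tail of [B]. *)
Lemma tannery (x : nat -> nat -> CC R) (y : nat -> CC R) (B : nat -> R) (K : R) :
  (forall M k, normc (x M k) <= B k) -> (forall N, \sum_(k < N) B k <= K) ->
  (forall k, normc (x M k - y k) @[M --> \oo] --> (0 : R)) ->
  normc (\sum_(k < M) x M k - \sum_(k < M) y k) @[M --> \oo] --> (0 : R).
Proof.
move=> xB BK xy.
have B0 k : 0 <= B k := le_trans (normc_ge0 _) (xB 0%N k).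
have yB k : normc (y k) <= B k.
  apply: (@normc_lim_le _ (fun M => x M k)); first exact: xy.
  by exists 0%N.
apply/cvg0P => [M|e e0]; first exact: normc_ge0.
have e3 : 0 < e / 3 by rewrite divr_gt0.
have [N0 hN] := abs_summable_tail B0 BK e3.
have fin : \sum_(k < N0) normc (x M k - y k) @[M --> \oo] --> (0 : R).
  elim: (N0) => [|N IH]; first by under eq_fun do rewrite big_ord0; exact: cvg_cst.
  under eq_fun do rewrite big_ord_recr /=.
  have hh := cvgD IH (xy N); rewrite addr0 in hh; exact: hh.
have s0 M : 0 <= \sum_(k < N0) normc (x M k - y k) by apply: sumr_ge0 => *; exact: normc_ge0.
have /(cvg0P s0)/(_ _ e3)[N1 h1] := fin.
exists (maxn N0 N1) => M; rewrite geq_max => /andP[M0 M1].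
rewrite -sumrB -(big_mkord xpredT (fun k => x M k - y k)) (@big_cat_nat _ _ _ N0) //=.
apply: le_trans (le_normcD _ _) _.
have a1 : normc (\sum_(0 <= k < N0) (x M k - y k)) <= e / 3.
  by rewrite big_mkord; apply: le_trans (normc_sum _ _ _) _; exact: h1.
have a2 : normc (\sum_(N0 <= k < M) (x M k - y k)) <= e / 3 + e / 3.
  apply: le_trans (normc_sum _ _ _) _.
  apply: (@le_trans _ _ (\sum_(N0 <= k < M) (B k + B k))).
    by apply: ler_sum => k _; apply: le_trans (le_normcD _ _) _; rewrite normcN lerD.
  by rewrite big_split lerD //; exact: hN.
by move: a1 a2; lra.
Qed.

End Tannery.

(** * Norms and Taylor coefficients in the Bergman space *)

Section BergmanHankel.
Context {R : realType}.
Local Notation mR := (measurableTypeR R).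
Local Notation mu2 := (@plane_mu R).
Variable alpha : R.
Hypothesis halpha : -1 < alpha.
Local Notation D := (@disc R : set (mR * mR)).
Local Notation w := (@dA R alpha : mR * mR -> mR).
Local Notation zeta := (@toC R : mR * mR -> CC R).
Local Notation gam := (bgam alpha).
Let mD : measurable D := @measurable_disc R.
Let mw : measurable_fun D w := @measurable_dA_disc R alpha.
Let w0 (p : mR * mR) (_ : D p) : 0 <= w p := dA_ge0 halpha p.
Let mzeta : cmeas D zeta := cmeas_toC D.
Let zeta1 := @sqn_toC_le R.
Let L1 := L2_disc_one halpha.
Let gam0 n : 0 < gam n := bgam_gt0 n (ltW halpha).
Let ip := inner_disc halpha.
Implicit Types (a b : nat -> CC R) (f psi : CC R -> CC R).

Lemma toCK (p : R * R) : ofC (toC p) = p. Proof. by case: p. Qed.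

Lemma ofCK (z : CC R) : toC (ofC z) = z. Proof. by case: z. Qed.

Lemma disc_normc (p : mR * mR) : D p -> normc (toC p) < 1.
Proof.
rewrite discE /= in_itv /= => /andP[_ p1].
by rewrite normc_sqrt sqn_toC -[ltRHS]sqrtr1 ltr_sqrt.
Qed.

Lemma bergmanP (u : R * R -> CC R) : bergman alpha u ->
  exists f a, [/\ u = f \o toC, pser a f & L2 mu2 D w (f \o toC)].
Proof.
case=> Lu hu; exists (u \o ofC), (tcoef (u \o ofC)).
have e : u = (u \o ofC) \o toC by apply/funext => p /=; rewrite toCK.
by split => //; [exact: holomorphic_power_series|rewrite -e].
Qed.

Lemma pser_ppoly a f p : pser a f -> D p ->
  normc (ppoly zeta a N p - (f \o toC) p) @[N --> \oo] --> (0 : R).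
Proof. by move=> paf /disc_normc; exact: paf. Qed.

Lemma cmeas_pser a f : pser a f -> cmeas D (f \o toC).
Proof.
move=> paf; apply: (cmeas_lim mD (F := ppoly zeta a)); last by move=> p; exact: pser_ppoly.
by move=> N; apply: (@L2_cmeas _ _ _ mu2 D w mw w0); exact: L2_ppoly.
Qed.

(** The converse of Bessel's inequality, by Fatou's lemma along the partial sums. *)
Lemma pser_L2 a f B : pser a f -> (forall N, \sum_(n < N) gam n * sqn (a n) <= B) ->
  L2 mu2 D w (f \o toC) /\ nrm2 mu2 D w (f \o toC) <= B.
Proof.
move=> paf hB; have Lp N : L2 mu2 D w (ppoly zeta a N) by exact: L2_ppoly.
apply: (L2_fatou mD mw w0 (F := ppoly zeta a)).
- by move=> N; exact: (L2_cmeas mw w0 (Lp N)).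
- exact: cmeas_pser paf.
- by move=> N; split => //; rewrite (nrm2_ppoly mD mw w0 mzeta zeta1 L1 ip).
- by move=> p Dp; apply: normc_sqn_cvg0; exact: pser_ppoly.
Qed.

Lemma pcoef_pser a f : pser a f -> L2 mu2 D w (f \o toC) ->
  pcoef mu2 D w zeta gam (f \o toC) = a.
Proof.
move=> paf Lf; apply/funext => n; rewrite /pcoef (bergman_inner halpha n paf Lf).
by rewrite mulrA -rmorphM /= mulVf ?gt_eqF // mul1r.
Qed.

Lemma pser_bessel a f N : pser a f -> L2 mu2 D w (f \o toC) ->
  \sum_(n < N) gam n * sqn (a n) <= nrm2 mu2 D w (f \o toC).
Proof.
by move=> paf Lf; have := bessel mD mw w0 mzeta zeta1 L1 gam0 ip N Lf; rewrite (pcoef_pser paf Lf).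
Qed.

(** The squared distance is the defect in Bessel's inequality. Were it to stay above some [e], then
    [pser_L2] applied with the bound lowered by [e] would make the squared norm of [f] smaller than
    itself. *)
Lemma bergman_approx a f : pser a f -> L2 mu2 D w (f \o toC) ->
  nrm2 mu2 D w (ppoly zeta a N \- (f \o toC)) @[N --> \oo] --> (0 : R).
Proof.
move=> paf Lf; set s := (fun N => \sum_(n < N) gam n * sqn (a n)).
have sE N : nrm2 mu2 D w (ppoly zeta a N \- (f \o toC)) = nrm2 mu2 D w (f \o toC) - s N.
  have := nrm2_sub_proj mD mw w0 mzeta zeta1 L1 gam0 ip N Lf; rewrite (pcoef_pser paf Lf) => <-.
  by apply: eq_Rintegral => p _ /=; rewrite -[in LHS]sqnN opprB.
under eq_fun do rewrite sE.
have t0 n : 0 <= gam n * sqn (a n) by rewrite mulr_ge0 ?sqn_ge0 ?(ltW (gam0 n)).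
have smono N M : (N <= M)%N -> s N <= s M.
  move=> NM; rewrite /s -!(big_mkord xpredT (fun n => gam n * sqn (a n))).
  by rewrite [leRHS](@big_cat_nat _ _ _ N) //= lerDl sumr_ge0.
have sle N : s N <= nrm2 mu2 D w (f \o toC) by exact: pser_bessel.
apply/cvg0P => [N|e e0]; first by rewrite subr_ge0.
apply: contrapT => no.
have sB N : s N <= nrm2 mu2 D w (f \o toC) - e.
  rewrite leNgt; apply/negP => lt; apply: no; exists N => n Nn.
  by rewrite lerBlDl -lerBlDr; exact: le_trans (ltW lt) (smono _ _ Nn).
by have [_] := pser_L2 paf sB; rewrite leNgt ltrBlDl ltrDr e0.
Qed.

End BergmanHankel.

(** * Growth of the weights and the Dirichlet integral *)

Section BergmanWeights.
Context {R : realType}.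
Implicit Types (alpha r : R) (a b c : nat -> CC R).

Lemma bgam_le1 alpha n : -1 <= alpha -> bgam alpha n <= 1.
Proof.
move=> ha; elim: n => [|n IH]; first exact: lexx.
have n0 : (0 : R) <= n%:R by [].
have p : 0 < n%:R + alpha + 2 by lra.
rewrite -(ler_pM2r p) bgam_rec // mul1r; apply: le_trans (ler_wpM2l (ler0n _ _) IH) _.
by rewrite mulr1 -[n.+1%:R]natr1; lra.
Qed.

Lemma bgam0E n : bgam (0 : R) n = n.+1%:R^-1.
Proof.
elim: n => [|n IH]; first by rewrite invr1.
have p : 0 < n%:R + 0 + 2 :> R by rewrite addr0 ltr_wpDl.
apply: (mulIf (lt0r_neq0 p)); rewrite bgam_rec ?lerN10 // IH mulfV ?pnatr_eq0 //.
by rewrite addr0 -natrD addn2 mulVf // pnatr_eq0.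
Qed.

(** The ratios of consecutive weights tend to 1, so [r^n / bgam alpha n] eventually decreases and is
    bounded. Thus coefficients bounded only after multiplication by the weights still define a
    function on the disc. *)
Lemma subexp_bgamV alpha (C : R) c : -1 <= alpha ->
  (forall n, normc (c n) * bgam alpha n <= C) -> subexp c.
Proof.
move=> ha hc r /andP[r0 r1].
have g0 n : 0 < bgam alpha n := bgam_gt0 n ha.
pose x n := r ^+ n / bgam alpha n.
have x0 n : 0 <= x n by rewrite divr_ge0 ?exprn_ge0 ?(ltW (g0 n)).
have [N hN] : exists N, forall n, (N <= n)%N -> r * (n%:R + alpha + 2) <= n.+1%:R.
  have q : 0 < 1 - r by rewrite subr_gt0.
  have alg (k A : R) : A <= k * (1 - r) -> 0 <= (1 - r) * A -> r * (k + A) <= k + 1 by nra.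
  exists (Num.trunc ((alpha + 2) / (1 - r))).+1 => n hn.
  have : (alpha + 2) / (1 - r) <= n%:R.
    by apply: ltW; apply: lt_le_trans (truncnS_gt _) _; rewrite ler_nat.
  rewrite ler_pdivrMr // -[n.+1%:R]natr1; have a2 : 0 <= (1 - r) * (alpha + 2).
    by rewrite mulr_ge0 ?(ltW q) //; lra.
  by move: (n%:R : R) => k h; rewrite -addrA; exact: alg h a2.
have dec n : (N <= n)%N -> x n.+1 <= x n.
  move=> /hN h; rewrite /x; have p : 0 < n.+1%:R :> R by [].
  have e := bgam_rec n ha.
  rewrite ler_pdivrMr // mulrAC ler_pdivlMr // exprSr -mulrA [leRHS]mulrC [leRHS]mulrC.
  rewrite ler_wpM2l ?exprn_ge0 //.
  have q : 0 < n%:R + alpha + 2 by have : (0 : R) <= n%:R by []; lra.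
  rewrite -(ler_pM2r q) e mulrAC ler_wpM2r //; exact: ltW.
have xB n : x n <= \sum_(k < N.+1) x k.
  have le k : (k < N.+1)%N -> x k <= \sum_(k < N.+1) x k.
    by move=> kN; rewrite (bigD1 (Ordinal kN)) //= lerDl sumr_ge0.
  elim: n => [|n IH]; first exact: le.
  by have [lt|ge] := ltnP n N; [exact: le|exact: le_trans (dec n ge) IH].
have C0 : 0 <= C by apply: le_trans (hc 0%N); rewrite mulr_ge0 ?normc_ge0 ?(ltW (g0 _)).
exists (C * \sum_(k < N.+1) x k) => n.
have -> : normc (c n) * r ^+ n = normc (c n) * bgam alpha n * x n.
  by rewrite /x; have := lt0r_neq0 (g0 n); move: (bgam alpha n) => g gn; field.
by apply: ler_pM => //; rewrite mulr_ge0 ?normc_ge0 ?(ltW (g0 _)).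
Qed.

(** The weight of [z^n] in A^2 is [1 / (n + 1)] and the derivative brings [(n + 1)^2]; together they
    put the weight [m] on the coefficient of index [m = n + 1]. *)
Lemma dirichlet_coefs b (psi : CC R -> CC R) K : pser b psi ->
  L2 (@plane_mu R) (@disc R) (dA 0) (derive1 psi \o toC) ->
  \sum_(m < K) m%:R * sqn (b m) <= nrm2 (@plane_mu R) (@disc R) (dA 0) (derive1 psi \o toC).
Proof.
move=> pb Lp; case: K => [|K].
  by rewrite big_ord0; apply: nrm2_ge0 => p _; apply: dA_ge0; exact: ltrN10.
apply: le_trans (pser_bessel (ltrN10 R) K (pser_derive1 pb) Lp).
rewrite big_ord_recl mul0r add0r; apply: ler_sum => n _.
rewrite lift0 /dcoef bgam0E sqnM (_ : sqn n.+1%:R = n.+1%:R ^+ 2); last first.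
  by rewrite -(rmorph_nat (real_complex R)) sqnR.
by rewrite expr2 !mulrA mulVf ?mul1r // pnatr_eq0.
Qed.

End BergmanWeights.

Section ComplexLimits.
Context {R : realType}.
Implicit Types (x y : nat -> CC R) (s t : CC R).

Lemma normc_cvgM x y s t : normc (x n - s) @[n --> \oo] --> (0 : R) ->
  normc (y n - t) @[n --> \oo] --> (0 : R) ->
  normc (x n * y n - s * t) @[n --> \oo] --> (0 : R).
Proof.
move=> hx hy; apply: (@cvg0_squeeze _ _ (fun n => normc (x n - s) * normc (y n - t) +
  normc (x n - s) * normc t + normc s * normc (y n - t))).
- by move=> n; exact: normc_ge0.
- move=> n; rewrite -!ComplexField.Normc.normcM.
  have -> : x n * y n - s * t = (x n - s) * (y n - t) + (x n - s) * t + s * (y n - t) by ring.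
  by apply: le_trans (le_normcD _ _) _; rewrite lerD // le_normcD.
- have cst (k : R) : (fun=> k) @ \oo --> k by exact: cvg_cst.
  have hh := cvgD (cvgD (cvgM hx hy) (cvgM hx (cst (normc t)))) (cvgM (cst (normc s)) hy).
  rewrite !mul0r mulr0 !addr0 in hh; exact: hh.
Qed.

Lemma normc_cvgJ x s : normc (x n - s) @[n --> \oo] --> (0 : R) ->
  normc ((x n)^* - s^*) @[n --> \oo] --> (0 : R).
Proof. by under [in X in _ -> X]eq_fun do rewrite -rmorphB /= normc_conj. Qed.

End ComplexLimits.

Section MoveSymbol.
Context {R : realType} {d : measure_display} {T : measurableType d}.
Variables (mu : {measure set T -> \bar R}) (D : set T) (w : T -> R).
Implicit Types (f psi z : T -> CC R).

(** Moves the symbol to the other factor, so that a coefficient of the product becomes a pairing of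
    two functions whose truncations converge in norm. *)
Lemma inner_symbol f psi z :
  L2inner mu D w (fun x => (psi x)^* * f x) z = L2inner mu D w f (fun x => psi x * z x).
Proof.
rewrite !innerE; apply: eq_cint => x _; rewrite /wprod rmorphM /=.
by move: ((psi x)^*) ((z x)^*) (f x) ((w x)%:C) => P Z F W; ring.
Qed.

End MoveSymbol.

Section BergmanHankelBound.
Context {R : realType}.
Local Notation mR := (measurableTypeR R).
Local Notation mu2 := (@plane_mu R).
Variable alpha : R.
Hypothesis halpha : -1 < alpha.
Local Notation D := (@disc R : set (mR * mR)).
Local Notation w := (@dA R alpha : mR * mR -> mR).
Local Notation zeta := (@toC R : mR * mR -> CC R).
Local Notation gam := (bgam alpha).
Let mD : measurable D := @measurable_disc R.
Let mw : measurable_fun D w := @measurable_dA_disc R alpha.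
Let w0 (p : mR * mR) (_ : D p) : 0 <= w p := dA_ge0 halpha p.
Let mzeta : cmeas D zeta := cmeas_toC D.
Let zeta1 := @sqn_toC_le R.
Let L1 := L2_disc_one halpha.
Let gam0 n : 0 < gam n := bgam_gt0 n (ltW halpha).
Let ip := inner_disc halpha.
Let Lz n : L2 mu2 D w (fun p => zeta p ^+ n) := L2_disc_power halpha n.
Local Notation inner := (L2inner mu2 D w).
Local Notation nrm2 := (nrm2 mu2 D w).
Implicit Types (a b : nat -> CC R) (f psi : CC R -> CC R).

Lemma bergman_orthogonal (q h : mR * mR -> CC R) : L2 mu2 D w q ->
  (forall k, inner q (fun p => zeta p ^+ k) = 0) -> bergman alpha h -> inner q h = 0.
Proof.
move=> Lq q0 /bergmanP[f [a [-> paf Lf]]].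
apply: (inner_limit0 mD mw w0 Lq Lf (G := ppoly zeta a)).
- by move=> n; exact: L2_ppoly.
- move=> n; rewrite (inner_ppolyr mD mw w0 mzeta zeta1 L1 _ _ Lq) big1 // => k _.
  by rewrite q0 mulr0.
- exact: bergman_approx.
Qed.

Lemma nrm2_mul_power u k : L2 mu2 D w u -> nrm2 (fun p => u p * zeta p ^+ k) <= nrm2 u.
Proof.
move=> Lu; have Lzu := L2_mul_power mD mw w0 mzeta zeta1 k Lu.
have Luz : L2 mu2 D w (fun p => u p * zeta p ^+ k).
  by apply: L2_eq Lzu => // x _; rewrite mulrC.
apply: le_Rintegral => //.
- by have /(L2P _ mw w0)[] := Luz.
- by have /(L2P _ mw w0)[] := Lu.
move=> x Dx; rewrite ler_wpM2l ?w0 // sqnM sqnX ler_piMr ?sqn_ge0 //.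
by rewrite exprn_ile1 ?sqn_ge0 // zeta1.
Qed.

Lemma L2_power_mul u k : L2 mu2 D w u -> L2 mu2 D w (fun p => u p * zeta p ^+ k).
Proof.
move=> Lu; have Lzu := L2_mul_power mD mw w0 mzeta zeta1 k Lu.
by apply: L2_eq Lzu => // x _; rewrite mulrC.
Qed.

(* The projections of the truncated products converge pointwise by Tannery's theorem,
   which is all that Fatou's lemma needs to pass to the limit in the finite inequality. *)
Lemma bergman_hankel a b f psi (E : R) : pser a f -> L2 mu2 D w (f \o toC) ->
  pser b psi -> L2 mu2 D w (psi \o toC) ->
  L2 mu2 D w (fun p => (psi (toC p))^* * f (toC p)) ->
  (forall K, \sum_(m < K) m%:R * sqn (b m) <= E) ->
  exists2 g, is_orthproj mu2 D w (bergman alpha) (fun p => (psi (toC p))^* * f (toC p)) g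
   & nrm2 ((fun p => (psi (toC p))^* * f (toC p)) \- g) <= nrm2 (f \o toC) * E / (2 + alpha).
Proof.
move=> paf Lf pb Lpsi; set u := (fun p => _) => Lu hE.
have E0 : 0 <= E by have := hE 0%N; rewrite big_ord0.
have a2 : 0 < 2 + alpha by have := halpha; lra.
pose K := Num.sqrt (nrm2 (f \o toC)) * Num.sqrt (nrm2 (psi \o toC)).
pose L M k := inner (cprod zeta a b M) (fun p => zeta p ^+ k).
have La N : L2 mu2 D w (ppoly zeta a N) by exact: L2_ppoly.
have Lb N : L2 mu2 D w (ppoly zeta b N) by exact: L2_ppoly.
have LM M k : L M k = inner (ppoly zeta a M) (fun p => ppoly zeta b M p * zeta p ^+ k).
  exact: inner_symbol.
have Lu' k : inner u (fun p => zeta p ^+ k) = inner (f \o toC) (fun p => psi (toC p) * zeta p ^+ k).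
  exact: inner_symbol.
(* A bound uniform in the truncation [M]: it passes to the coefficients of [u] and provides the
   majorant for Tannery's theorem. *)
have LK M k : normc (L M k) <= K.
  rewrite LM; apply: le_trans (normc_inner_le mD mw w0 (La M) (L2_power_mul k (Lb M))) _.
  apply: ler_pM; rewrite ?sqrtr_ge0 // ler_wsqrtr //.
    by rewrite (nrm2_ppoly mD mw w0 mzeta zeta1 L1 ip); exact: pser_bessel.
  apply: le_trans (nrm2_mul_power k (Lb M)) _.
  by rewrite (nrm2_ppoly mD mw w0 mzeta zeta1 L1 ip); exact: pser_bessel.
have cL k : normc (L M k - inner u (fun p => zeta p ^+ k)) @[M --> \oo] --> (0 : R).
  under eq_fun do rewrite LM Lu'.
  apply: (inner_cvg mD mw w0 La (fun M => L2_power_mul k (Lb M)) Lf (L2_power_mul k Lpsi)).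
    exact: bergman_approx.
  apply: (cvg0_squeeze _ _ (bergman_approx halpha pb Lpsi)) => M; first exact: nrm2_ge0.
  have -> : (fun p => ppoly zeta b M p * zeta p ^+ k) \- (fun p => psi (toC p) * zeta p ^+ k) =
      fun p => (ppoly zeta b M \- (psi \o toC)) p * zeta p ^+ k.
    by apply/funext => p /=; rewrite mulrBl.
  by apply: nrm2_mul_power; exact: L2B.
have [c uE] : exists c : nat -> CC R, forall k,
    inner u (fun p => zeta p ^+ k) = (gam k)%:C * c k.
  by exists (pcoef mu2 D w zeta gam u) => k; rewrite -pcoefE.
have cK k : normc (c k) * gam k <= K.
  have -> : normc (c k) * gam k = normc (inner u (fun p => zeta p ^+ k)).
    by rewrite uE ComplexField.Normc.normcM normcR (ger0_norm (ltW (gam0 k))) mulrC.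
  by apply: (normc_lim_le (cL k)); exists 0%N.
(* The candidate projection, so far only a convergent power series; that it lies in [L2] follows
   from Fatou's lemma below. *)
have [g pg] := subexp_pser (subexp_bgamV (ltW halpha) cK).
have L_u N : L2 mu2 D w (cprod zeta a b N) by exact: L2_cprod.
have L_h N : L2 mu2 D w (cprod_proj mu2 D w zeta gam a b N) by exact: L2_ppoly.
have cg : cmeas D (g \o toC) := cmeas_pser halpha pg.
have cu : cmeas D u := L2_cmeas mw w0 Lu.
pose B := nrm2 (f \o toC) * E / (2 + alpha).
have [Lq qB] : L2 mu2 D w (u \- (g \o toC)) /\ nrm2 (u \- (g \o toC)) <= B.
  apply: (L2_fatou mD mw w0
    (F := fun M => cprod zeta a b M \- cprod_proj mu2 D w zeta gam a b M)).
  - by move=> M; apply: (L2_cmeas mw w0 (mu := mu2)); exact: L2B.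
  - exact: cmeasB.
  - move=> M; split; first exact: L2B.
    have := nrm2_hankel_ppoly mD mw w0 mzeta zeta1 L1 gam0 ip a b M (ltW halpha)
      (fun n => bgam_rec n (ltW halpha)).
    move=> /le_trans; apply; rewrite /B ler_wpM2r ?invr_ge0 ?(ltW a2) //.
    apply: ler_pM => //; last exact: pser_bessel.
      by apply: sumr_ge0 => n _; rewrite mulr_ge0 ?sqn_ge0 ?(ltW (gam0 n)).
    by apply: sumr_ge0 => n _; rewrite mulr_ge0 ?sqn_ge0.
  move=> p Dp; apply: normc_sqn_cvg0.
  have z1 := disc_normc Dp.
  have cA := paf _ z1; have cB := pb _ z1; have cG := pg _ z1.
  have cU : normc (cprod zeta a b M p - u p) @[M --> \oo] --> (0 : R).
    exact: normc_cvgM (normc_cvgJ cB) cA.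
  (* Both the coefficients and the length of this sum vary with [M]; the majorant
     [K / gam k * |z|^k] is summable because the weights decay subexponentially. *)
  have cH : normc (cprod_proj mu2 D w zeta gam a b M p - g (toC p)) @[M --> \oo] --> (0 : R).
    have K0 : 0 <= K by rewrite mulr_ge0 ?sqrtr_ge0.
    have sK : subexp (fun n => (K / gam n)%:C).
      apply: (subexp_bgamV (C := K) (ltW halpha)) => n.
      by rewrite normcR ger0_norm ?divfK ?gt_eqF ?divr_ge0 ?(ltW (gam0 n)).
    have z01 : 0 <= normc (toC p) < 1 by rewrite normc_ge0.
    have [B' hB'] := subexp_abs sK z01.
    pose X M k : CC R := ((gam k)^-1)%:C * L M k * toC p ^+ k.
    have XB M k : normc (X M k) <= normc (K / gam k)%:C * normc (toC p) ^+ k.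
      rewrite /X !ComplexField.Normc.normcM normcX ler_wpM2r ?exprn_ge0 ?normc_ge0 //.
      rewrite !normcR ger0_norm ?invr_ge0 ?(ltW (gam0 k)) // mulrC.
      rewrite ger0_norm ?divr_ge0 ?(ltW (gam0 k)) //.
      by rewrite ler_wpM2r ?invr_ge0 ?(ltW (gam0 k)).
    have cX k : normc (X M k - c k * toC p ^+ k) @[M --> \oo] --> (0 : R).
      have cst (y : CC R) : normc (y - y) @[_ --> \oo] --> (0 : R).
        by rewrite subrr ComplexField.Normc.normc0; exact: cvg_cst.
      have := normc_cvgM (normc_cvgM (cst ((gam k)^-1)%:C) (cL k)) (cst (toC p ^+ k)).
      by rewrite uE [_%:C * (_ * c k)]mulrA -rmorphM /= mulVf ?gt_eqF // mul1r.
    have cT := tannery XB hB' cX.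
    have hh := cvgD cT cG; rewrite addr0 in hh.
    apply: (@cvg0_squeeze _ _ (fun M => normc (\sum_(k < M) X M k - \sum_(k < M) c k * toC p ^+ k) +
      normc (psum c M (toC p) - g (toC p)))); [by move=> M; exact: normc_ge0|move=> M|exact: hh].
    have -> : cprod_proj mu2 D w zeta gam a b M p - g (toC p) =
        (\sum_(k < M) X M k - \sum_(k < M) c k * toC p ^+ k) + (psum c M (toC p) - g (toC p)).
      by rewrite [RHS]addrA subrK.
    exact: le_normcD.
  apply: (@cvg0_squeeze _ _ (fun M => normc (cprod zeta a b M p - u p) +
     normc (cprod_proj mu2 D w zeta gam a b M p - g (toC p)))).
  - by move=> M; exact: normc_ge0.
  - move=> M /=; rewrite (_ : forall x y z t : CC R, x - y - (z - t) = (x - z) - (y - t)).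
      by apply: le_trans (le_normcD _ _) _; rewrite normcN.
    by move=> *; ring.
  - have hh := cvgD cU cH; rewrite addr0 in hh; exact: hh.
(* Fatou's lemma has put [u - g] in [L2], and [u] is there by hypothesis. *)
have Lg : L2 mu2 D w (g \o toC).
  have h := L2B mD mw w0 Lu Lq.
  by apply: (L2_eq mD mw w0 _ h) => p _ /=; rewrite opprB addrC subrK.
exists (g \o toC) => //; split.
  split => //; have -> : (g \o toC) \o ofC = g by apply/funext => z /=; rewrite ofCK.
  exact: pser_holomorphic pg.
move=> h Hh; apply: (bergman_orthogonal Lq _ Hh) => k.
by rewrite (innerBl mD mw w0 Lu Lg (Lz k)) uE (bergman_inner halpha k pg Lg) subrr.
Qed.

End BergmanHankelBound.

(** * The Hardy case *)

Section RieszFischer.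
Context {R : realType} {d : measure_display} {T : measurableType d}.
Variables (mu : {measure set T -> \bar R}) (D : set T) (w : T -> R).
Hypothesis mD : measurable D.
Hypothesis mw : measurable_fun D w.
Hypothesis w0 : forall x, D x -> 0 <= w x.
Hypothesis wpos : forall x, D x -> 0 < w x.
Hypothesis L1 : L2 mu D w (fun=> 1).
Local Notation L2 := (L2 mu D w).
Local Notation inner := (L2inner mu D w).
Local Notation nrm2 := (nrm2 mu D w).
Variable F : nat -> T -> CC R.
Hypothesis LF : forall k, L2 (F k).
Hypothesis geoF : forall k, Num.sqrt (nrm2 (F k.+1 \- F k)) <= 2^-1 ^+ k.

Let delta k x := normc (F k.+1 x - F k x).

Let sum_half k m : \sum_(k <= i < k + m) (2^-1 : R) ^+ i <= 2 * 2^-1 ^+ k.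
Proof.
suff -> : \sum_(k <= i < k + m) (2^-1 : R) ^+ i = 2 * 2^-1 ^+ k - 2 * 2^-1 ^+ (k + m).
  by rewrite gerBl mulr_ge0 // exprn_ge0.
elim: m => [|m IH]; first by rewrite addn0 big_geq // subrr.
rewrite addnS big_nat_recr ?leq_addr //= IH exprS.
by move: ((2^-1 : R) ^+ k) ((2^-1 : R) ^+ (k + m)) => A B; field.
Qed.

Let tele k m : Num.sqrt (nrm2 (F (k + m)%N \- F k)) <= 2 * 2^-1 ^+ k.
Proof.
apply: le_trans (sum_half k m); elim: m => [|m IH].
  by rewrite addn0 big_geq // nrm2_subxx sqrtr0.
rewrite addnS big_nat_recr ?leq_addr //=.
have -> : F (k + m).+1 \- F k = (F (k + m)%N \- F k) \+ (F (k + m).+1 \- F (k + m)%N).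
  by apply/funext => x /=; ring.
apply: le_trans (nrm2_sqrtD mD mw w0 _ _) _; try exact: L2B.
by apply: lerD.
Qed.

Let mdelta k : measurable_fun D (delta k).
Proof. by apply: cmeas_normc; apply: (L2_cmeas mw w0 (mu := mu)); exact: L2B. Qed.

Let delta0 k x : 0 <= delta k x. Proof. exact: normc_ge0. Qed.

(** The weight sits inside the sum, so that a finite integral against [mu] makes [S] finite almost
    everywhere; where [w] is positive, [F k x] then has summable increments. *)
Let S x : \bar R := (\sum_(0 <= k <oo) (w x * delta k x)%:E)%E.

Let wd0 k x : D x -> (0 <= (w x * delta k x)%:E)%E.
Proof. by move=> Dx; rewrite lee_fin mulr_ge0 ?w0. Qed.

Let mwd k : measurable_fun D (fun x => (w x * delta k x)%:E).
Proof. by apply/measurable_EFinP; apply: measurable_funM. Qed.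

Let Ldelta k : L2 (fun x => (delta k x)%:C).
Proof.
apply/(L2P _ mw w0); split; first exact/cmeasR.
have /(L2P _ mw w0)[_] : L2 (F k.+1 \- F k) by exact: L2B.
rewrite (_ : (EFin \o _) = (EFin \o (fun x => w x * sqn ((delta k x)%:C : CC R)))) //.
by apply/funext => x /=; rewrite sqnR /delta sqr_normc_sqn.
Qed.

(** Cauchy-Schwarz against the constant 1, whose norm is finite by [L1]. *)
Let int_delta k : (\int[mu]_(x in D) (w x * delta k x)%:E <=
  (2^-1 ^+ k * Num.sqrt (nrm2 (fun=> 1%R)))%:E)%E.
Proof.
have Ld := Ldelta k.
have [i1 _] := wprod_cint mD mw w0 Ld L1.
have e x : Re (wprod w (fun x => (delta k x)%:C) (fun=> 1) x) = w x * delta k x.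
  by rewrite /wprod !partsE; ring.
have i : mu.-integrable D (fun x => (w x * delta k x)%:E).
  by apply: eq_integrable i1 => // x _; rewrite e.
have -> : (\int[mu]_(x in D) (w x * delta k x)%:E = (Re (inner (fun x => (delta k x)%:C) (fun=> 1)))%:E)%E.
  rewrite innerE /cint -[Re _]/(\int[mu]_(x in D) Re (wprod w (fun x => (delta k x)%:C) (fun=> 1) x)).
  rewrite /Rintegral; under [in RHS]eq_integral do rewrite e.
  by rewrite fineK //; exact: integrable_fin_num.
rewrite lee_fin; apply: le_trans (ler_norm _) _; apply: le_trans (Re_le_normc _) _.
apply: le_trans (normc_inner_le mD mw w0 Ld L1) _; rewrite ler_wpM2r ?sqrtr_ge0 //.
suff -> : nrm2 (fun x => (delta k x)%:C) = nrm2 (F k.+1 \- F k) by [].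
by apply: eq_Rintegral => x _; rewrite sqnR /delta sqr_normc_sqn.
Qed.

Let S_fin : \forall x \ae mu, D x -> S x \is a fin_num.
Proof.
have mS : measurable_fun D S.
  by apply: ge0_emeasurable_sum => // k x Dx _; exact: wd0.
apply: integrable_ae => //; apply/integrableP; split => //.
have -> : (\int[mu]_(x in D) `|S x| = \int[mu]_(x in D) S x)%E.
  apply: eq_integral => x /set_mem Dx; rewrite gee0_abs // /S.
  by apply: nneseries_ge0 => k _ _; exact: wd0.
rewrite integral_nneseries //.
pose C := Num.sqrt (nrm2 (fun=> 1)).
apply: (@le_lt_trans _ _ (2 * C)%:E); last exact: ltry.
apply: lime_le.
  by apply: is_cvg_nneseries => k _ _; apply: integral_ge0 => x Dx; exact: wd0.
apply: nearW => n; apply: (@le_trans _ _ (\sum_(0 <= k < n) (2^-1 ^+ k * C)%:E)%E).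
  by apply: lee_sum => k _; exact: int_delta.
rewrite sumEFin lee_fin -mulr_suml ler_wpM2r ?sqrtr_ge0 //.
by have := sum_half 0 n; rewrite add0n expr0 mulr1.
Qed.

Let good := D `&` [set x | (S x < +oo)%E].

Let mgood : measurable good.
Proof.
have mS : measurable_fun D S.
  by apply: ge0_emeasurable_sum => // k x Dx _; exact: wd0.
rewrite /good (_ : [set x | _] = S @^-1` [set y | (y < +oo)%E]) //.
by apply: mS => //; rewrite -set_itvNyo; exact: emeasurable_itv.
Qed.

Let good_bound x : good x -> exists B, forall N, \sum_(k < N) delta k x <= B.
Proof.
case=> Dx /= Sx; exists (fine (S x) / w x) => N.
have w1 := wpos Dx; rewrite ler_pdivlMr // mulrC mulr_sumr.
have S0 : (0 <= S x)%E by apply: nneseries_ge0 => k _ _; exact: wd0.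
rewrite -lee_fin fineK ?ge0_fin_numE //.
have := @nneseries_lim_ge R (fun k => (w x * delta k x)%:E) xpredT 0 N (fun k _ _ => wd0 k Dx).
by rewrite sumEFin big_mkord.
Qed.

(** Cutting off outside the good set makes the limit exist everywhere, at the price of a change on a
    null set of [D]. *)
Let F' k x : CC R := (\1_good x)%:C * F k x.

Let LF' k : L2 (F' k).
Proof.
apply: (L2_bounded mD mw w0 (C := 1)) => //.
  by apply: cmeasR; apply: measurable_funTS; exact: measurable_indic.
by move=> x _; rewrite sqnR indicE; case: (_ \in _); rewrite /= ?expr1n ?expr0n.
Qed.

Lemma L2_complete : exists2 g, L2 g & nrm2 (F k \- g) @[k --> \oo] --> (0 : R).
Proof.
have ex x : exists s : CC R, normc (F' k x - s) @[k --> \oo] --> (0 : R).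
  have [gx|gx] := pselect (good x).
    have [B hB] := good_bound gx.
    have [s hs] := @abs_summable_cvg _ (fun k => F k.+1 x - F k x) B hB; exists (F 0%N x + s).
    rewrite (_ : (fun k => _) = fun N => normc (\sum_(n < N) (F n.+1 x - F n x) - s)) //.
    apply/funext => N; rewrite /F' indicE mem_set // mul1r; congr normc.
    have -> : \sum_(n < N) (F n.+1 x - F n x) = F N x - F 0%N x.
      by rewrite -(big_mkord xpredT (fun n => F n.+1 x - F n x)) telescope_sumr.
    ring.
  exists 0; under eq_fun do rewrite /F' indicE memNset // mul0r subr0 ComplexField.Normc.normc0.
  exact: cvg_cst.
have [g hg] := choice ex.
have cg : cmeas D g.
  by apply: (cmeas_lim mD (F := F')) => // k; exact: (L2_cmeas mw w0 (LF' k)).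
(* Fatou's lemma in the second index turns the geometric bounds on differences into a distance to
   the pointwise limit. *)
have key k : L2 (F' k \- g) /\ nrm2 (F' k \- g) <= (2 * 2^-1 ^+ k) ^+ 2.
  apply: (L2_fatou mD mw w0 (F := fun m => F' k \- F' (k + m)%N)).
  - by move=> m; apply: (L2_cmeas mw w0 (mu := mu)); exact: L2B.
  - by apply: cmeasB => //; exact: (L2_cmeas mw w0 (LF' k)).
  - move=> m; split; first exact: L2B.
    apply: (@le_trans _ _ (nrm2 (F (k + m)%N \- F k))).
      have LL : L2 (F (k + m)%N \- F k) by exact: L2B.
      have LL' : L2 (F' k \- F' (k + m)%N) by exact: L2B.
      apply: le_Rintegral => //.
      + by have /(L2P _ mw w0)[] := LL'.
      + by have /(L2P _ mw w0)[] := LL.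
      move=> x Dx; rewrite ler_wpM2l ?w0 // /F' /= -mulrBr sqnM sqnR indicE.
      rewrite (_ : sqn (F k x - F (k + m)%N x) = sqn (F (k + m)%N x - F k x)); last first.
        by rewrite -!sqr_normc_sqn normcB.
      by case: (_ \in _); rewrite /= ?expr1n ?mul1r // expr0n mul0r sqn_ge0.
    rewrite -[leLHS]sqr_sqrtr ?nrm2_ge0 //; apply: lerXn2r; rewrite ?nnegrE ?sqrtr_ge0 //;
      first [exact: tele|by rewrite mulr_ge0 ?exprn_ge0].
  - move=> x Dx; apply: normc_sqn_cvg0.
    have hx := hg x; move/(cvg0P (fun k => normc_ge0 _)) : hx => hx.
    apply/cvg0P => [m|e e0]; first exact: normc_ge0.
    have [N hN] := hx e e0; exists N => m Nm; have := hN (k + m)%N (leq_trans Nm (leq_addl _ _)).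
    have -> : (F' k \- F' (k + m)%N) x - (F' k \- g) x = - (F' (k + m)%N x - g x).
      have alg (p q t : CC R) : (p - q) - (p - t) = - (q - t) by ring.
      exact: alg.
    by rewrite normcN.
have Lg : L2 g.
  have [h _] := key 0%N; have h2 := L2B mD mw w0 (LF' 0%N) h.
  by apply: (L2_eq mD mw w0 _ h2) => x _ /=; rewrite opprB addrC subrK.
exists g => //.
have nE k : nrm2 (F k \- g) = nrm2 (F' k \- g).
  apply: (congr1 (@fine R)); apply: ae_eq_integral => //.
  - by apply: wsqn_meas => //; apply: (L2_cmeas mw w0 (mu := mu)); exact: L2B.
  - by apply: wsqn_meas => //; apply: (L2_cmeas mw w0 (mu := mu)); exact: L2B.
  apply: filterS S_fin => x fin Dx; rewrite /F' /= indicE mem_set ?mul1r //.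
  by split => //=; rewrite ltey_eq fin.
under eq_fun do rewrite nE.
apply: (@cvg0_squeeze _ _ (fun k => (2 * 2^-1 ^+ k) ^+ 2)).
- by move=> k; exact: nrm2_ge0.
- by move=> k; have [] := key k.
have h : 2 * (2^-1 : R) ^+ k @[k --> \oo] --> (2 * 0 : R).
  by apply: cvgMl_tmp; apply: cvg_expr; rewrite ger0_norm // invf_lt1 // ltr1n.
have hh := cvgM h h; rewrite mulr0 mulr0 in hh; exact: hh.
Qed.

End RieszFischer.

(** * Uniqueness of power series coefficients *)

Section PserUnique.
Context {R : realType}.
Implicit Types (a b : nat -> CC R) (f : CC R -> CC R).

(* Rescaled to a smaller disc the function lies in A^2, where the coefficients are
   inner products with monomials. *)
Lemma pser_unique a b f : pser a f -> pser b f -> a = b.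
Proof.
move=> pa pb; have h0 : -1 < (0 : R) := ltrN10 R.
pose s : R := 2^-1.
have s0 : 0 < s by rewrite invr_gt0.
have s1 : 0 <= s < 1 by rewrite (ltW s0) invf_lt1 // ltr1n.
have scale c : pser c f -> pser (fun n => c n * s%:C ^+ n) (fun z => f (s%:C * z)).
  move=> pc z z1; have sz : normc (s%:C * z) < 1.
    have /andP[_ s2] := s1.
    rewrite ComplexField.Normc.normcM normcR ger0_norm ?(ltW s0) //.
    by apply: le_lt_trans s2; rewrite ler_piMr ?(ltW s0) // ltW.
  have := pc _ sz; rewrite /psum.
  have e N : \sum_(n < N) c n * (s%:C * z) ^+ n = \sum_(n < N) c n * s%:C ^+ n * z ^+ n.
    by apply: eq_bigr => n _; rewrite exprMn mulrA.
  by under eq_fun do rewrite e.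
have Lf : L2 (@plane_mu R) (@disc R) (dA 0) ((fun z => f (s%:C * z)) \o toC).
  have sa := pser_subexp pa; have [C hC] := sa s s1; have [B hB] := subexp_abs sa s1.
  suff hs : forall N, \sum_(n < N) bgam 0 n * sqn (a n * s%:C ^+ n) <= C * B.
    by have [] := pser_L2 h0 (scale a pa) hs.
  have C0 : 0 <= C by apply: le_trans (hC 0%N); rewrite mulr_ge0 ?normc_ge0.
  move=> N; apply: le_trans (ler_wpM2l C0 (hB N)); rewrite mulr_sumr.
  apply: ler_sum => n _; rewrite -sqr_normc_sqn ComplexField.Normc.normcM normcX normcR.
  rewrite (ger0_norm (ltW s0)); have n0 : 0 <= normc (a n) * s ^+ n by rewrite mulr_ge0 ?normc_ge0 ?exprn_ge0 ?(ltW s0).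
  have g1 := bgam_le1 n (ltW h0); have g0 := ltW (bgam_gt0 n (ltW h0)).
  rewrite expr2 [leLHS]mulrA; apply: ler_wpM2r => //.
  by apply: le_trans (ler_wpM2r n0 g1) _; rewrite mul1r.
apply/funext => n.
have := bergman_inner h0 n (scale a pa) Lf; rewrite (bergman_inner h0 n (scale b pb) Lf).
have gn : (bgam 0 n)%:C != 0 :> CC R.
  by apply/eqP => /(congr1 (@complex.Re R)) /= /eqP; rewrite gt_eqF // bgam_gt0 // ltW.
have sn : s%:C ^+ n != 0 :> CC R.
  rewrite expf_neq0 //; apply/eqP => /(congr1 (@complex.Re R)) /= /eqP; by rewrite gt_eqF.
by move=> /(mulfI gn)/(mulIf sn).
Qed.

End PserUnique.

(** * Square-summable coefficients of Hardy functions *)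

Section HardyBoundary.
Context {R : realType}.
Local Notation leb := (@lebesgue_measure R).
Local Notation L2c := (L2 leb (@angles R) (@dtheta R)).
Local Notation innerc := (L2inner leb (@angles R) (@dtheta R)).
Local Notation nrm2c := (nrm2 leb (@angles R) (@dtheta R)).
Local Notation circ := (@circle R).
Implicit Types (a b : nat -> CC R) (f psi : CC R -> CC R) (u v : R -> CC R).

Lemma nrm2c_sup u (e : R) : L2c u -> (forall t, normc (u t) <= e) -> nrm2c u <= e ^+ 2.
Proof.
move=> Lu ue.
have n1 : nrm2c (fun=> 1) = 1.
  have := @inner_circle R 0 0; rewrite eqxx.
  rewrite (_ : (fun t => circ t ^+ 0) = fun=> 1); last by apply/funext => t; rewrite expr0.
  by rewrite inner_self => /(congr1 (@complex.Re R)).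
have i1 : leb.-integrable (@angles R) (EFin \o (fun x => dtheta x * sqn (1 : CC R))).
  by have /(L2P _ mdtheta (@dtheta_ge0 R))[] := @L2c_one R.
rewrite -[leRHS]mulr1 -n1 -(RintegralZl (e ^+ 2) mangles i1).
apply: (le_Rintegral mangles).
- by have /(L2P _ mdtheta (@dtheta_ge0 R))[] := Lu.
- exact: (integrableZl mangles (e ^+ 2) i1).
move=> x Dx; rewrite sqn1 mulr1 mulrC ler_wpM2r ?dtheta_ge0 // -sqr_normc_sqn.
by apply: lerXn2r; rewrite ?nnegrE ?normc_ge0 //; exact: le_trans (normc_ge0 _) (ue 0).
Qed.

(** Bessel's inequality on the circle of radius [r] bounds the sum of [|a n|^2 * r^(2n)] uniformly
    in [r]; in a finite sum [r] may tend to 1. *)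
Lemma hardy_coefs f : hardy_disc f -> exists M : R, forall N, \sum_(n < N) sqn (tcoef f n) <= M.
Proof.
case=> hf [M hM]; exists (M ^+ 2) => N.
have main r : 0 < r < 1 -> \sum_(n < N) sqn (tcoef f n) * r ^+ (2 * n) <= M ^+ 2.
  move=> r01; have /andP[r0 r1] := r01.
  have cts t : ccts (on_circle f r) t.
    have dz : derivable f (r%:C * circ t) 1.
      by apply: hf; rewrite ComplexField.Normc.normcM normc_circle normcR mulr1 ger0_norm // ltW.
    exact: (ccts_cdiff_circle r0 (derivable_cdiff dz)).
  have Lf := L2_ccts cts.
  have r01' : 0 <= r < 1 by rewrite (ltW r0).
  have := hM r r01'; rewrite /circle_norm (L2normE mangles mdtheta (@dtheta_ge0 R) Lf) lee_fin.
  move=> le; have M0 : 0 <= M := le_trans (sqrtr_ge0 _) le.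
  have le2 : nrm2c (on_circle f r) <= M ^+ 2.
    have n0 : 0 <= nrm2c (on_circle f r) by apply: nrm2_ge0; exact: dtheta_ge0.
    rewrite -[leLHS](sqr_sqrtr n0).
    by apply: lerXn2r; rewrite ?nnegrE ?sqrtr_ge0.
  apply: le_trans le2; apply: le_trans (bessel_circle N Lf).
  by apply: ler_sum => n _; rewrite (inner_on_circle hf n r01) [leRHS]sqnM sqnR -exprM mulnC.
set S := \sum_(n < N) _.
have S0 : 0 <= S by apply: sumr_ge0 => n _; exact: sqn_ge0.
(* At radius [1 - dl] Bernoulli's inequality bounds the relative loss by [2 * N * dl], so
   [dl * K <= e] keeps the total loss below [e]. *)
apply/ler_addgt0Pr => e e0; pose K := 2 * N%:R * S + 1.
have K0 : 0 < K by rewrite ltr_wpDl // !mulr_ge0.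
have [dl [d0 d1 dK]] : exists dl : R, [/\ 0 < dl, dl < 1 & dl * K <= e].
  exists (Num.min 2^-1 (e / K)); rewrite lt_min divr_gt0 // invr_gt0 ltr0n; split => //.
    by rewrite gt_min invf_lt1 ?ltr1n.
  by rewrite -ler_pdivlMr // ge_min lexx orbT.
have r01 : 0 < 1 - dl < 1 by rewrite subr_gt0 d1 gtrBl.
rewrite -lerBlDr; apply: le_trans (main _ r01).
apply: (@le_trans _ _ (\sum_(n < N) sqn (tcoef f n) * (1 - 2 * N%:R * dl))).
  rewrite -mulr_suml -/S mulrBr mulr1 lerD2l lerN2; apply: le_trans dK.
  by rewrite /K mulrDr mulr1 mulrC -!mulrA; nra.
apply: ler_sum => n _; rewrite ler_wpM2l ?sqn_ge0 //.
apply: le_trans (bernoulli_sub (2 * n) (ltW d0) (ltW d1)).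
rewrite lerD2l lerN2 ler_wpM2r ?(ltW d0) // natrM ler_wpM2l // ler_nat; exact: ltnW.
Qed.

End HardyBoundary.

(** * Boundary values of the symbol *)

Section BoundaryValues.
Context {R : realType}.
Local Notation circ := (@circle R).
Implicit Types (a b : nat -> CC R) (psi : CC R -> CC R) (t : R).

(** From [1 / k^2 <= 2 / (k * (k + 1))] for [k >= 1], whose right-hand side telescopes. *)
Lemma sum_inv_sqr N : \sum_(n < N) (n.+1%:R ^+ 2)^-1 <= 2 - 2 * N.+1%:R^-1 :> R.
Proof.
elim: N => [|N IH]; first by rewrite big_ord0 invr1; lra.
rewrite big_ord_recr /=; apply: le_trans (lerD IH (lexx _)) _.
have p1 : (0 : R) < N.+1%:R by [].
have eq : N.+2%:R = N.+1%:R + 1 :> R by rewrite [RHS]natr1.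
rewrite eq; have h1 : (1 : R) <= N.+1%:R by rewrite ler1n.
move: (N.+1%:R : R) p1 h1 => k p1 h1.
have -> : 2 - 2 * (k + 1)^-1 = 2 - 2 * k^-1 + 2 * (k * (k + 1))^-1.
  by field; rewrite !gt_eqF //; lra.
rewrite lerD2l -[leLHS]mul1r ler_pdivrMr ?exprn_gt0 // mulrAC ler_pdivlMr; last by nra.
by rewrite mul1r; nra.
Qed.

(** Square summability of the coefficients [k * b_k] of the derivative makes [b] itself summable:
    [|b_k| <= (k * |b_k|)^2 + 1 / k^2]. *)
Lemma abs_summable_dcoef b (M : R) : (forall N, \sum_(n < N) sqn (dcoef b n) <= M) ->
  exists K : R, forall N, \sum_(n < N) normc (b n) <= K.
Proof.
move=> hM; have M0 : 0 <= M by have := hM 0%N; rewrite big_ord0.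
exists (normc (b 0%N) + (M + 2)) => N.
apply: (@le_trans _ _ (\sum_(n < N.+1) normc (b n))).
  by rewrite big_ord_recr /= lerDl normc_ge0.
rewrite big_ord_recl lerD2l.
apply: (@le_trans _ _ (\sum_(n < N) (sqn (dcoef b n) + (n.+1%:R ^+ 2)^-1))).
  apply: ler_sum => n _; rewrite lift0 /dcoef sqnM.
  rewrite (_ : sqn (n.+1%:R : CC R) = n.+1%:R ^+ 2); last first.
    by rewrite -(rmorph_nat (real_complex R)) sqnR.
  rewrite -sqr_normc_sqn; have k0 : (0 : R) < n.+1%:R by [].
  move: (n.+1%:R : R) (normc (b n.+1)) k0 (normc_ge0 (b n.+1)) => k x k0 x0.
  have -> : k ^+ 2 * x ^+ 2 + (k ^+ 2)^-1 = (k * x - k^-1) ^+ 2 + x + x.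
    by field; rewrite gt_eqF.
  by have := sqr_ge0 (k * x - k^-1); lra.
rewrite big_split /=; apply: lerD; first exact: hM.
by apply: le_trans (sum_inv_sqr N) _; rewrite gerBl mulr_ge0 // invr_ge0.
Qed.

Variables (b : nat -> CC R) (K : R).
Hypothesis bK : forall N, \sum_(n < N) normc (b n) <= K.

Lemma circle_series : exists psib : R -> CC R, forall e : R, 0 < e ->
  exists N0, forall N t, (N0 <= N)%N -> normc (ppoly circ b N t - psib t) <= e.
Proof.
have nX t n : normc (b n * circ t ^+ n) = normc (b n).
  by rewrite ComplexField.Normc.normcM normcX normc_circle expr1n mulr1.
have ex t : exists s : CC R, normc (ppoly circ b N t - s) @[N --> \oo] --> (0 : R).
  apply: (@abs_summable_cvg _ (fun n => b n * circ t ^+ n) K) => N.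
  by under eq_bigr do rewrite nX.
have [psib hp] := choice ex; exists psib => e e0.
have [N0 hN] := abs_summable_tail (fun n => normc_ge0 (b n)) bK e0.
exists N0 => N t NN; rewrite normcB.
apply: (@normc_lim_le _ (fun M => ppoly circ b M t - ppoly circ b N t)).
  rewrite (_ : (fun M => _) = fun M => normc (ppoly circ b M t - psib t)) //.
  by apply/funext => M; congr normc; ring.
exists N => M NM; rewrite [_ - _](psumB b (circ t) NM).
apply: le_trans (normc_sum _ _ _) _.
by under eq_bigr do rewrite nX; exact: hN.
Qed.

(** The radial limit exists at every angle, so [bdry] never returns its junk value here. Tails are
    small uniformly in the radius, and the polynomial in between moves little because
    [1 - r^n <= n * (1 - r)]. *)
Lemma bdry_circle_series psi psib : pser b psi ->
  (forall e : R, 0 < e -> exists N0, forall N t, (N0 <= N)%N ->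
     normc (ppoly circ b N t - psib t) <= e) -> bdry psi = psib.
Proof.
move=> pb hp; apply/funext => t; rewrite /bdry.
have nz (r : R) : 0 <= r -> normc (r%:C * circ t) = r.
  by move=> r0; rewrite ComplexField.Normc.normcM normcR normc_circle mulr1 ger0_norm.
have tail (e : R) : 0 < e -> exists N0, forall N (r : R), (N0 <= N)%N -> 0 <= r < 1 ->
    normc (psum b N (r%:C * circ t) - psi (r%:C * circ t)) <= e.
  move=> e0; have [N0 hN] := abs_summable_tail (fun n => normc_ge0 (b n)) bK e0.
  exists N0 => N r NN /andP[r0 r1]; have z1 : normc (r%:C * circ t) < 1 by rewrite nz.
  rewrite normcB; apply: (@normc_lim_le _ (fun M => psum b M (r%:C * circ t) - psum b N (r%:C * circ t))).
    rewrite (_ : (fun M => _) = fun M => normc (psum b M (r%:C * circ t) - psi (r%:C * circ t))).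
      exact: pb.
    by apply/funext => M; congr normc; ring.
  exists N => M NM; rewrite psumB //; apply: le_trans (normc_sum _ _ _) _.
  apply: le_trans (hN N M NN NM); apply: ler_sum => n _.
  rewrite ComplexField.Normc.normcM normcX nz // ler_piMr ?normc_ge0 //.
  by rewrite exprn_ile1 // ltW.
have diff N (r : R) : 0 <= r -> r < 1 ->
    normc (ppoly circ b N t - psum b N (r%:C * circ t)) <= (1 - r) * \sum_(n < N) n%:R * normc (b n).
  move=> r0 r1; rewrite /ppoly /psum -sumrB; apply: le_trans (normc_sum _ _ _) _.
  rewrite mulr_sumr; apply: ler_sum => n _.
  have -> : b n * circ t ^+ n - b n * (r%:C * circ t) ^+ n = (1 - r ^+ n)%:C * (b n * circ t ^+ n).
    by rewrite exprMn rmorphB rmorph1 rmorphXn /=; ring.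
  rewrite !ComplexField.Normc.normcM normcX normc_circle expr1n mulr1 normcR.
  rewrite mulrA ler_wpM2r ?normc_ge0 // ger0_norm; last by rewrite subr_ge0 exprn_ile1 // ltW.
  have := @bernoulli_sub R n (1 - r); rewrite subr_ge0 gerBl => /(_ (ltW r1) r0).
  by rewrite subKr [n%:R * _]mulrC; lra.
apply: cvg_lim; first exact: norm_hausdorff.
apply/cvgrPdist_le => e' /posC[e e0 ->].
have e4 : 0 < e / 3 by rewrite divr_gt0.
have [N0 h0] := tail _ e4; have [N1 h1] := hp _ e4.
pose N := maxn N0 N1.
have S0 : 0 <= \sum_(n < N) n%:R * normc (b n).
  by apply: sumr_ge0 => n _; rewrite mulr_ge0 ?normc_ge0.
set S := \sum_(n < N) _ in S0.
have S1 : 0 < S + 1 by rewrite ltr_wpDl.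
near=> r; have r1 : r < 1 by near: r; exact: nbhs_left_lt.
have r0 : 0 < r by near: r; apply: nbhs_left_gt.
have rS : 1 - e / 3 / (S + 1) < r by near: r; apply: nbhs_left_gt; rewrite gtrBl divr_gt0.
rewrite normrE lecR.
have k1 := h1 N t (leq_maxr _ _).
have k0 : normc (psum b N (r%:C * circ t) - psi (r%:C * circ t)) <= e / 3.
  by apply: h0; rewrite ?leq_maxl // (ltW r0).
have k2 : normc (ppoly circ b N t - psum b N (r%:C * circ t)) <= e / 3.
  apply: le_trans (diff N r (ltW r0) r1) _; rewrite -/S.
  apply: (@le_trans _ _ (e / 3 / (S + 1) * (S + 1))); last by rewrite divfK // gt_eqF.
  by apply: ler_pM => //; rewrite ?subr_ge0 ?(ltW r1) // ?lerDl //; lra.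
have -> : psib t - psi (r%:C * circ t) = - (ppoly circ b N t - psib t) +
    (ppoly circ b N t - psum b N (r%:C * circ t)) + (psum b N (r%:C * circ t) - psi (r%:C * circ t)).
  by ring.
apply: le_trans (le_normcD _ _) _; apply: le_trans (lerD (le_normcD _ _) (lexx _)) _.
rewrite normcN; move: k0 k1 k2; move: (normc _) (normc _) (normc _) => A B C; lra.
Unshelve. all: by end_near. Qed.

End BoundaryValues.

(** * Uniform polynomial approximation of rational functions on the circle *)

Section RationalApproximation.
Context {R : realType}.
Local Notation circ := (@circle R).
Implicit Types (F G : R -> CC R) (p q : {poly R[i]}) (z : R[i]).

Definition poly_approx F := forall e : R, 0 < e ->
  exists p, forall t, normc (F t - p.[circ t]) <= e.

Lemma poly_circle_bound p : exists B : R, 0 <= B /\ forall t, normc p.[circ t] <= B.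
Proof.
exists (\sum_(i < size p) normc p`_i); split.
  by apply: sumr_ge0 => i _; exact: normc_ge0.
move=> t; rewrite horner_coef; apply: le_trans (normc_sum _ _ _) _.
by apply: ler_sum => i _; rewrite ComplexField.Normc.normcM normcX normc_circle expr1n mulr1.
Qed.

Lemma poly_approx_poly p : poly_approx (fun t => p.[circ t]).
Proof.
by move=> e e0; exists p => t; rewrite subrr ComplexField.Normc.normc0 ltW.
Qed.

Lemma poly_approxM F G : poly_approx F -> poly_approx G -> poly_approx (fun t => F t * G t).
Proof.
move=> aF aG e e0.
have [p0 h0] := aF 1 ltr01; have [B0 [B00 hB0]] := poly_circle_bound p0.
have FB t : normc (F t) <= 1 + B0.
  by rewrite -[F t](subrK p0.[circ t]); apply: le_trans (le_normcD _ _) _; rewrite lerD.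
have K0 : 0 < 1 + B0 by rewrite ltr_wpDr.
have eF : 0 < e / 2 / (1 + B0) by rewrite !divr_gt0.
have [q hq] := aG _ eF; have [B1 [B10 hB1]] := poly_circle_bound q.
have K1 : 0 < 1 + B1 by rewrite ltr_wpDr.
have eG : 0 < e / 2 / (1 + B1) by rewrite !divr_gt0.
have [p hp] := aF _ eG; exists (p * q) => t.
have -> : F t * G t - (p * q).[circ t] = F t * (G t - q.[circ t]) + (F t - p.[circ t]) * q.[circ t].
  by rewrite hornerM; move: (F t) (G t) p.[_] q.[_] => x y x' y'; ring.
apply: le_trans (le_normcD _ _) _; rewrite !ComplexField.Normc.normcM [leRHS](splitr e).
apply: lerD.
  apply: (@le_trans _ _ ((1 + B0) * (e / 2 / (1 + B0)))); last by rewrite mulrC divfK // gt_eqF.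
  by apply: ler_pM => //; exact: normc_ge0.
apply: (@le_trans _ _ (e / 2 / (1 + B1) * (1 + B1))); last by rewrite divfK // gt_eqF.
apply: ler_pM => //; rewrite ?normc_ge0 //.
by apply: le_trans (hB1 t) _; rewrite lerDr.
Qed.

(** A truncated geometric series in [circ t / z], uniform in [t] because [|z| > 1]. *)
Lemma poly_approx_inv_linear z : 1 < normc z -> poly_approx (fun t => (circ t - z)^-1).
Proof.
move=> z1 e e0.
have nz0 : 0 < normc z := lt_trans ltr01 z1.
have z0 : z != 0 by apply: contraTneq nz0 => ->; rewrite ComplexField.Normc.normc0 ltxx.
pose k := normc z - 1; have k0 : 0 < k by rewrite subr_gt0.
have dist t : k <= normc (circ t - z).
  have := le_normcD (circ t - z) (- circ t); rewrite normcN normc_circle.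
  by rewrite (_ : circ t - z - circ t = - z) ?normcN /k; [lra|ring].
have [N hN] : exists N, (normc z)^-1 ^+ N <= e * k.
  have : (normc z)^-1 ^+ n @[n --> \oo] --> (0 : R).
    by apply: cvg_expr; rewrite ger0_norm ?invr_ge0 ?(ltW nz0) // invf_lt1.
  move=> /cvg0P h; have [||N hN] := h _ (e * k) _.
  - by move=> n; rewrite exprn_ge0 // invr_ge0 ltW.
  - by rewrite mulr_gt0.
  by exists N; exact: hN.
exists (\poly_(n < N) (- z^-1 ^+ n.+1)) => t.
have xz : circ t - z != 0.
  by apply/eqP => h; have := dist t; rewrite h ComplexField.Normc.normc0 leNgt k0.
have -> : (circ t - z)^-1 - (\poly_(n < N) (- z^-1 ^+ n.+1)).[circ t] =
    (circ t - z)^-1 * (z^-1 * circ t) ^+ N.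
  rewrite horner_poly; apply: (mulfI xz); rewrite mulrBr mulfV // mulrA mulfV // mul1r.
  have -> : \sum_(i < N) - z^-1 ^+ i.+1 * circ t ^+ i = - z^-1 * \sum_(i < N) (z^-1 * circ t) ^+ i.
    by rewrite mulr_sumr; apply: eq_bigr => i _; rewrite exprS exprMn; ring.
  have e1 : (circ t - z) * - z^-1 = - (z^-1 * circ t - 1).
    by rewrite mulrN mulrBl mulfV // mulrC.
  by rewrite mulrA e1 mulNr -subrX1 opprK addrC subrK.
rewrite ComplexField.Normc.normcM normcX ComplexField.Normc.normcM normc_circle mulr1.
rewrite !ComplexField.Normc.normcV; have dt := dist t.
have p : 0 < normc (circ t - z) := lt_le_trans k0 dt.
rewrite mulrC ler_pdivrMr //; apply: le_trans hN _.
by rewrite ler_wpM2l // ltW.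
Qed.

(** The denominator splits into linear factors with roots outside the closed disc, whose inverses
    can be approximated one by one. The Hardy space is thereby a closure of polynomials. *)
Lemma poly_approx_rational p q : (forall z, normc z <= 1 -> q.[z] != 0) ->
  poly_approx (fun t => p.[circ t] / q.[circ t]).
Proof.
move=> q0; apply: poly_approxM (poly_approx_poly p) _.
have [s sE] := closed_field_poly_normal q.
have lq : lead_coef q != 0.
  rewrite lead_coef_eq0; apply: contraTneq (q0 0 _) => [->|].
    by rewrite horner0 eqxx.
  by rewrite ComplexField.Normc.normc0.
have rs z : z \in s -> 1 < normc z.
  move=> zs; rewrite ltNge; apply/negP => /q0; rewrite sE hornerZ horner_prod.
  by rewrite (big_rem z) //= hornerXsubC subrr mul0r mulr0 eqxx.
rewrite (_ : (fun t => _) = fun t => (lead_coef q)^-1%:P.[circ t] * \prod_(z <- s) (circ t - z)^-1).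
  apply: poly_approxM (poly_approx_poly _) _.
  elim: s rs {sE} => [|z s IH] rs.
    rewrite (_ : (fun t => _) = fun t => (1 : {poly R[i]}).[circ t]); first exact: poly_approx_poly.
    by apply/funext => t; rewrite big_nil hornerC.
  rewrite (_ : (fun t => _) = fun t => (circ t - z)^-1 * \prod_(z <- s) (circ t - z)^-1).
    apply: poly_approxM; first by apply/poly_approx_inv_linear/rs; rewrite mem_head.
    by apply: IH => x xs; apply: rs; rewrite inE xs orbT.
  by apply/funext => t; rewrite big_cons.
apply/funext => t; rewrite hornerC [in LHS]sE hornerZ horner_prod invfM; congr (_ * _).
rewrite prodfV; congr (_^-1); apply: eq_bigr => z _; exact: hornerXsubC.
Qed.

End RationalApproximation.

(** * The Hankel operator on the Hardy space *)

Section HardyHankel.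
Context {R : realType}.
Local Notation leb := (@lebesgue_measure R).
Local Notation mR := (measurableTypeR R).
Local Notation D := (@angles R : set mR).
Local Notation w := (@dtheta R : mR -> R).
Local Notation L2c := (L2 leb D w).
Local Notation innerc := (L2inner leb D w).
Local Notation nrm2c := (nrm2 leb D w).
Local Notation circ := (@circle R).
Local Notation gam := (fun=> 1 : R).
Implicit Types (a b : nat -> CC R) (u v f q : R -> CC R).
Let mD : measurable D := @mangles R.
Let mw : measurable_fun D w := @mdtheta R.
Let w0 t (Dt : D t) : 0 <= w t := dtheta_ge0 Dt.
Let mzeta := @cmeas_circle R.
Let zeta1 := @sqn_circle_le R.
Let L1 := @L2c_one R.
Let gam0 (n : nat) : 0 < gam n := ltr01.
Let ip : forall n m, innerc (fun t => circ t ^+ n) (fun t => circ t ^+ m) =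
  (if n == m then gam n else 0)%:C := @inner_circle R.
Let Lz n := @L2_circleX R n.

Lemma hardy_ppoly a N : hardy_bdry (ppoly circ a N).
Proof.
have Lp : L2c (ppoly circ a N) by exact: L2_ppoly.
split => // e e0; exists (\poly_(n < N) a n), 1; split.
  by move=> z _; rewrite hornerE oner_neq0.
have e1 : (fun t => ppoly circ a N t - (\poly_(n < N) a n).[circ t] / 1.[circ t]) =
    ppoly circ a N \- ppoly circ a N.
  by apply/funext => t; rewrite hornerE divr1 horner_poly.
by rewrite /circle_norm e1 (L2normE mD mw w0 (L2B mD mw w0 Lp Lp)) nrm2_subxx sqrtr0.
Qed.

(** A rational approximant is replaced by a polynomial, uniformly on the circle, and the Fourier
    sums do at least as well as any polynomial. *)
Lemma hardy_approx f : hardy_bdry f ->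
  nrm2c (ppoly circ (pcoef leb D w circ gam f) N \- f) @[N --> \oo] --> (0 : R).
Proof.
case=> Lf hf; apply/cvg0P => [n|e e0]; first exact: nrm2_ge0.
pose e1 := Num.sqrt e / 2.
have e10 : 0 < e1 by rewrite divr_gt0 // sqrtr_gt0.
have [p [q [q0 hpq]]] := hf e1 e10.
have [s hs] := poly_approx_rational p q0 e10.
pose c := fun n : nat => s`_n : CC R.
have sE t : s.[circ t] = ppoly circ c (size s) t by rewrite horner_coef.
have Lp (a : nat -> CC R) N : L2c (ppoly circ a N) by exact: L2_ppoly.
have cP (P : {poly R[i]}) : cmeas D (fun t => P.[circ t]).
  rewrite (_ : (fun t => _) = ppoly circ (fun n => P`_n) (size P)); last first.
    by apply/funext => t; rewrite horner_coef.
  exact: (L2_cmeas mw w0 (Lp _ _)).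
(* The quotient is measurable as a limit of polynomials. *)
have cr : cmeas D (fun t => p.[circ t] / q.[circ t]).
  have ex n : exists P : {poly R[i]}, forall t, normc (p.[circ t] / q.[circ t] - P.[circ t]) <= n.+1%:R^-1.
    by apply: poly_approx_rational; rewrite ?invr_gt0.
  have [P hP] := choice ex.
  apply: (cmeas_lim mD (F := fun n t => (P n).[circ t])); [by move=> n; exact: cP|move=> t _].
  apply: (@cvg0_squeeze _ _ (fun n => n.+1%:R^-1)).
  - by move=> n; exact: normc_ge0.
  - by move=> n; rewrite normcB; exact: hP.
  - exact: cvg_harmonic.
have Lr : L2c (fun t => f t - p.[circ t] / q.[circ t]).
  have [c1 c2] := cmeasB (L2_cmeas mw w0 Lf) cr.
  by split => //; exact: lt_trans hpq (ltry _).
have n1 : Num.sqrt (nrm2c (fun t => f t - p.[circ t] / q.[circ t])) <= e1.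
  by move: hpq; rewrite /circle_norm (L2normE mD mw w0 Lr) lte_fin => /ltW.
have Ld : L2c (fun t => p.[circ t] / q.[circ t] - ppoly circ c (size s) t).
  have h := L2B mD mw w0 (L2B mD mw w0 Lf (Lp c (size s))) Lr.
  apply: (L2_eq mD mw w0 _ h) => t _ /=; move: (f t) (_ / _) (ppoly _ _ _ _) => x y z; ring.
have n2 : nrm2c (fun t => p.[circ t] / q.[circ t] - ppoly circ c (size s) t) <= e1 ^+ 2.
  by apply: nrm2c_sup => // t; rewrite -sE.
have n3 : Num.sqrt (nrm2c (f \- ppoly circ c (size s))) <= Num.sqrt e.
  have := nrm2_sqrtD mD mw w0 Lr Ld.
  rewrite (_ : (fun t => _) \+ (fun t => _) = f \- ppoly circ c (size s)); last first.
    by apply/funext => t /=; move: (f t) (_ / _) (ppoly _ _ _ _) => x y z; ring.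
  move=> /le_trans; apply; rewrite [leRHS]splitr; apply: lerD n1 _.
  by rewrite -[leRHS]ger0_norm ?(ltW e10) // -sqrtr_sqr ler_wsqrtr.
exists (size s) => N NN.
have -> : nrm2c (ppoly circ (pcoef leb D w circ gam f) N \- f) =
    nrm2c (f \- ppoly circ (pcoef leb D w circ gam f) N).
  by apply: eq_Rintegral => t _ /=; rewrite -!sqr_normc_sqn normcB.
apply: le_trans (best_approx mD mw w0 mzeta zeta1 L1 gam0 ip c Lf NN) _.
have := n3; rewrite ler_sqrt //; exact: ltW.
Qed.

Lemma hardy_limit a (N : nat -> nat) g : L2c g ->
  nrm2c (ppoly circ a (N j) \- g) @[j --> \oo] --> (0 : R) -> hardy_bdry g.
Proof.
move=> Lg /cvg0P h; split => // e e0.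
have [|j hj] := h (fun j => nrm2_ge0 leb w0 _) ((e / 2) ^+ 2); first by rewrite exprn_gt0 // divr_gt0.
have Lp : L2c (ppoly circ a (N j)) by exact: L2_ppoly.
exists (\poly_(n < N j) a n), 1; split; first by move=> z _; rewrite hornerE oner_neq0.
have e1 : (fun t => g t - (\poly_(n < N j) a n).[circ t] / 1.[circ t]) = g \- ppoly circ a (N j).
  by apply/funext => t; rewrite hornerE divr1 horner_poly.
rewrite /circle_norm e1 (L2normE mD mw w0 (L2B mD mw w0 Lg Lp)) lte_fin.
have -> : nrm2c (g \- ppoly circ a (N j)) = nrm2c (ppoly circ a (N j) \- g).
  by apply: eq_Rintegral => t _ /=; rewrite -!sqr_normc_sqn normcB.
have e2 : 0 < e / 2 by rewrite divr_gt0.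
apply: (@le_lt_trans _ _ (e / 2)); last by rewrite ltr_pdivrMr // ltr_pMr // ltr1n.
by rewrite -[leRHS](ger0_norm (ltW e2)) -sqrtr_sqr ler_wsqrtr // hj.
Qed.

(** Partial sums along a sparse sequence of degrees have geometric gaps, so completeness applies and
    the coefficients pass to the limit. *)
Lemma hardy_riesz_fischer (c : nat -> CC R) (B : R) :
  (forall N, \sum_(n < N) sqn (c n) <= B) ->
  exists g, [/\ L2c g, hardy_bdry g & forall k, innerc g (fun t => circ t ^+ k) = c k].
Proof.
move=> cB; have Lp N : L2c (ppoly circ c N) by exact: L2_ppoly.
have ex j : exists N0, forall N M, (N0 <= N)%N -> (N <= M)%N ->
    \sum_(N <= n < M) sqn (c n) <= (2^-1 ^+ j) ^+ 2.
  apply: (abs_summable_tail (fun n => sqn_ge0 (c n)) cB).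
  by rewrite !exprn_gt0 // invr_gt0.
have [N0 hN0] := choice ex.
(* Summing successors makes the degrees monotone and larger than their index, so that every fixed
   [k] is eventually below [N j]. *)
have [N [NN0 Nmono Nj]] : exists N : nat -> nat,
    [/\ forall j, (N0 j <= N j)%N, forall j, (N j <= N j.+1)%N & forall j, (j < N j)%N].
  exists (fun j => \sum_(i < j.+1) (N0 i).+1); split => j.
  - by rewrite big_ord_recr /=; apply: leq_trans (leqnSn _) _; exact: leq_addl.
  - by rewrite [leqRHS]big_ord_recr /=; exact: leq_addr.
  - have : (\sum_(i < j.+1) 1 <= \sum_(i < j.+1) (N0 i).+1)%N by exact: leq_sum.
    by rewrite sum1_card card_ord.
have pc M n : (n < M)%N -> pcoef leb D w circ gam (ppoly circ c M) n = c n.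
  move=> nM; rewrite /pcoef (inner_ppoly_power mD mw w0 mzeta zeta1 L1 ip) nM invr1.
  by rewrite mul1r mulr1.
have geo j : Num.sqrt (nrm2c (ppoly circ c (N j.+1) \- ppoly circ c (N j))) <= 2^-1 ^+ j.
  have h0 : (0 : R) <= 2^-1 ^+ j by rewrite exprn_ge0.
  rewrite -[leRHS](ger0_norm h0) -sqrtr_sqr ler_wsqrtr //.
  have := nrm2_sub_ppoly mD mw w0 mzeta zeta1 L1 gam0 ip c (N j) (Lp (N j.+1)) => ->.
  rewrite [X in _ + X]big1 ?addr0; last first.
    by move=> n _; rewrite pc ?subrr ?sqn0 ?mulr0 // (leq_trans (ltn_ord n)).
  rewrite (nrm2_ppoly mD mw w0 mzeta zeta1 L1 ip).
  apply: le_trans (hN0 j (N j) (N j.+1) (NN0 j) (Nmono j)).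
  have -> : \sum_(n < N j) 1 * sqn (pcoef leb D w circ gam (ppoly circ c (N j.+1)) n) =
      \sum_(0 <= n < N j) sqn (c n).
    by rewrite big_mkord; apply: eq_bigr => n _; rewrite mul1r pc // (leq_trans (ltn_ord n)).
  under eq_bigr do rewrite mul1r.
  rewrite -(big_mkord xpredT (fun n => sqn (c n))) (@big_cat_nat _ _ _ (N j) 0 (N j.+1)) //=.
  by rewrite [X in X - _]addrC addrK.
have wpos t : D t -> 0 < w t by move=> _; rewrite /dtheta invr_gt0 mulr_gt0 // pi_gt0.
have [g Lg cg] := L2_complete mD mw w0 wpos L1 (F := fun j => ppoly circ c (N j)) (fun j => Lp (N j)) geo.
exists g; split => //; first exact: hardy_limit Lg cg.
move=> k; have c0 : nrm2c ((fun t => circ t ^+ k) \- (fun t => circ t ^+ k)) @[_ --> \oo] --> (0 : R).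
  by rewrite nrm2_subxx; exact: cvg_cst.
have h := inner_cvg mD mw w0 (fun j => Lp (N j)) (fun=> Lz k) Lg (Lz k) cg c0.
apply/esym/(normc_lim_unique _ h); apply/cvg0P => [j|e e0]; first exact: normc_ge0.
exists k => j kj; rewrite (inner_ppoly_power mD mw w0 mzeta zeta1 L1 ip).
by rewrite (leq_ltn_trans kj (Nj j)) mulr1 subrr ComplexField.Normc.normc0 ltW.
Qed.

Lemma hardy_orthogonal q h : L2c q ->
  (forall k, innerc q (fun t => circ t ^+ k) = 0) -> hardy_bdry h -> innerc q h = 0.
Proof.
move=> Lq q0 Hh; have [Lh _] := Hh.
apply: (inner_limit0 mD mw w0 Lq Lh (G := ppoly circ (pcoef leb D w circ gam h))).
- by move=> n; exact: L2_ppoly.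
- move=> n; rewrite (inner_ppolyr mD mw w0 mzeta zeta1 L1 _ _ Lq) big1 // => k _.
  by rewrite q0 mulr0.
- exact: hardy_approx.
Qed.

Lemma nrm2c_mul (F q : R -> CC R) (dl : R) : L2c q -> L2c (fun t => F t * q t) ->
  (forall t, normc (F t) <= dl) -> nrm2c (fun t => F t * q t) <= dl ^+ 2 * nrm2c q.
Proof.
move=> Lq LFq hF.
have i1 : leb.-integrable D (EFin \o (fun x => w x * sqn (q x))) by have /(L2P _ mw w0)[] := Lq.
rewrite -(RintegralZl (dl ^+ 2) mD i1); apply: (le_Rintegral mD).
- by have /(L2P _ mw w0)[] := LFq.
- exact: (integrableZl mD (dl ^+ 2) i1).
move=> x Dx; rewrite sqnM mulrCA; apply: ler_wpM2r; first by rewrite mulr_ge0 ?sqn_ge0 ?w0.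
rewrite -sqr_normc_sqn; apply: lerXn2r => //; rewrite nnegrE ?normc_ge0 //.
exact: le_trans (normc_ge0 _) (hF 0).
Qed.

(* With q = u - g orthogonal to the Hardy space, |q|^2 = <u, q> is the limit of
   <u_N - h_N, q>, where u_N is a truncated product and h_N its projection. *)
Lemma hardy_hankel b psib f (K E : R) : hardy_bdry f ->
  (forall N, \sum_(n < N) normc (b n) <= K) ->
  (forall e : R, 0 < e -> exists N0, forall N t, (N0 <= N)%N ->
     normc (ppoly circ b N t - psib t) <= e) ->
  L2c (fun t => (psib t)^* * f t) ->
  (forall M, \sum_(m < M) m%:R * sqn (b m) <= E) ->
  exists2 g, is_orthproj leb D w (@hardy_bdry R) (fun t => (psib t)^* * f t) g
   & nrm2c ((fun t => (psib t)^* * f t) \- g) <= nrm2c f * E / (2 + -1).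
Proof.
move=> Hf bK hp; set u := (fun t => _) => Lu hE; have [Lf _] := Hf.
have [c cE] : exists c : nat -> CC R, forall k, innerc u (fun t => circ t ^+ k) = c k.
  by exists (fun k => innerc u (fun t => circ t ^+ k)).
have cB N : \sum_(n < N) sqn (c n) <= nrm2c u.
  by under eq_bigr do rewrite -cE; exact: bessel_circle.
have [g [Lg Hg gE]] := hardy_riesz_fischer cB.
have Lq : L2c (u \- g) by exact: L2B.
have q0 k : innerc (u \- g) (fun t => circ t ^+ k) = 0.
  by rewrite (innerBl mD mw w0 Lu Lg (Lz k)) cE gE subrr.
have orth h : hardy_bdry h -> innerc (u \- g) h = 0 by exact: hardy_orthogonal.
exists g; first by split.
pose B := nrm2c f * E / (2 + -1); rewrite -/B.
have Lp a N : L2c (ppoly circ a N) by exact: L2_ppoly.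
pose a := pcoef leb D w circ gam f.
pose q := u \- g; rewrite -/q in Lq q0 orth *.
have i0 : (0 : R) <= (2 + -1)^-1 by rewrite invr_ge0; lra.
have E0 : 0 <= E by have := hE 0%N; rewrite big_ord0.
have B0 : 0 <= B by apply: mulr_ge0 => //; apply: mulr_ge0 => //; exact: nrm2_ge0.
have K0 : 0 <= K by have := bK 0%N; rewrite big_ord0.
have pK N t : normc (ppoly circ b N t) <= K.
  apply: le_trans (bK N); apply: le_trans (normc_sum _ _ _) _; apply: ler_sum => n _.
  by rewrite ComplexField.Normc.normcM normcX normc_circle expr1n mulr1.
have Lpq N : L2c (fun t => ppoly circ b N t * q t).
  apply: (L2_bounded mD mw w0 (C := K ^+ 2)) (Lq); first exact: (L2_cmeas mw w0 (Lp b N)).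
  by move=> t _; rewrite -sqr_normc_sqn; apply: lerXn2r; rewrite ?nnegrE ?normc_ge0.
have Lpsiq : L2c (fun t => psib t * q t).
  have [N0 h1] := hp 1 ltr01.
  apply: (L2_bounded mD mw w0 (C := (K + 1) ^+ 2)) (Lq).
    apply: (cmeas_lim mD (F := fun N => ppoly circ b N)).
      by move=> N; exact: (L2_cmeas mw w0 (Lp b N)).
    move=> t _; apply/cvg0P => [N|e /hp[N1 h]]; first exact: normc_ge0.
    by exists N1 => N; exact: h.
  move=> t _; rewrite -sqr_normc_sqn; apply: lerXn2r; rewrite ?nnegrE ?normc_ge0 ?addr_ge0 //.
  rewrite -[psib t](subrK (ppoly circ b N0 t)) addrC; apply: le_trans (le_normcD _ _) _.
  by rewrite lerD // normcB h1.
(* Truncations of the symbol converge uniformly, so multiplying the fixed function [q] by them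
   converges in norm. *)
have cpq : nrm2c ((fun t => ppoly circ b N t * q t) \- (fun t => psib t * q t)) @[N --> \oo] --> (0 : R).
  apply/cvg0P => [N|e e0]; first exact: nrm2_ge0.
  have n1 : 0 < nrm2c q + 1 by rewrite ltr_wpDl // nrm2_ge0.
  have d0 : 0 < Num.sqrt (e / (nrm2c q + 1)) by rewrite sqrtr_gt0 divr_gt0.
  have [N0 h1] := hp _ d0; exists N0 => N NN.
  have eN : (fun t => ppoly circ b N t * q t) \- (fun t => psib t * q t) =
      fun t => (ppoly circ b N t - psib t) * q t.
    by apply/funext => t /=; rewrite mulrBl.
  have LN : L2c (fun t => (ppoly circ b N t - psib t) * q t) by rewrite -eN; exact: L2B.
  rewrite eN; apply: le_trans (nrm2c_mul Lq LN (fun t => h1 N t NN)) _.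
  rewrite sqr_sqrtr; last by rewrite divr_ge0 ?(ltW e0) ?(ltW n1).
  apply: (@le_trans _ _ (e / (nrm2c q + 1) * (nrm2c q + 1))); last by rewrite divfK // gt_eqF.
  by rewrite ler_wpM2l ?lerDl // divr_ge0 ?(ltW e0) ?(ltW n1).
have lim : normc (innerc (cprod circ a b N) q - innerc u q) @[N --> \oo] --> (0 : R).
  have := inner_cvg mD mw w0 (Lp a) Lpq Lf Lpsiq (hardy_approx Hf) cpq.
  rewrite -(inner_symbol leb D w f psib q) -/u.
  by under eq_fun do rewrite -(inner_symbol leb D w (ppoly circ a _) (ppoly circ b _) q).
have n0 := nrm2_ge0 leb w0 q.
have bound : normc (innerc u q) <= Num.sqrt B * Num.sqrt (nrm2c q).
  apply: (normc_lim_le lim); exists 0%N => N _.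
  have Lcp : L2c (cprod circ a b N) by exact: L2_cprod.
  have Lpr : L2c (cprod_proj leb D w circ gam a b N) by exact: Lp.
  (* The projection of the truncated product is a polynomial, hence orthogonal to [q], and may be
     subtracted to reach the finite inequality. *)
  have -> : innerc (cprod circ a b N) q =
      innerc (cprod circ a b N \- cprod_proj leb D w circ gam a b N) q.
    rewrite (innerBl mD mw w0 Lcp Lpr Lq) (innerJ mD mw w0 Lq Lpr).
    by rewrite orth ?rmorph0 ?subr0 //; exact: hardy_ppoly.
  apply: le_trans (normc_inner_le mD mw w0 (L2B mD mw w0 Lcp Lpr) Lq) _.
  rewrite ler_wpM2r ?sqrtr_ge0 // ler_wsqrtr //.
  (* Constant weights satisfy the recursion of [gam] exactly for [alpha = -1]. *)
  have rec (n : nat) : (1 : R) * (n%:R + -1 + 2) = n.+1%:R * 1.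
    by rewrite mul1r mulr1 -[n.+1%:R]natr1; ring.
  apply: le_trans (nrm2_hankel_ppoly mD mw w0 mzeta zeta1 L1 gam0 ip a b N (lexx (-1)) rec) _.
  rewrite /B; apply: ler_wpM2r => //.
  apply: ler_pM => //.
  - by apply: sumr_ge0 => n _; rewrite mul1r sqn_ge0.
  - by apply: sumr_ge0 => n _; rewrite mulr_ge0 ?sqn_ge0.
  - exact: (bessel mD mw w0 mzeta zeta1 L1 gam0 ip N Lf).
have self : innerc u q = (nrm2c q)%:C.
  rewrite -inner_self {2}/q (innerBl mD mw w0 Lu Lg Lq).
  by rewrite (innerJ mD mw w0 Lq Lg) orth // rmorph0 subr0.
(* The bound now reads [|q|^2 <= sqrt B * |q|]; it remains to divide by [|q|] when that is
   nonzero. *)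
move: bound; rewrite self normcR ger0_norm // -{1}(sqr_sqrtr n0) expr2.
have [s0|s0] := eqVneq (Num.sqrt (nrm2c q)) 0.
  move=> _; rewrite -[leLHS](sqr_sqrtr n0) s0 expr0n; exact: B0.
have sp : 0 < Num.sqrt (nrm2c q) by rewrite lt_def s0 sqrtr_ge0.
rewrite ler_pM2r // => le; by rewrite -(ler_sqrt _ B0).
Qed.

End HardyHankel.

(** * The norm of the Hankel operator *)

Section HankelNorm.
Context {R : realType}.
Local Notation leb := (@lebesgue_measure R).
Local Notation mR := (measurableTypeR R).
Local Notation mu2 := (@plane_mu R).
Local Notation D := (@disc R : set (mR * mR)).
Local Notation circ := (@circle R).
Implicit Types (alpha : R) (psi : CC R -> CC R).

(** The factor 1 stands for the squared norm of the unit vector to which the operator is applied. *)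
Lemma sqrt_div_le (alpha E x : R) : -1 <= alpha -> 0 <= E -> x <= 1 * E / (2 + alpha) ->
  Num.sqrt x <= (Num.sqrt (2 + alpha))^-1 * Num.sqrt E.
Proof.
move=> ha E0 h; have a2 : 0 <= 2 + alpha by lra.
apply: le_trans (ler_wsqrtr h) _.
by rewrite mul1r sqrtrM // sqrtrV // mulrC.
Qed.

Lemma bergman_sub alpha : bergman alpha `<=` L2 mu2 D (dA alpha).
Proof. by move=> u []. Qed.

Lemma hankel_norm_le_bergman alpha psi (E : R) b : -1 < alpha -> pser b psi ->
  (forall M, \sum_(m < M) m%:R * sqn (b m) <= E) ->
  (hankel_opnorm mu2 D (dA alpha) (bergman alpha) (psi \o toC)
    <= ((Num.sqrt (2 + alpha))^-1 * Num.sqrt E)%:E)%E.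
Proof.
move=> ha pb hE; have E0 : 0 <= E by have := hE 0%N; rewrite big_ord0.
have w0 (p : mR * mR) (_ : D p) : 0 <= dA alpha p := dA_ge0 ha p.
(* From index 1 on, [bgam alpha n <= 1 <= n] compares the squared norm of [psi] with the Dirichlet
   sum; the constant coefficient is counted apart. *)
have Lpsi : L2 mu2 D (dA alpha) (psi \o toC).
  suff h N : \sum_(n < N) bgam alpha n * sqn (b n) <= sqn (b 0%N) + E.
    by have [] := pser_L2 ha pb h.
  apply: (@le_trans _ _ (\sum_(n < N.+1) bgam alpha n * sqn (b n))).
    by rewrite [leRHS]big_ord_recr /= lerDl mulr_ge0 ?sqn_ge0 // ltW // bgam_gt0 // ltW.
  rewrite big_ord_recl mul1r lerD2l; apply: le_trans (hE N.+1).
  rewrite [leRHS]big_ord_recl mul0r add0r; apply: ler_sum => n _; rewrite lift0.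
  rewrite ler_wpM2r ?sqn_ge0 //; apply: le_trans (bgam_le1 _ (ltW ha)) _.
  by rewrite ler1n.
apply: (hankel_opnorm_le (@measurable_disc R) (@measurable_dA_disc R alpha) w0 (@bergman_sub alpha)).
  by rewrite lee_fin mulr_ge0 // ?sqrtr_ge0 // invr_ge0 sqrtr_ge0.
move=> f /bergmanP[f' [a [-> pa Lf]]] Lu n1.
have [g og gB] := bergman_hankel ha pa Lf pb Lpsi Lu hE.
exists g => //; rewrite lee_fin; apply: sqrt_div_le => //; first exact: ltW.
by rewrite n1 in gB.
Qed.

Lemma hankel_norm_le_hardy psi (E : R) b : pser b psi ->
  hardy_disc (derive1 psi) -> (forall M, \sum_(m < M) m%:R * sqn (b m) <= E) ->
  (hankel_opnorm leb (@angles R) (@dtheta R) (@hardy_bdry R) (bdry psi)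
    <= ((Num.sqrt (2 + -1))^-1 * Num.sqrt E)%:E)%E.
Proof.
move=> pb hd hE; have E0 : 0 <= E by have := hE 0%N; rewrite big_ord0.
have [M hM] := hardy_coefs hd.
(* The Hardy bound concerns the Cauchy coefficients of [psi']; uniqueness identifies them with the
   differentiated series. *)
have e : tcoef (derive1 psi) = dcoef b.
  by apply: (pser_unique (f := derive1 psi)); [exact: holomorphic_power_series hd.1|exact: pser_derive1].
rewrite e in hM; have [K bK] := abs_summable_dcoef hM.
have [psib hp] := circle_series bK; rewrite (bdry_circle_series bK pb hp).
apply: (hankel_opnorm_le (@mangles R) (@mdtheta R) (@dtheta_ge0 R)).
- by move=> u [].
- by rewrite lee_fin mulr_ge0 // ?sqrtr_ge0 // invr_ge0 sqrtr_ge0.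
move=> f Hf Lu n1; have [g og gB] := hardy_hankel Hf bK hp Lu hE.
exists g => //; rewrite lee_fin; apply: sqrt_div_le => //.
by rewrite n1 in gB.
Qed.

Lemma hankel_norm_le alpha psi : -1 <= alpha -> holomorphic_disc psi ->
  in_A2 alpha (derive1 psi) ->
  (hankel_norm alpha psi <= ((Num.sqrt (2 + alpha))^-1)%:E * A2norm (derive1 psi))%E.
Proof.
move=> ha hpsi; have a2 : 0 < 2 + alpha by lra.
have pb : pser (tcoef psi) psi by exact: holomorphic_power_series.
have pd := pser_derive1 pb.
(* If the Dirichlet integral is infinite, the right-hand side is [+oo], its constant being
   positive. *)
have [fin|] := boolP (A2norm (derive1 psi) < +oo)%E; last first.
  rewrite -leNgt leye_eq => /eqP -> _; rewrite gt0_muley ?leey //.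
  by rewrite lte_fin invr_gt0 sqrtr_gt0.
have Ld : L2 mu2 D (dA 0) (derive1 psi \o toC).
  by have [c1 c2] := cmeas_pser (ltrN10 R) pd; split.
have w0 (p : mR * mR) (_ : D p) : 0 <= dA 0 p := dA_ge0 (ltrN10 R) p.
rewrite /A2norm (L2normE (@measurable_disc R) (@measurable_dA_disc R 0) w0 Ld) -EFinM.
have hE M := dirichlet_coefs M pb Ld.
rewrite /in_A2 /hankel_norm; case: eqP => [->|/eqP na] hd.
  exact: hankel_norm_le_hardy hE.
by apply: hankel_norm_le_bergman hE => //; rewrite lt_def na.
Qed.

Lemma derive1_idC : derive1 (fun z : CC R => z) = fun=> 1.
Proof. by apply/funext => z; have [_ ->] := cdiff_derivable (cdiff_id z). Qed.

Lemma holomorphic_cst (c : CC R) : holomorphic_disc (fun=> c).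
Proof. by move=> z _; have [] := cdiff_derivable (cdiff_cst c z). Qed.

Lemma hankel_norm_id_bergman alpha : -1 < alpha ->
  (((Num.sqrt (2 + alpha))^-1)%:E <= hankel_norm alpha (fun z : CC R => z))%E.
Proof.
move=> ha; rewrite /hankel_norm gt_eqF //.
have w0 (p : mR * mR) (_ : D p) : 0 <= dA alpha p := dA_ge0 ha p.
have mD := @measurable_disc R; have mw := @measurable_dA_disc R alpha.
have L1 := L2_disc_one ha.
have n1 : nrm2 mu2 D (dA alpha) (fun=> 1) = 1.
  have := inner_disc ha 0 0; rewrite eqxx.
  rewrite (_ : (fun p => toC p ^+ 0) = fun=> 1); last by apply/funext => t; rewrite expr0.
  by rewrite inner_self => /(congr1 (@complex.Re R)).
have Lz := L2_disc_power ha 1.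
have Lu : L2 mu2 D (dA alpha) (fun p => (toC p)^* * 1).
  by apply: (L2_eq mD mw w0 _ (L2J mw w0 Lz)) => p _; rewrite mulr1 expr1.
have H1 : bergman alpha (fun=> 1) by split => //; exact: holomorphic_cst.
have H0 : bergman alpha (fun=> 0) by split; [exact: L2_0|exact: holomorphic_cst].
have q0 : (fun p => (toC p)^* * 1) \- (fun=> 0) = (fun p => (toC p)^* * 1) :> (mR * mR -> CC R).
  by apply/funext => p /=; rewrite subr0.
(* Moving the symbol across gives [<conj z, z^k> = <1, z^(k+1)> = 0], so the projection is 0. *)
have og : is_orthproj mu2 D (dA alpha) (bergman alpha) (fun p => (toC p)^* * 1) (fun=> 0).
  split => // h Hh; rewrite q0; apply: (bergman_orthogonal ha Lu _ Hh) => k.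
  rewrite inner_symbol; transitivity (L2inner mu2 D (dA alpha) (fun p => toC p ^+ 0) (fun p => toC p ^+ k.+1)).
    by apply: eq_inner => p _; rewrite ?expr0 // exprS.
  by rewrite (inner_disc ha 0 k.+1).
have := hankel_opnorm_ge mD mw w0 (@bergman_sub alpha) H1 n1 Lu og.
apply: le_trans; rewrite lee_fin q0.
have -> : nrm2 mu2 D (dA alpha) (fun p => (toC p)^* * 1) = (2 + alpha)^-1.
  have := inner_disc ha 1 1; rewrite eqxx inner_self => /(congr1 (@complex.Re R)) /= h.
  transitivity (nrm2 mu2 D (dA alpha) (fun p => toC p ^+ 1)).
    by apply: eq_Rintegral => p _; rewrite mulr1 expr1 sqnJ.
  by rewrite h add0r mulr1 mul1r addrC.
by rewrite sqrtrV //; lra.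
Qed.

Lemma bdry_id : bdry (fun z : CC R => z) = circ.
Proof.
have pid : pser (fun n => (n == 1%N)%:R) (fun z : CC R => z).
  move=> z _; apply/cvg0P => [n|e e0]; first exact: normc_ge0.
  exists 2%N => -[|[|n]] // _; rewrite /psum !big_ord_recl big1 /=.
    by rewrite mul0r mul1r expr1 addr0 add0r subrr ComplexField.Normc.normc0 ltW.
  by move=> i _; rewrite mul0r.
apply: (@bdry_circle_series _ (fun n => (n == 1%N)%:R) 1) pid _.
  move=> [|[|N]]; rewrite ?big_ord0 ?ler01 // !big_ord_recl ?big_ord0 /=.
    by rewrite ComplexField.Normc.normc0 addr0.
  rewrite big1 => [|i _]; rewrite ComplexField.Normc.normc0 //.
  by rewrite ComplexField.Normc.normc1 add0r addr0.
move=> e e0; exists 2%N => -[|[|n]] // t _; rewrite /ppoly !big_ord_recl big1 /=.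
  by rewrite mul0r mul1r expr1 addr0 add0r subrr ComplexField.Normc.normc0 ltW.
by move=> i _; rewrite mul0r.
Qed.

Lemma nrm2c_one : nrm2 leb (@angles R) (@dtheta R) (fun=> 1) = 1.
Proof.
have := @inner_circle R 0 0; rewrite eqxx.
rewrite (_ : (fun t => circ t ^+ 0) = fun=> 1); last by apply/funext => t; rewrite expr0.
by rewrite inner_self => /(congr1 (@complex.Re R)).
Qed.

Lemma hankel_norm_id_hardy :
  (((Num.sqrt (2 + -1))^-1)%:E <= hankel_norm (-1) (fun z : CC R => z))%E.
Proof.
rewrite /hankel_norm eqxx bdry_id.
have mD := @mangles R; have mw := @mdtheta R; have w0 := @dtheta_ge0 R.
have Lz := @L2_circleX R 1.
have Lu : L2 leb (@angles R) (@dtheta R) (fun t => (circ t)^* * 1).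
  by apply: (L2_eq mD mw w0 _ (L2J mw w0 Lz)) => p _; rewrite mulr1 expr1.
have H1 : hardy_bdry (fun=> 1 : CC R).
  have := @hardy_ppoly R (fun=> 1) 1; rewrite (_ : ppoly _ _ _ = fun=> 1) //.
  by apply/funext => t; rewrite /ppoly big_ord1 expr0 mulr1.
have H0 : hardy_bdry (fun=> 0 : CC R).
  have := @hardy_ppoly R (fun=> 1) 0; rewrite (_ : ppoly _ _ _ = fun=> 0) //.
  by apply/funext => t; rewrite /ppoly big_ord0.
have q0 : (fun t => (circ t)^* * 1) \- (fun=> 0) = (fun t => (circ t)^* * 1).
  by apply/funext => p /=; rewrite subr0.
have og : is_orthproj leb (@angles R) (@dtheta R) (@hardy_bdry R) (fun t => (circ t)^* * 1) (fun=> 0).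
  split => // h Hh; rewrite q0; apply: (hardy_orthogonal Lu _ Hh) => k.
  rewrite inner_symbol; transitivity (L2inner leb (@angles R) (@dtheta R)
    (fun t => circ t ^+ 0) (fun t => circ t ^+ k.+1)).
    by apply: eq_inner => p _; rewrite ?expr0 // exprS.
  by rewrite (@inner_circle R 0 k.+1).
have sub : @hardy_bdry R `<=` L2 leb (@angles R) (@dtheta R) by move=> u [].
have := hankel_opnorm_ge mD mw w0 sub H1 nrm2c_one Lu og.
apply: le_trans; rewrite lee_fin q0.
have -> : nrm2 leb (@angles R) (@dtheta R) (fun t => (circ t)^* * 1) = 1.
  rewrite -nrm2c_one; apply: eq_Rintegral => p _; rewrite mulr1 sqnJ sqn_circle.
  by rewrite sqn1.
by rewrite (_ : 2 + -1 = 1 :> R) ?sqrtr1 ?invr1 //; ring.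
Qed.

Lemma in_A2_one alpha : -1 <= alpha -> in_A2 alpha (fun=> 1 : CC R).
Proof.
move=> ha; rewrite /in_A2; case: eqP => [_|/eqP na].
  split; first exact: holomorphic_cst.
  exists 1 => r _; rewrite /circle_norm.
  by rewrite (L2normE (@mangles R) (@mdtheta R) (@dtheta_ge0 R) (@L2c_one R)) nrm2c_one sqrtr1.
have ha' : -1 < alpha by rewrite lt_def na.
by split; [exact: L2_disc_one|exact: holomorphic_cst].
Qed.

Lemma A2norm_one : A2norm (fun=> 1 : CC R) = 1%E.
Proof.
have h0 := ltrN10 R.
have w0 (p : mR * mR) (_ : D p) : 0 <= dA 0 p := dA_ge0 h0 p.
rewrite /A2norm (L2normE (@measurable_disc R) (@measurable_dA_disc R 0) w0 (L2_disc_one h0)).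
have := inner_disc h0 0 0; rewrite eqxx.
rewrite (_ : (fun p => toC p ^+ 0) = fun=> 1); last by apply/funext => t; rewrite expr0.
by rewrite inner_self => /(congr1 (@complex.Re R)) /= ->; rewrite sqrtr1.
Qed.

End HankelNorm.

Theorem theorem1 (R : realType) (alpha : R) (halpha : -1 <= alpha) :
  (forall psi : CC R -> CC R,
     holomorphic_disc psi -> in_A2 alpha (derive1 psi) ->
     (hankel_norm alpha psi
      <= ((Num.sqrt (2 + alpha))^-1)%:E * A2norm (derive1 psi))%E)
  /\
  (forall c : R, c < (Num.sqrt (2 + alpha))^-1 ->
     ~ (forall psi : CC R -> CC R,
          holomorphic_disc psi -> in_A2 alpha (derive1 psi) ->
          (hankel_norm alpha psi <= c%:E * A2norm (derive1 psi))%E)).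
Proof.
split=> [psi|c hc all]; first exact: hankel_norm_le.
have hid : holomorphic_disc (fun z : CC R => z).
  by move=> z _; have [] := cdiff_derivable (cdiff_id z).
have := all _ hid; rewrite derive1_idC A2norm_one mule1 => /(_ (in_A2_one halpha)).
apply/negP; rewrite -ltNge; apply: lt_le_trans (_ : ((Num.sqrt (2 + alpha))^-1)%:E <= _)%E.
  by rewrite lte_fin.
have [e|na] := eqVneq alpha (-1); first by rewrite e; exact: hankel_norm_id_hardy.
by apply: hankel_norm_id_bergman; rewrite lt_def na.
Qed.
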